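(* Let $M$ be a smooth manifold without boundary. Let $\mathcal{W}$ be any $C^\infty$-open neighborhood of $\mathrm{Id}$ in $\mathrm{Diff}^c_0(M)$. Then there exists $\phi\in\mathcal{W}$ such that $\phi\neq\psi^2$ holds for any $\psi\in\mathrm{Diff}^c(M)$ (where $\psi^2=\psi\circ\psi$). In particular, $\mathcal{W}\setminus\mathrm{Aut}(M)$ is not empty.
   Context: $\mathrm{Diff}^c(M)=\{\phi\in\mathrm{Diff}(M)\mid \mathrm{supp}(\phi)\text{ is compact}\}$ is the set of compactly supported diffeomorphisms of $M$. $\mathrm{Diff}^c_0(M)$ is the connected component of $\mathrm{Diff}^c(M)$ containing $\mathrm{Id}$ (i.e. any element of $\mathrm{Diff}^c_0(M)$ is isotopic to $\mathrm{Id}$). $\Gamma^c(TM)$ is the set of compactly supported vector fields on $M$, $\exp(X)$ denotes the time-$1$ map of the flow of a vector field $X$, and $\mathrm{Aut}(M)=\{\exp(X)\mid X\in\Gamma^c(TM)\}$ is the set of autonomous diffeomorphisms.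
   Formalization: M is assumed nonempty and of dimension at least 1; for M empty or of dimension 0, Diff^c_0(M) = {Id} and Id = Id∘Id, so the claim as literally written fails there. *)

(* Defs.v *)
From HB Require Import structures.
From mathcomp Require Import all_boot all_order all_algebra.
From mathcomp Require Import all_classical all_reals all_analysis.

Set Implicit Arguments.
Unset Strict Implicit.
Unset Printing Implicit Defensive.
Import Order.TTheory GRing.Theory Num.Theory.
Import numFieldNormedType.Exports.
Local Open Scope classical_set_scope.
Local Open Scope ring_scope.

Section Euclidean.
Context {R : realType} {m n : nat}.

(** Iterated partial derivatives along the canonical basis, indexed by a list
    of directions. *)
Fixpoint pder (s : seq 'I_m) (f : 'rV[R]_m -> 'rV[R]_n) : 'rV[R]_m -> 'rV[R]_n :=
  if s is i :: s' then 'D_(delta_mx 0 i) (pder s' f) else f.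

(** C^oo on [U], which is meant to be open: all partial derivatives of all
    orders exist and are continuous at every point of [U]. *)
Definition smooth_on (U : set 'rV[R]_m) (f : 'rV[R]_m -> 'rV[R]_n) : Prop :=
  forall (s : seq 'I_m) (x : 'rV[R]_m), U x ->
    {for x, continuous (pder s f)} /\
    forall i : 'I_m, derivable (pder s f) x (delta_mx 0 i).

End Euclidean.

(** A chart is a homeomorphism from the open set [cdom] onto an open subset of
    R^n.  [cmap] and [cinv] are total functions; their values outside [cdom]
    and [cmap @` cdom] are irrelevant. *)
Record chart (R : realType) (n : nat) (M : topologicalType) := Chart {
  cdom : set M;
  cmap : M -> 'rV[R]_n;
  cinv : 'rV[R]_n -> M;
  cdom_open : open cdom;
  cimg_open : open (cmap @` cdom);
  cmapK : forall x, cdom x -> cinv (cmap x) = x;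
  cmap_continuous : {within cdom, continuous cmap};
  cinv_continuous : {within cmap @` cdom, continuous cinv}
}.

(** Local representative of [f] in the charts [c] (source) and [c'] (target),
    and the set on which it is meaningful. *)
Definition local_rep (R : realType) (n : nat) (M : topologicalType)
    (c c' : chart R n M) (f : M -> M) : 'rV[R]_n -> 'rV[R]_n :=
  cmap c' \o f \o cinv c.

Definition local_dom (R : realType) (n : nat) (M : topologicalType)
    (c c' : chart R n M) (f : M -> M) : set 'rV[R]_n :=
  cmap c @` (cdom c `&` f @^-1` cdom c').

(** Smooth n-manifolds without boundary (Hausdorff, second countable, not
    necessarily connected).  The smooth structure is given by any smooth atlas,
    not necessarily maximal. *)
Record smoothManifold (R : realType) (n : nat) := SmoothManifold {
  carrier :> topologicalType;
  manifold_hausdorff : hausdorff_space carrier;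
  manifold_second_countable : @second_countable carrier;
  atlas : set (chart R n carrier);
  atlas_cover : forall x : carrier, exists2 c, atlas c & cdom c x;
  atlas_compat : forall c c', atlas c -> atlas c' ->
    smooth_on (local_dom c c' id) (local_rep c c' id)
}.

Arguments atlas {R n} s _.

Section Diffeomorphisms.
Context {R : realType} {n : nat} (M : smoothManifold R n).

Definition smooth_map (f : M -> M) : Prop :=
  continuous f /\
  forall c c', atlas M c -> atlas M c' ->
    smooth_on (local_dom c c' f) (local_rep c c' f).

Definition is_diffeo (f : M -> M) : Prop :=
  smooth_map f /\
  exists g : M -> M, [/\ smooth_map g, cancel f g & cancel g f].

Definition supp (f : M -> M) : set M := closure [set x | f x <> x].

Record diffc := Diffc {
  diffc_fun :> M -> M;
  diffc_diffeo : is_diffeo diffc_fun;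
  diffc_compact : compact (supp diffc_fun)
}.

Lemma smooth_map_id : smooth_map id.
Proof. by split=> [x //|c c']; apply: atlas_compat. Qed.

Lemma is_diffeo_id : is_diffeo id.
Proof.
by split; [exact: smooth_map_id | exists id; split => //; exact: smooth_map_id].
Qed.

Lemma compact_supp_id : compact (supp id).
Proof.
rewrite /supp; suff -> : [set x : M | id x <> x] = set0.
  by rewrite closure0; exact: compact0.
by apply/seteqP; split=> x /=.
Qed.

Definition diffc_id : diffc := Diffc is_diffeo_id compact_supp_id.

HB.instance Definition _ := gen_eqMixin diffc.
HB.instance Definition _ := gen_choiceMixin diffc.

(** The diffeomorphisms [g] that are [e]-close to [f], together with all
    partial derivatives up to order [k], on [L] in the charts [c] and [c']. *)
Definition Cinfty_basic (c c' : chart R n M) (L : set M) (k : nat) (e : R)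
    (f : diffc) : set diffc :=
  [set g : diffc | g @` L `<=` cdom c' /\
    forall s : seq 'I_n, (size s <= k)%N -> forall x, L x ->
      `|pder s (local_rep c c' g) (cmap c x)
        - pder s (local_rep c c' f) (cmap c x)| < e].

Definition Cinfty_subbase : set (set diffc) :=
  [set B | exists c c' (L : set M) (k : nat) (e : R) (f : diffc),
    [/\ atlas M c, atlas M c', compact L & L `<=` cdom c] /\
    [/\ f @` L `<=` cdom c', 0 < e & B = Cinfty_basic c c' L k e f]].

(** Compactly supported diffeomorphisms with the topology of uniform convergence
    of all derivatives on compact sets. *)
Definition diffc_weak : Type := diffc.
HB.instance Definition _ := Choice.on diffc_weak.
HB.instance Definition _ :=
  isSubBaseTopological.Build diffc_weak Cinfty_subbase (fun B => B).

Definition diff_supp_in (K : set M) : set diffc :=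
  [set f : diffc | supp f `<=` K].

(** The C^oo topology on compactly supported diffeomorphisms: the direct limit,
    over the compact subsets [K] of [M], of the spaces of diffeomorphisms
    supported in [K], with uniform convergence of all derivatives.  When [M] is
    compact it coincides with the topology of [diffc_weak]. *)
Definition Cinfty_open (U : set diffc) : Prop :=
  forall K : set M, compact K ->
    exists2 O : set diffc_weak,
      open O & U `&` diff_supp_in K = O `&` diff_supp_in K.

Lemma Cinfty_openT : Cinfty_open setT.
Proof. by move=> K _; exists setT => //; exact: openT. Qed.

Lemma Cinfty_openI : setI_closed Cinfty_open.
Proof.
move=> U V Uo Vo K cK.
have [A Ao UA] := Uo K cK; have [B Bo VB] := Vo K cK.
by exists (A `&` B); [exact: openI | rewrite setIIl UA VB -setIIl].
Qed.

Lemma Cinfty_open_bigU (I : Type) (U : I -> set diffc) :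
  (forall i, Cinfty_open (U i)) -> Cinfty_open (\bigcup_i U i).
Proof.
move=> Uo K cK.
have /choice[A AP] : forall i, exists O : set diffc_weak,
    open O /\ U i `&` diff_supp_in K = O `&` diff_supp_in K.
  by move=> i; have [A] := Uo i K cK; exists A.
exists (\bigcup_i A i); first by apply: bigcup_open => i _; case: (AP i).
by rewrite !setI_bigcupl; apply: eq_bigcupr => i _; case: (AP i).
Qed.

HB.instance Definition _ := isOpenTopological.Build diffc
  Cinfty_openT Cinfty_openI Cinfty_open_bigU.

Definition diffc0 : set diffc := connected_component setT diffc_id.

End Diffeomorphisms.

Arguments diffc_id {R n} M.
Arguments diffc0 {R n} M.

Section Autonomous.
Context {R : realType} {n : nat} (M : smoothManifold R n).

(** A smooth vector field is given by its components in the charts of the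
    atlas, related to one another by the differentials of the transition
    maps. *)
Record vfield := VField {
  vcomp :> chart R n M -> M -> 'rV[R]_n;
  vcomp_compat : forall c c' (x : M), atlas M c -> atlas M c' ->
    cdom c x -> cdom c' x ->
    vcomp c' x = 'd (cmap c' \o cinv c) (cmap c x) (vcomp c x);
  vcomp_smooth : forall c, atlas M c ->
    smooth_on (cmap c @` cdom c) (vcomp c \o cinv c)
}.

Definition vsupp (X : vfield) : set M :=
  closure [set x | exists c, [/\ atlas M c, cdom c x & X c x <> 0]].

Definition integral_curve (X : vfield) (gamma : R -> M) : Prop :=
  continuous gamma /\
  forall (c : chart R n M) (t : R), atlas M c -> cdom c (gamma t) ->
    is_derive t 1 (cmap c \o gamma) (X c (gamma t)).

Definition is_flow (X : vfield) (Phi : R -> M -> M) : Prop :=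
  forall x, Phi 0 x = x /\ integral_curve X (Phi ^~ x).

(** The flow of [X]; it exists and is unique when [X] has compact support.  The
    default value, used when [X] is not complete, is constantly [id]. *)
Definition flow (X : vfield) : R -> M -> M :=
  @xget (R -> M -> M) (fun _ => id) (is_flow X).

Definition vexp (X : vfield) : M -> M := flow X 1.

Definition autonomous : set (diffc M) :=
  [set phi : diffc M |
    exists2 X : vfield, compact (vsupp X) & vexp X = phi :> (M -> M)].

End Autonomous.

Arguments autonomous {R n} M.

(* Main.v *)
(** Push into a chart the perturbation id + tau V of the identity of a cube,
    where V vanishes near the boundary of the cube, has the hyperbolic form
    (w_0, - w_1, ..., - w_m) near 0 and -(w - e_0) near e_0, and points from 0
    to e_0 along the segment joining them; for small tau this is a
    diffeomorphism phi close to Id.  A square root psi of phi permutes the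
    isolated fixed points 0 and e_0 of phi; it fixes both, and since it is
    differentiable there and commutes with the linear maps that phi induces
    near them, it is itself linear on the segment near its end points, with
    factors sqrt (1 + tau) and sqrt (1 - tau).  Commutation with phi propagates
    these germs: psi is determined on the segment from the side of 0 as well as
    from the side of e_0.  If psi exists, adding to phi a small kick supported
    in an interval [s, t] of the segment with t < psi(s) leaves both
    determinations unchanged outside [s, t], and these already determine the
    square on [s, t]; hence phi or its kicked version has no such square root.
    The time-1/2 map of a flow need not be known to be a diffeomorphism here:
    that exp(X/2) has the germs above at 0 and e_0 is read off from the vector
    field, which inherits the symmetries of exp(X). *)
From HB Require Import structures.
Require Import Defs.
From mathcomp Require Import all_boot all_order all_algebra.
From mathcomp Require Import all_classical all_reals all_analysis.
From mathcomp Require Import ring lra.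

Set Implicit Arguments.
Unset Strict Implicit.
Unset Printing Implicit Defensive.
Import Order.TTheory GRing.Theory Num.Theory.
Import numFieldNormedType.Exports.
Local Open Scope classical_set_scope.
Local Open Scope ring_scope.

(** * Differential calculus on row vectors *)

(** The shape of the field is dictated by what a root may do at a fixed point. A square root of a
    homothety need not preserve a line, so a homothety at 0 would give no control; the saddle
    singles out the segment as its only expanding direction, and a differentiable map that commutes
    with it must keep the segment near 0, hence everywhere. Once this is known, a homothety at e_0
    is enough, since only the coordinate along the segment has to be followed there. The square does
    not settle the sign of the slope at 0: phi preserves the half cube w_0 <= 0, and a root that
    reversed the segment would trap there the images of orbits that tend to e_0. All maps are id + U
    with U Lipschitz of constant at most 1/2, so that a contraction argument inverts them and affine
    interpolation in U is an isotopy. In dimension one the transverse directions are absent and the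
    same argument applies. *)

Section RowNorm.
Context {R : realType} {n : nat}.
Implicit Types u v : 'rV[R]_n.

Lemma normr_coord_le v i : `|v 0 i| <= `|v|.
Proof.
rewrite [leRHS]/Num.Def.normr/= mx_normrE.
exact: (le_bigmax _ (fun ij => `|v ij.1 ij.2|) (0, i)).
Qed.

Lemma row_norm_le v r : 0 <= r -> (forall i, `|v 0 i| <= r) -> `|v| <= r.
Proof.
move=> r0 H; rewrite [leLHS]/Num.Def.normr/= mx_normrE (bigmax_le _ r0)//= => -[i j] _ /=.
by rewrite (ord1 i).
Qed.

Lemma row_norm_lt v r : 0 < r -> (forall i, `|v 0 i| < r) -> `|v| < r.
Proof.
move=> r0 H; rewrite [ltLHS]/Num.Def.normr/= mx_normrE (bigmax_lt _ r0)//= => -[i j] _ /=.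
by rewrite (ord1 i).
Qed.

End RowNorm.

Section MeanValue.
Context {R : realType}.

Lemma is_derive_line (V : normedModType R) (f : V -> R) (x v : V) (b c : R) :
  derivable f ((c * b) *: v + x) v ->
  is_derive c 1 (fun s : R => f ((s * b) *: v + x))
    (b * 'D_v f ((c * b) *: v + x)).
Proof.
move=> df.
have H : is_derive (c * b) 1 (fun s : R => f (s *: v + x))
    ('D_v f ((c * b) *: v + x)).
  have e : (fun h : R => h^-1 *: (f ((h *: 1 + c * b) *: v + x) - f ((c * b) *: v + x)))
    = (fun h : R => h^-1 *: (f (h *: v + ((c * b) *: v + x)) - f ((c * b) *: v + x))).
    apply/funext => h; congr (_ *: (f _ - _)).
    by rewrite scalerDl addrA /GRing.scale/= mulr1.
  split; first by rewrite /derivable /= e; exact: df.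
  by rewrite /derive /= e.
have H2 : is_derive c 1 (fun s : R => s * b) b.
  have -> : (fun s : R => s * b) = b *: (id : R -> R).
    by apply/funext => s /=; rewrite mulrC.
  by apply: is_derive_eq; rewrite /GRing.scale/= mulr1.
rewrite mulrC.
exact: (@is_derive1_comp _ (fun s : R => f (s *: v + x)) (fun s : R => s * b)).
Qed.

Lemma mean_value_line (V : normedModType R) (f : V -> R) (x v : V) (a b e : R) :
  (forall s : R, 0 <= s <= 1 -> derivable f ((s * b) *: v + x) v /\
     `|'D_v f ((s * b) *: v + x) - a| <= e) ->
  `|f (b *: v + x) - f x - a * b| <= e * `|b|.
Proof.
move=> H.
pose g (s : R) := f ((s * b) *: v + x).
pose dg (s : R) := b * 'D_v f ((s * b) *: v + x).
have dgP (s : R) : 0 <= s <= 1 -> is_derive s 1 g (dg s).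
  by move=> s01; apply: is_derive_line; case: (H s s01).
have [||c /[!in_itv]/= /andP[c0 c1]] :=
  @MVT R g dg 0 1 ltr01.
- by move=> s /[!in_itv]/= /andP[s0 s1]; apply: dgP; rewrite !ltW.
- apply: derivable_within_continuous => s /[!in_itv]/= s01.
  by have := dgP s s01; case.
rewrite /g /dg subr0 mulr1 mul1r mul0r scale0r add0r => ->.
have [|_ D] := H c; first by rewrite !ltW.
by rewrite [a * b]mulrC -mulrBr normrM mulrC ler_wpM2r.
Qed.

(** The path from [z'] to [z] that changes one coordinate at a time stays in the sup-norm ball,
    which is a product of intervals, so partial derivatives suffice. The slopes [a] are left free:
    partial derivatives at [x0] give differentiability, zero gives Lipschitz bounds. *)
Lemma mean_value_cube n (f : 'rV[R]_n -> R) (x0 : 'rV[R]_n) (r e : R)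
    (a : 'I_n -> R) (z z' : 'rV[R]_n) :
  (forall y : 'rV[R]_n, `|y - x0| < r -> forall j, derivable f y (delta_mx 0 j) /\
     `|'D_(delta_mx 0 j) f y - a j| <= e) ->
  `|z - x0| < r -> `|z' - x0| < r ->
  `|f z - f z' - \sum_j a j * (z - z') 0 j| <= e *+ n * `|z - z'|.
Proof.
move=> H zr z'r.
have r0 : 0 < r by exact: le_lt_trans zr.
pose P k : 'rV[R]_n := \row_j (if (j < k)%N then z 0 j else z' 0 j).
have -> : f z = f (P n).
  by congr f; apply/rowP => j; rewrite mxE ltn_ord.
have -> : f z' = f (P 0%N) by congr f; apply/rowP => j; rewrite mxE.
rewrite -(@telescope_sumr _ 0%N n (fun k => f (P k)))// big_mkord -sumrB.
rewrite (le_trans (ler_norm_sum _ _ _))//.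
have -> : e *+ n * `|z - z'| = \sum_(k < n) e * `|z - z'|.
  by rewrite sumr_const card_ord mulrnAl.
apply: ler_sum => k _.
have e0 : 0 <= e by have [_] := H _ zr k; apply: le_trans.
have PS : P k.+1 = ((z - z') 0 k) *: delta_mx 0 k + P k.
  apply/rowP => j; rewrite !mxE eqxx /=.
  have [->|jk] := eqVneq j k; first by rewrite ltnS leqnn ltnn mulr1 subrK.
  by rewrite mulr0 add0r ltnS leq_eqVlt (negPf jk : (j == k :> nat) = false).
rewrite PS.
apply: (le_trans (@mean_value_line _ f (P k) _ (a k) _ e _)); last first.
  by rewrite ler_wpM2l// normr_coord_le.
move=> s /andP[s0 s1]; apply: H; apply: row_norm_lt => // j.
rewrite !mxE eqxx /=.
have zj : `|z 0 j - x0 0 j| < r.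
  by apply: le_lt_trans zr; rewrite -[leRHS]/(`|z - x0|);
    have := normr_coord_le (z - x0) j; rewrite !mxE.
have z'j : `|z' 0 j - x0 0 j| < r.
  by apply: le_lt_trans z'r; have := normr_coord_le (z' - x0) j; rewrite !mxE.
have [jk|jk] := eqVneq j k; last by rewrite mulr0 add0r; case: ifP.
rewrite jk ltnn mulr1.
rewrite -jk.
(* On the coordinate being moved the point is a convex combination, so its distance to [x0] is at
   most the larger of the two end distances. *)
have -> : s * (z 0 j - z' 0 j) + z' 0 j - x0 0 j
  = s * (z 0 j - x0 0 j) + (1 - s) * (z' 0 j - x0 0 j) by ring.
apply: le_lt_trans (ler_normD _ _) _.
rewrite !normrM (ger0_norm s0) (@ger0_norm _ (1 - s)) ?subr_ge0//.
apply: (@le_lt_trans _ _ (Num.max `|z 0 j - x0 0 j| `|z' 0 j - x0 0 j|)).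
  set A := `|z 0 j - _|; set B := `|z' 0 j - _|.
  have hA : A <= Num.max A B by rewrite le_max lexx.
  have hB : B <= Num.max A B by rewrite le_max lexx orbT.
  by nra.
by rewrite gt_max zj z'j.
Qed.

End MeanValue.

Lemma cvg_sum_seq (R : numFieldType) (V : normedModType R) (T I : Type)
    (F : set_system T) (FF : Filter F) (r : seq I) (f : I -> T -> V) (l : I -> V) :
  (forall i, f i x @[x --> F] --> l i) ->
  (\sum_(i <- r) f i x) @[x --> F] --> \sum_(i <- r) l i.
Proof.
move=> fl; elim: r => [|i r IH].
  by rewrite big_nil; under eq_fun do rewrite big_nil; exact: cvg_cst.
by rewrite big_cons; under eq_fun do rewrite big_cons; exact: cvgD.
Qed.

Lemma differentiable_littleo (R : numFieldType) (V W : normedModType R)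
    (f : V -> W) (df : {linear V -> W}) (x : V) :
  continuous df ->
  (forall e, 0 < e -> \forall w \near (0 : V),
     `|f (w + x) - f x - df w| <= e * `|w|) ->
  differentiable f x /\ 'd f x = df :> (V -> W).
Proof.
move=> dfc H.
have E : f \o shift x = cst (f x) + df +o_ (0 : V) id.
  apply/eqaddoP => e e0; near=> w.
  have -> : (f \o shift x - (cst (f x) + df)) w = f (w + x) - f x - df w.
    by rewrite !fctE /= opprD addrA.
  by near: w; exact: H.
have D := diff_unique dfc E.
by split=> //; apply/diff_locallyP; rewrite D.
Unshelve. all: by end_near. Qed.

Lemma near_forall_ord (T : topologicalType) (x : T) n (P : 'I_n -> T -> Prop) :
  (forall j, \forall y \near x, P j y) -> \forall y \near x, forall j, P j y.
Proof. exact: filter_forall. Qed.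

Section Differentiability.
Context {R : realType} {n : nat}.
Implicit Types (f : 'rV[R]_n -> R) (x : 'rV[R]_n).

Definition lincomb (a : 'I_n -> R) (w : 'rV[R]_n) : R := \sum_j a j * w 0 j.

Lemma lincomb_is_linear a : linear (lincomb a).
Proof.
move=> k u v; rewrite /lincomb scaler_sumr -big_split/=; apply: eq_bigr => j _.
by rewrite !mxE /GRing.scale/=; ring.
Qed.

HB.instance Definition _ a :=
  GRing.isLinear.Build R 'rV[R]_n R _ (lincomb a) (lincomb_is_linear a).

Lemma lincomb_continuous a : continuous (lincomb a).
Proof.
move=> x; apply: (@cvg_sum_seq _ _ _ _ (nbhs x) (nbhs_filter x)) => j.
apply: cvgM; first exact: cvg_cst.
exact: coord_continuous.
Qed.

Lemma C1_differentiable f x :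
  (forall j : 'I_n, (\forall y \near x, derivable f y (delta_mx 0 j)) /\
     {for x, continuous ('D_(delta_mx 0 j) f)}) ->
  differentiable f x.
Proof.
move=> H.
apply: (proj1 (@differentiable_littleo _ _ _ _ (lincomb (fun j => 'D_(delta_mx 0 j) f x)) _ _ _)).
  exact: lincomb_continuous.
move=> e e0.
(* [mean_value_cube] loses a factor [n]; dividing by [n.+1] also covers [n = 0]. *)
pose e' := e / n.+1%:R.
have e'0 : 0 < e' by rewrite divr_gt0.
have /nbhs_ballP[r /= r0 B] : \forall y \near x, forall j : 'I_n,
    derivable f y (delta_mx 0 j) /\
    `|'D_(delta_mx 0 j) f y - 'D_(delta_mx 0 j) f x| <= e'.
  apply: near_forall_ord => j; have [d c] := H j.
  near=> y; split; first by near: y.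
  by near: y; move/cvgrPdist_le : c => /(_ _ e'0); under eq_near do rewrite distrC.
near=> w.
have := @mean_value_cube R n f x r e' (fun j => 'D_(delta_mx 0 j) f x) (w + x) x.
rewrite addrK subrr normr0 => K.
apply: le_trans (K _ _ r0) _.
- by move=> y yr j; apply: B; rewrite -ball_normE /= distrC.
- near: w; apply/nbhs_ballP; exists r => //= w; rewrite -ball_normE /= sub0r normrN //.
- rewrite ler_wpM2r// /e' -mulrnAr -[leRHS]mulr1 ler_wpM2l//; first exact: ltW.
  by rewrite -mulr_natl ler_pdivrMr// mul1r ler_nat.
Unshelve. all: by end_near. Qed.

End Differentiability.

Lemma cvg_rV (R : realType) n (T : Type) (F : set_system T) (FF : Filter F)
    (f : T -> 'rV[R]_n) (l : 'rV[R]_n) :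
  (forall j, f x 0 j @[x --> F] --> l 0 j) -> f @ F --> l.
Proof.
move=> H; apply/cvgrPdist_le => e e0.
have : \forall x \near F, forall j, `|l 0 j - f x 0 j| <= e.
  by apply: filter_forall => j; move/cvgrPdist_le : (H j) => /(_ _ e0).
apply: filterS => x K; apply: row_norm_le; first exact: ltW.
by move=> j; rewrite !mxE.
Qed.

Lemma continuous_rV (R : realType) n (T : topologicalType) (f : T -> 'rV[R]_n)
    (x : T) :
  (forall j, {for x, continuous (fun y => f y 0 j)}) -> {for x, continuous f}.
Proof. by move=> H; apply: (@cvg_rV _ _ _ (nbhs x) (nbhs_filter x)). Qed.

(** * Functions of class C^k on open sets *)

Section Ck.
Context {R : realType}.

(** The recursion removes the innermost derivative, whereas [pder] adds the outermost one: in this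
    form sums, products and compositions are handled by induction on [k]. [pder_rcons] links the
    two. *)
Fixpoint Ck {m} {W : normedModType R} (k : nat) (U : set 'rV[R]_m)
    (f : 'rV[R]_m -> W) : Prop :=
  (forall x, U x -> {for x, continuous f}) /\
  (if k is k'.+1 then forall i : 'I_m,
     (forall x, U x -> derivable f x (delta_mx 0 i)) /\
     Ck k' U ('D_(delta_mx 0 i) f) else True).

Section Local.
Context {m : nat} {W : normedModType R}.
Implicit Types (U V : set 'rV[R]_m) (f g : 'rV[R]_m -> W).

Lemma Ck_continuous k U f x : Ck k U f -> U x -> {for x, continuous f}.
Proof. by case: k => [|k] [c _]; exact: c. Qed.

Lemma CkW k U f : Ck k.+1 U f -> Ck k U f.
Proof.
elim: k f => [|k IH] f [c H]; split=> // i.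
by have [d K] := H i; split => //; exact: IH.
Qed.

Lemma Ck_eq k U f g : open U -> (forall x, U x -> f x = g x) ->
  Ck k U f -> Ck k U g.
Proof.
move=> oU; have nearU x h h' : U x -> (forall x, U x -> h x = h' x) ->
    \forall y \near x, (h : 'rV[R]_m -> W) y = h' y.
  by move=> Ux E; apply: filterS (open_nbhs_nbhs (conj oU Ux)).
elim: k f g => [|k IH] f g fg.
  move=> [c _]; split => // x Ux.
  rewrite /prop_for /continuous_at -fg//; apply: cvg_trans (c x Ux).
  exact: (near_eq_cvg (nearU _ _ _ Ux fg)).
move=> [c H]; split => [x Ux|i].
  rewrite /prop_for /continuous_at -fg//; apply: cvg_trans (c x Ux).
  exact: (near_eq_cvg (nearU _ _ _ Ux fg)).
have [d K] := H i; split => [x Ux|].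
  exact: (@near_eq_derivable _ _ _ f g x _ (nearU _ _ _ Ux fg) (d x Ux)).
by apply: IH K => x Ux; exact: (@near_eq_derive _ _ _ f g x _ (nearU _ _ _ Ux fg)).
Qed.

End Local.

Section Basics.
Context {m : nat}.
Implicit Types (U V : set 'rV[R]_m) (f g : 'rV[R]_m -> R).

Lemma Ck_differentiable k U f x : open U -> Ck k.+1 U f -> U x ->
  differentiable f x.
Proof.
move=> oU [c H] Ux; apply: C1_differentiable => j; have [d K] := H j.
split; last exact: Ck_continuous K Ux.
by apply: filterS (open_nbhs_nbhs (conj oU Ux)).
Qed.

Lemma Ck_cst k U (c : R) : Ck k U (fun=> c).
Proof.
elim: k c => [|k IH] c; first by split => // x _; exact: cst_continuous.
split => [x _|i]; first exact: cst_continuous.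
split => [x _|]; first exact: derivable_cst.
have -> : 'D_(delta_mx 0 i) (fun=> c) = (fun _ : 'rV[R]_m => 0 : R).
  by apply/funext => x; exact: derive_cst.
exact: IH.
Qed.

Lemma is_derive_coord (x v : 'rV[R]_m) j :
  is_derive x v (fun y : 'rV[R]_m => y 0 j) (v 0 j).
Proof.
have did : derivable (id : 'rV[R]_m -> 'rV[R]_m) x v by exact: derivable_id.
have := derive_mx did.
have /derivable_mxP/(_ 0 j) d := did.
rewrite derive_id => /matrixP/(_ 0 j); rewrite mxE => E.
by split.
Qed.

Lemma Ck_coord k U j : Ck k U (fun x => x 0 j).
Proof.
case: k => [|k]; first by split => // x _; exact: coord_continuous.
split => [x _|i]; first exact: coord_continuous.
split => [x _|]; first by case: (is_derive_coord x (delta_mx 0 i) j).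
have -> : 'D_(delta_mx 0 i) (fun x : 'rV[R]_m => x 0 j) =
          fun=> (delta_mx 0 i : 'rV[R]_m) 0 j.
  by apply/funext => x; case: (is_derive_coord x (delta_mx 0 i) j).
exact: Ck_cst.
Qed.

Lemma CkD k U f g : open U -> Ck k U f -> Ck k U g ->
  Ck k U (fun x => f x + g x).
Proof.
move=> oU; elim: k f g => [|k IH] f g [cf Hf] [cg Hg].
  by split => // x Ux; apply: continuousD; [exact: cf|exact: cg].
split => [x Ux|i]; first by apply: continuousD; [exact: cf|exact: cg].
have [df Kf] := Hf i; have [dg Kg] := Hg i; split => [x Ux|].
  by apply: derivableD; [exact: df|exact: dg].
apply: Ck_eq (IH _ _ Kf Kg) => // x Ux.
by rewrite deriveD; [|exact: df|exact: dg].
Qed.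

Lemma CkM k U f g : open U -> Ck k U f -> Ck k U g ->
  Ck k U (fun x => f x * g x).
Proof.
move=> oU; elim: k f g => [|k IH] f g [cf Hf] [cg Hg].
  by split => // x Ux; apply: continuousM; [exact: cf|exact: cg].
split => [x Ux|i]; first by apply: continuousM; [exact: cf|exact: cg].
have [df Kf] := Hf i; have [dg Kg] := Hg i; split => [x Ux|].
  by apply: derivableM; [exact: df|exact: dg].
have W (h : 'rV[R]_m -> R) (ch : forall x, U x -> {for x, continuous h})
    (Hh : forall i : 'I_m, (forall x, U x -> derivable h x (delta_mx 0 i)) /\
      Ck k U ('D_(delta_mx 0 i) h)) : Ck k U h by exact: CkW.
apply: Ck_eq (CkD oU (IH _ _ (W _ cf Hf) Kg) (IH _ _ (W _ cg Hg) Kf)) => // x Ux.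
by rewrite deriveM; [|exact: df|exact: dg].
Qed.

Lemma Ck_sum k U (I : Type) (s : seq I) (F : I -> 'rV[R]_m -> R) : open U ->
  (forall i, Ck k U (F i)) -> Ck k U (fun x => \sum_(i <- s) F i x).
Proof.
move=> oU H; elim: s => [|i s IH].
  by under eq_fun do rewrite big_nil; exact: Ck_cst.
by under eq_fun do rewrite big_cons; exact: CkD.
Qed.

Lemma Ck_prod k U (I : Type) (s : seq I) (F : I -> 'rV[R]_m -> R) : open U ->
  (forall i, Ck k U (F i)) -> Ck k U (fun x => \prod_(i <- s) F i x).
Proof.
move=> oU H; elim: s => [|i s IH].
  by under eq_fun do rewrite big_nil; exact: Ck_cst.
by under eq_fun do rewrite big_cons; exact: CkM.
Qed.

Lemma CkN k U f : open U -> Ck k U f -> Ck k U (fun x => - f x).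
Proof.
move=> oU H; apply: Ck_eq (CkM oU (Ck_cst k U (-1)) H) => // x _.
by rewrite mulN1r.
Qed.

Lemma CkB k U f g : open U -> Ck k U f -> Ck k U g ->
  Ck k U (fun x => f x - g x).
Proof. by move=> oU Hf Hg; apply: CkD => //; exact: CkN. Qed.

End Basics.

Lemma differentiable_rV m n (f : 'rV[R]_m -> 'rV[R]_n) x :
  (forall j, differentiable (fun y => f y 0 j) x) -> differentiable f x.
Proof.
move=> H.
have -> : f = fun y => \sum_j (f y 0 j) *: (delta_mx 0 j : 'rV[R]_n).
  by apply/funext => y; exact: row_sum_delta.
have -> : (fun y => \sum_j f y 0 j *: (delta_mx 0 j : 'rV[R]_n)) =
   \sum_j (fun y => f y 0 j *: (delta_mx 0 j : 'rV[R]_n)).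
  by apply/funext => y; rewrite fct_sumE.
by apply: differentiable_sum => j; exact: differentiableZl.
Qed.

Lemma derive_comp_rV m n (f : 'rV[R]_m -> 'rV[R]_n) (g : 'rV[R]_n -> R)
    (x v : 'rV[R]_m) :
  (forall j, differentiable (fun y => f y 0 j) x) -> differentiable g (f x) ->
  derivable (g \o f) x v /\
  'D_v (g \o f) x = \sum_j 'D_v (fun y => f y 0 j) x * 'D_(delta_mx 0 j) g (f x).
Proof.
move=> fd gd; have df := differentiable_rV fd.
have dgf : differentiable (g \o f) x by exact: differentiable_comp.
split; first exact: diff_derivable.
rewrite deriveE// diff_comp//= -[X in 'd g _ X](@deriveE _ _ _ f x v)//.
have dfv : derivable f x v by exact: diff_derivable.
rewrite (derive_mx dfv) [X in 'd g _ X](row_sum_delta (\matrix_(i, j) _)).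
rewrite linear_sum; apply: eq_bigr => j _.
by rewrite linearZ/= mxE -deriveE.
Qed.

(** The chain rule expresses a partial derivative of [g \o f] through those of [f] and the
    composites of those of [g] with [f], to which the induction hypothesis on [k] applies. *)
Lemma Ck_comp m n k (U : set 'rV[R]_m) (V : set 'rV[R]_n)
    (f : 'rV[R]_m -> 'rV[R]_n) (g : 'rV[R]_n -> R) :
  open U -> open V -> (forall j, Ck k U (fun x => f x 0 j)) -> Ck k V g ->
  (forall x, U x -> V (f x)) -> Ck k U (g \o f).
Proof.
move=> oU oV; elim: k g => [|k IH] g Hf Hg UV.
  split => // x Ux; apply: continuous_comp; last exact: Ck_continuous Hg (UV _ Ux).
  by apply: continuous_rV => j; exact: Ck_continuous (Hf j) Ux.
split => [x Ux|i].
  apply: continuous_comp; last exact: Ck_continuous Hg (UV _ Ux).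
  by apply: continuous_rV => j; exact: Ck_continuous (Hf j) Ux.
have [cg Kg] := Hg.
have fd x : U x -> forall j, differentiable (fun y => f y 0 j) x.
  by move=> Ux j; exact: Ck_differentiable (Hf j) Ux.
have D x : U x -> _ := fun Ux => derive_comp_rV (delta_mx 0 i) (fd x Ux)
  (Ck_differentiable oV Hg (UV _ Ux)).
split => [x Ux|]; first by case: (D x Ux).
apply: (@Ck_eq _ _ _ _ (fun x => \sum_j 'D_(delta_mx 0 i) (fun y => f y 0 j) x *
   ('D_(delta_mx 0 j) g \o f) x)) => //.
  by move=> x Ux; case: (D x Ux).
apply: Ck_sum => // j; apply: CkM => //.
  by have [_ /(_ i)[]] := Hf j.
apply: IH => // [j'|]; first exact: CkW.
by have [] := Kg j.
Qed.

(** The scalar function belongs to a family [H] stable under differentiation, so that the induction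
    on [k] never names a higher derivative. The families used are the multiples of inverse powers
    and the flat functions. *)
Lemma Ck_comp1 m k (U : set 'rV[R]_m) (W : set R) (H : set (R -> R))
    (a : 'rV[R]_m -> R) h :
  open U ->
  (forall h, H h -> exists2 h', H h' & forall y, W y -> is_derive y 1 h (h' y)) ->
  H h -> (forall x, U x -> W (a x)) -> Ck k U a -> Ck k U (h \o a).
Proof.
move=> oU HH; elim: k h => [|k IH] h Hh aW Ca.
  have [h' Hh' hd] := HH h Hh.
  split => // x Ux; apply: continuous_comp; first exact: Ck_continuous Ca Ux.
  by apply: differentiable_continuous; apply/derivable1_diffP; case: (hd _ (aW _ Ux)).
have [h' Hh' hd] := HH h Hh.
have ch x (Ux : U x) : {for x, continuous (h \o a)} by
  apply: continuous_comp; [exact: Ck_continuous Ca Ux|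
    apply: differentiable_continuous; apply/derivable1_diffP; case: (hd _ (aW _ Ux))].
split => // i.
have D x (Ux : U x) : is_derive x (delta_mx 0 i) (h \o a)
    (h' (a x) * 'D_(delta_mx 0 i) a x).
  have da : differentiable a x by exact: Ck_differentiable Ca Ux.
  have [e1 e2] := hd _ (aW _ Ux).
  have dh : differentiable h (a x) by apply/derivable1_diffP.
  have dha : differentiable (h \o a) x by exact: differentiable_comp.
  split; first exact: diff_derivable.
  rewrite deriveE// diff_comp//= -[X in 'd h _ X](@deriveE _ _ _ a x _)//.
  rewrite -[X in 'd h _ X]mulr1 -[X in 'd h _ X]/(_ *: 1) linearZ/= -deriveE// e2.
  by rewrite /GRing.scale/= mulrC.
split => [x Ux|]; first by case: (D x Ux).
apply: (@Ck_eq _ _ _ _ (fun x => (h' \o a) x * 'D_(delta_mx 0 i) a x)) => //.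
  by move=> x Ux; case: (D x Ux).
apply: CkM => //; last by have [_ /(_ i)[]] := Ca.
by apply: IH => //; exact: CkW.
Qed.

End Ck.

Section SmoothOn.
Context {R : realType}.

Lemma Ck_rV m n k (U : set 'rV[R]_m) (f : 'rV[R]_m -> 'rV[R]_n) : open U ->
  Ck k U f <-> forall j, Ck k U (fun x => f x 0 j).
Proof.
move=> oU.
have cj g x j : {for x, continuous (g : 'rV[R]_m -> 'rV[R]_n)} ->
    {for x, continuous (fun y => g y 0 j)}.
  by move=> c; apply: (@continuous_comp _ _ _ g (fun v : 'rV[R]_n => v 0 j)) => //;
    exact: coord_continuous.
elim: k f => [|k IH] f.
  split=> [[c _] j|H]; first by split => // x Ux; exact/cj/c.
  by split => // x Ux; apply: continuous_rV => j; have [c _] := H j; exact: c.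
have E i x j : derivable f x (delta_mx 0 i) ->
    ('D_(delta_mx 0 i) f) x 0 j = 'D_(delta_mx 0 i) (fun y => f y 0 j) x.
  by move=> d; rewrite (derive_mx d) mxE.
split=> [[c H] j|H].
  split=> [x Ux|i]; first exact/cj/c.
  have [d K] := H i; split=> [x Ux|]; first by move/derivable_mxP: (d x Ux).
  move/IH : K => /(_ j); apply: Ck_eq => // x Ux; exact/E/d.
split=> [x Ux|i]; first by apply: continuous_rV => j; have [c _] := H j; exact: c.
have d x : U x -> derivable f x (delta_mx 0 i).
  move=> Ux; apply/derivable_mxP => a j; rewrite (ord1 a).
  by have [_ /(_ i)[d _]] := H j; exact: d.
split=> //; apply/IH => j; have [_ /(_ i)[_ K]] := H j.
by apply: Ck_eq K => // x Ux; rewrite E//; exact: d.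
Qed.

Lemma pder_rcons m n (s : seq 'I_m) i (f : 'rV[R]_m -> 'rV[R]_n) :
  pder (rcons s i) f = pder s ('D_(delta_mx 0 i) f).
Proof. by elim: s => //= j s ->. Qed.

Lemma smooth_onP m n (U : set 'rV[R]_m) (f : 'rV[R]_m -> 'rV[R]_n) :
  smooth_on U f <-> forall k, Ck k U f.
Proof.
split=> H.
  move=> k; elim: k f H => [|k IH] f H.
    by split => // x Ux; case: (H [::] x Ux).
  split=> [x Ux|i]; first by case: (H [::] x Ux).
  split=> [x Ux|]; first by case: (H [::] x Ux) => _ /(_ i).
  by apply: IH => s x Ux; rewrite -pder_rcons; exact: H.
move=> s; elim/last_ind: s f H => [|s i IH] f H x Ux.
  by have [c K] := H 1%N; split; [exact: c|move=> i; have [d _] := K i; exact: d].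
rewrite pder_rcons; apply: IH => // k.
by have [_ /(_ i)[]] := H k.+1.
Qed.

Lemma smooth_on_coordP m n (U : set 'rV[R]_m) (f : 'rV[R]_m -> 'rV[R]_n) :
  open U -> smooth_on U f <-> forall k j, Ck k U (fun x => f x 0 j).
Proof.
move=> oU; split=> [/smooth_onP H k|H]; first by apply/Ck_rV.
by apply/smooth_onP => k; apply/Ck_rV.
Qed.

Lemma smooth_on_local m n (U : set 'rV[R]_m) (f : 'rV[R]_m -> 'rV[R]_n) :
  (forall x, U x -> exists2 V, V x & smooth_on V f) -> smooth_on U f.
Proof. by move=> H s x Ux; have [V Vx K] := H x Ux; exact: K. Qed.

Lemma smooth_on_sub m n (U V : set 'rV[R]_m) (f : 'rV[R]_m -> 'rV[R]_n) :
  U `<=` V -> smooth_on V f -> smooth_on U f.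
Proof. by move=> UV H s x /UV; exact: H. Qed.

Lemma smooth_on_eq m n (U : set 'rV[R]_m) (f g : 'rV[R]_m -> 'rV[R]_n) :
  open U -> (forall x, U x -> f x = g x) -> smooth_on U f -> smooth_on U g.
Proof.
by move=> oU fg /smooth_onP H; apply/smooth_onP => k; exact: Ck_eq (H k).
Qed.

Lemma smooth_on_comp l m n (U : set 'rV[R]_l) (V : set 'rV[R]_m)
    (f : 'rV[R]_l -> 'rV[R]_m) (g : 'rV[R]_m -> 'rV[R]_n) :
  open U -> open V -> smooth_on U f -> smooth_on V g ->
  (forall x, U x -> V (f x)) -> smooth_on U (g \o f).
Proof.
move=> oU oV /smooth_on_coordP Hf /smooth_on_coordP Hg UV.
apply/smooth_on_coordP => // k j.
by apply: (@Ck_comp _ _ _ _ U V f (fun x => g x 0 j)) => //; [move=> i; exact: Hf|exact: Hg].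
Qed.

(** With the parameter placed in front of the space variables, spatial derivatives at a frozen
    parameter are partial derivatives of the joint map. This is how continuity in time of all
    spatial derivatives is deduced from joint smoothness. *)
Lemma pder_row_mx m n p (s : seq 'I_m) (f : 'rV[R]_(p + m) -> 'rV[R]_n)
    (t : 'rV[R]_p) x :
  pder s (fun y => f (row_mx t y)) x =
  pder (map (@rshift p m) s) f (row_mx t x).
Proof.
elim: s x => //= i s IH x.
apply: (congr1 (fun F : R -> 'rV[R]_n => lim (F @ 0^'))); apply/funext => h /=.
rewrite !IH; congr (_ *: (pder _ _ _ - _)).
apply/rowP => j; rewrite [RHS]mxE [X in _ = X + _]mxE [X in _ = _ * X + _]mxE.
by case: (split_ordP j) => k ->; rewrite ?row_mxEl ?row_mxEr ?mxE eq_shift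
  ?andbF ?mulr0 ?add0r.
Qed.

End SmoothOn.

(** Makes row vectors a complete normed space, as [banach_fixed_point] requires. *)
HB.instance Definition _ (R : realType) m n := Complete.on 'M[R]_(m, n).

(** * Inverses of small perturbations of the identity *)

Section InverseMatrix.
Context {R : realType} {m : nat}.

Lemma Ck_inv k (U : set 'rV[R]_m) (a : 'rV[R]_m -> R) : open U ->
  (forall x, U x -> a x != 0) -> Ck k U a -> Ck k U (fun x => (a x)^-1).
Proof.
move=> oU a0 Ca.
pose H : set (R -> R) := [set h | exists (c : R) l, h = fun y => c * y ^- l.+1].
have : Ck k U ((fun y : R => 1 * y ^- 1) \o a).
  apply: (@Ck_comp1 _ _ _ U [set y | y != 0] H) => //; last by exists 1, 0%N.
  move=> _ [c [l ->]]; exists (fun y => (- c * l.+1%:R) * y ^- l.+2).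
    by exists (- c * l.+1%:R), l.+1.
  move=> y /= y0.
  have dX : is_derive y 1 (fun z : R => z ^+ l.+1) (l.+1%:R * y ^+ l).
    split; first exact: exprn_derivable.
    by rewrite exp_derive /GRing.scale/= mulr1 mulr_natl.
  have yl0 : y ^+ l.+1 != 0 by rewrite expf_neq0.
  have -> : (fun y : R => c * y ^- l.+1) = c *: (fun z : R => (z ^+ l.+1)^-1).
    by apply/funext.
  have dV := @is_deriveV _ (fun z : R => z ^+ l.+1) y _ 1 yl0 dX.
  apply: is_derive_eq; rewrite /GRing.scale/= !exprS; field.
  by rewrite y0 expf_neq0.
by apply: Ck_eq => // x Ux /=; rewrite mul1r expr1.
Qed.

Lemma Ck_det n k (U : set 'rV[R]_m) (A : 'rV[R]_m -> 'M[R]_n) : open U ->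
  (forall i j, Ck k U (fun x => A x i j)) -> Ck k U (fun x => \det (A x)).
Proof.
move=> oU H; rewrite /determinant; apply: Ck_sum => // s.
by apply: CkM => //; [exact: Ck_cst|exact: Ck_prod].
Qed.

(** By Cramer's rule the entries are rational in those of [A], with denominator [\det (A x)]. *)
Lemma Ck_invmx n k (U : set 'rV[R]_m) (A : 'rV[R]_m -> 'M[R]_n) : open U ->
  (forall x, U x -> A x \in unitmx) ->
  (forall i j, Ck k U (fun x => A x i j)) ->
  forall i j, Ck k U (fun x => invmx (A x) i j).
Proof.
move=> oU uA H i j.
apply: (@Ck_eq _ _ _ _ _ (fun x => (\det (A x))^-1 *
   ((-1) ^+ (j + i) * \det (row' j (col' i (A x)))))) => //.
  by move=> x Ux; rewrite /invmx uA// !mxE.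
apply: CkM => //.
  apply: Ck_inv => //; last exact: Ck_det.
  by move=> x Ux; have := uA x Ux; rewrite unitmxE unitfE.
apply: CkM => //; first exact: Ck_cst.
apply: Ck_det => // a b.
by under eq_fun do rewrite !mxE; exact: H.
Qed.

End InverseMatrix.

Section InverseMap.
Context {R : realType} {n : nat}.
Variable U : 'rV[R]_n -> 'rV[R]_n.
Hypothesis Ulip : forall x y, `|U x - U y| <= 2^-1 * `|x - y|.
Hypothesis Usm : smooth_on setT U.

Let Phi x := x + U x.

Lemma perturb_expanding x y : `|x - y| <= 2 * `|Phi x - Phi y|.
Proof.
have := Ulip x y.
have -> : x - y = (Phi x - Phi y) - (U x - U y).
  by rewrite /Phi opprD addrACA addrK.
have := ler_normB (Phi x - Phi y) (U x - U y).
by move=> h1 h2; lra.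
Qed.

Lemma perturb_surjective y : exists x, Phi x = y.
Proof.
(* The solutions of [Phi x = y] are the fixed points of this 1/2-contraction. *)
pose T x := y - U x.
have hT : {homo T : x / [set: 'rV[R]_n] x >-> [set: 'rV[R]_n] x} by [].
have [|||x _ xE] := @banach_fixed_point R 'rV[R]_n setT (mkfun_fun hT).
- exists (2^-1)%:nng; split => /=; first by rewrite invf_lt1// ltr1n.
  move=> [a b] _ /=; rewrite /mkfun /T /=.
  by rewrite opprB addrC subrKA distrC; exact: Ulip.
- exact: closedT.
- by exists 0.
by exists x; rewrite /Phi {1}xE /= /mkfun /T subrK.
Qed.

(** The transpose of the usual Jacobian matrix, since differentials act on row vectors by right
    multiplication. *)
Definition jacobi x : 'M[R]_n :=
  \matrix_(i, j) 'D_(delta_mx 0 i) (fun y => Phi y 0 j) x.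

Lemma perturb_Ck k j : Ck k setT (fun x => Phi x 0 j).
Proof.
have -> : (fun x => Phi x 0 j) = (fun x => x 0 j + U x 0 j).
  by apply/funext => x; rewrite mxE.
apply: CkD; [exact: openT|exact: Ck_coord|].
by move/smooth_on_coordP : Usm; apply; exact: openT.
Qed.

Lemma perturb_differentiable x : differentiable Phi x.
Proof.
apply: differentiable_rV => j.
exact: (Ck_differentiable openT (perturb_Ck 1 j)).
Qed.

Lemma perturb_diff x w : 'd Phi x w = w *m jacobi x.
Proof.
rewrite [w in LHS]row_sum_delta linear_sum/=; apply/rowP => j.
rewrite summxE mxE; apply: eq_bigr => i _.
rewrite linearZ/= mxE [in RHS]mxE; congr (_ * _).
rewrite -deriveE; last exact: perturb_differentiable.
have d : derivable Phi x (delta_mx 0 i).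
  exact/diff_derivable/perturb_differentiable.
by rewrite (derive_mx d) mxE.
Qed.

(** Difference quotients of [perturb_expanding], in the limit; this makes the Jacobian injective,
    hence invertible. *)
Lemma perturb_diff_expanding x w : `|w| <= 2 * `|'d Phi x w|.
Proof.
have d : derivable Phi x w by exact/diff_derivable/perturb_differentiable.
rewrite -deriveE; last exact: perturb_differentiable.
have H : (2 * `|h^-1 *: ((Phi \o shift x) (h *: w) - Phi x)|) @[h --> (0:R)^'] -->
  2 * `|'D_w Phi x|.
  by apply: cvgM; [exact: cvg_cst|exact: cvg_norm].
rewrite -(cvg_lim _ H)//; apply: limr_ge; first by apply/cvg_ex; eexists; exact: H.
near=> h.
have h0 : h != 0 by near: h; exact: nbhs_dnbhs_neq.
have := perturb_expanding (h *: w + x) x; rewrite addrK normrZ => K.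
by rewrite normrZ normfV mulrCA ler_pdivlMl ?normr_gt0.
Unshelve. all: by end_near. Qed.

Lemma jacobi_unit x : jacobi x \in unitmx.
Proof.
rewrite -row_free_unit -kermx_eq0; apply/eqP/row_matrixP => i.
rewrite row0; apply/eqP; rewrite -normr_le0.
apply: le_trans (perturb_diff_expanding x _) _.
by rewrite perturb_diff -row_mul mulmx_ker row0 normr0 mulr0.
Qed.

(** Once [Psi] is differentiable with differential the inverse Jacobian at [Psi y], its partial
    derivatives are smooth functions composed with [Psi]: each order of regularity of [Psi] yields
    the next one. *)
Lemma perturb_inverse : exists Psi : 'rV[R]_n -> 'rV[R]_n,
  [/\ cancel Phi Psi, cancel Psi Phi & smooth_on setT Psi].
Proof.
have [Psi PhiK] := choice perturb_surjective.
have PhiI : injective Phi.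
  move=> x y E; apply/eqP; rewrite -subr_eq0 -normr_le0.
  by apply: le_trans (perturb_expanding x y) _; rewrite E subrr normr0 mulr0.
have PsiK : cancel Phi Psi by move=> x; apply: PhiI; rewrite PhiK.
exists Psi; split; [exact: PsiK|exact: PhiK|].
have Plip x y : `|Psi x - Psi y| <= 2 * `|x - y|.
  by apply: le_trans (perturb_expanding _ _) _; rewrite !PhiK.
have PD y : differentiable Psi y /\
    'd Psi y = mulmxr (invmx (jacobi (Psi y))) :> ('rV[R]_n -> 'rV[R]_n).
  have Mc : continuous (mulmxr (invmx (jacobi (Psi y))) : 'rV[R]_n -> 'rV[R]_n).
    move=> v; apply: continuous_rV => j.
    have -> : (fun y0 => mulmxr (invmx (jacobi (Psi y))) (y0 : 'rV[R]_n) 0 j) =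
        lincomb (fun k => invmx (jacobi (Psi y)) k j).
      by apply/funext => z; rewrite /= mxE; apply: eq_bigr => k _; rewrite mulrC.
    exact: lincomb_continuous.
  apply: differentiable_littleo => // e e0.
  have [C C0 CP] := linear_lipschitz Mc.
  pose e' := e / (2 * C).
  have e'0 : 0 < e' by rewrite divr_gt0// mulr_gt0.
  have /diff_locallyP[_ /eqaddoP/(_ _ e'0)] := perturb_differentiable (Psi y).
  move=> /nbhs_ballP[r /= r0 B].
  apply/nbhs_ballP; exists (r / 2) => /=; first by rewrite divr_gt0.
  move=> w; rewrite -ball_normE /= sub0r normrN => wr.
  set u := Psi (w + y) - Psi y.
  have uw : `|u| <= 2 * `|w| by apply: le_trans (Plip _ _) _; rewrite addrK.
  have /B : ball 0 r u.
    rewrite -ball_normE /= sub0r normrN; apply: le_lt_trans uw _.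
    by rewrite mulrC -ltr_pdivlMr.
  rewrite !fctE /= subrK PhiK PhiK perturb_diff => K.
  have -> : u - w *m invmx (jacobi (Psi y)) =
    - mulmxr (invmx (jacobi (Psi y))) ((w + y) - (y + u *m jacobi (Psi y))).
    rewrite /= opprD addrA addrK mulmxBl mulmxK ?jacobi_unit//.
    by rewrite opprB.
  rewrite normrN; apply: le_trans (CP _) _.
  rewrite -ler_pdivlMl//; apply: le_trans K _.
  apply: le_trans (ler_wpM2l (ltW e'0) uw) _.
  suff -> : e' * (2 * `|w|) = C^-1 * (e * `|w|) by [].
  by rewrite /e'; field; rewrite gt_eqF.
have Pcont : continuous Psi.
  by move=> y; apply: differentiable_continuous; case: (PD y).
have PE i : 'D_(delta_mx 0 i) Psi =
    (fun x => delta_mx 0 i *m invmx (jacobi x)) \o Psi.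
  by apply/funext => y; have [d E] := PD y; rewrite deriveE// E.
apply/smooth_onP; elim => [|k IH].
  by split=> // y _; exact: Pcont.
split=> [y _|i]; first exact: Pcont.
split=> [y _|]; first by apply: diff_derivable; case: (PD y).
rewrite PE; apply/Ck_rV; first exact: openT.
move=> j; apply: (@Ck_comp _ _ _ _ setT setT Psi
  (fun x => (delta_mx 0 i *m invmx (jacobi x)) 0 j)) => //; try exact: openT.
  by apply/Ck_rV => //; exact: openT.
apply: (@Ck_eq _ _ _ _ _ (fun x => invmx (jacobi x) i j)); first exact: openT.
  by move=> x _; rewrite -rowE mxE.
apply: Ck_invmx; [exact: openT|by move=> x _; exact: jacobi_unit|].
move=> a b; under eq_fun do rewrite mxE.
by have [_ /(_ a)[_]] := perturb_Ck k.+1 b.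
Qed.

End InverseMap.

(** * Bump functions and the perturbing fields *)

Section Flat.
Context {R : realType}.

(* Polynomials in 1/x times exp(-1/x): a family closed under differentiation. *)
Definition flat (p : {poly R}) (x : R) : R :=
  if 0 < x then p.[x^-1] * expR (- x^-1) else 0.

Lemma flat_monomial_le k (y : R) : 0 < y ->
  `|flat 'X^k y| <= k.+1%:R ^+ k.+1 * y.
Proof.
move=> y0; rewrite /flat y0 hornerXn ger0_norm; last first.
  by rewrite mulr_ge0 ?expR_ge0// exprn_ge0// invr_ge0 ltW.
have u0 : 0 < y^-1 by rewrite invr_gt0.
rewrite expRN ler_pdivrMr ?expR_gt0//.
(* With [u = y^-1], the bound [u ^+ k * expR (- u) <= k.+1 ^+ k.+1 / u] comes from [v <= expR v] at
   [v = u / k.+1], raised to the power [k.+1]. *)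
have -> : expR y^-1 = expR (y^-1 / k.+1%:R) ^+ k.+1.
  by rewrite -expRM_natl mulrC divfK.
have le1 : (y^-1 / k.+1%:R) ^+ k.+1 <= expR (y^-1 / k.+1%:R) ^+ k.+1.
  apply: lerXn2r; rewrite ?nnegrE ?expR_ge0//; first by rewrite divr_ge0// ltW.
  by apply: le_trans (expR_ge1Dx _); rewrite lerDr.
apply: le_trans (ler_wpM2l _ le1); last by rewrite mulr_ge0// ?exprn_ge0// ltW.
rewrite expr_div_n [y^-1 ^+ k.+1]exprSr.
have : k.+1%:R ^+ k.+1 != 0 :> R by rewrite expf_neq0.
move: (_ ^+ k.+1) (_ ^+ k) => B A B0.
suff -> : B * y * (A * y^-1 / B) = A by [].
by field; rewrite B0 gt_eqF.
Qed.

Lemma flat_cvg0 p : flat p x @[x --> (0:R)] --> (0:R).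
Proof.
have -> : flat p = fun x => \sum_(i <- iota 0 (size p)) p`_i * flat 'X^i x.
  apply/funext => x; rewrite /flat; case: ifP => x0; last first.
    by rewrite big1// => i _; rewrite mulr0.
  rewrite horner_coef mulr_suml -(big_mkord xpredT (fun i => p`_i * x^-1 ^+ i * expR (- x^-1))).
  by rewrite /index_iota subn0; apply: eq_bigr => i _; rewrite hornerXn mulrA.
rewrite [X in _ --> X](_ : _ = \sum_(i <- iota 0 (size p)) (p`_i * 0)); last first.
  by rewrite big1// => i _; rewrite mulr0.
apply: (@cvg_sum_seq _ _ _ _ (nbhs (0:R)) (nbhs_filter _)) => i.
apply: cvgM; first exact: cvg_cst.
apply/cvgrPdist_le => e e0; near=> x.
rewrite sub0r normrN; have [x0|x0] := ltP 0 x; last first.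
  by rewrite /flat ltNge x0 normr0 ltW.
apply: le_trans (flat_monomial_le _ x0) _.
rewrite -ler_pdivlMl ?exprn_gt0//; apply: le_trans (ler_norm _) _.
near: x; apply/nbhs_ballP; exists ((i.+1%:R ^+ i.+1)^-1 * e).
  by rewrite /= mulr_gt0// invr_gt0 exprn_gt0.
by move=> x; rewrite -ball_normE /= sub0r normrN => /ltW.
Unshelve. all: by end_near. Qed.

(** For [x > 0] both factors depend on [x^-1], whence ['X^2] and the difference of [p] and its
    derivative. At 0 the difference quotient of [flat p] is [flat (p * 'X)], which tends to 0. *)
Lemma is_derive_flat p (x : R) :
  is_derive x 1 (flat p) (flat ('X^2 * (p - p^`())) x).
Proof.
have [x0|x0|->] := ltgtP x 0.
- have N : \forall y \near x, (cst 0 : R -> R) y = flat p y.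
    have := lt_nbhsl x0; apply: filterS => y y0.
    by rewrite /flat ltNge (ltW y0).
  rewrite {2}/flat ltNge (ltW x0) /=.
  exact: near_eq_is_derive N (is_derive_cst _ _ _).
- have N : \forall y \near x, p.[y^-1] * expR (- y^-1) = flat p y.
    have := lt_nbhsr x0; apply: filterS => y y0.
    by rewrite /flat y0.
  apply: near_eq_is_derive N _.
  rewrite {1}/flat x0.
  have xn : x != 0 by rewrite gt_eqF.
  have dI : is_derive x 1 (fun y : R => y^-1) (- x ^- 2).
    have := @is_deriveV _ (id : R -> R) x 1 1 xn (is_derive_id _ _).
    by rewrite /GRing.scale/= mulr1.
  have dP : is_derive x 1 (horner p \o (fun y : R => y^-1))
      (p^`().[x^-1] * (- x ^- 2)).
    by apply: is_derive1_comp.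
  have dN : is_derive x 1 (fun y : R => - y^-1) (x ^- 2).
    by rewrite -[X in is_derive _ _ _ X]opprK; apply: is_deriveN.
  have dE : is_derive x 1 (expR \o (fun y : R => - y^-1))
      (expR (- x^-1) * x ^- 2).
    by apply: is_derive1_comp.
  have dM := @is_deriveM _ _ _ _ _ _ _ _ dP dE.
  apply: is_derive_eq dM _.
  rewrite /GRing.scale/= !hornerE /= -exprVn; ring.
- rewrite [X in is_derive _ _ _ X](_ : _ = 0); last by rewrite /flat ltxx.
  have E : (fun h : R => h^-1 *: ((flat p \o shift 0) (h *: 1) - flat p 0)) =
      flat (p * 'X).
    apply/funext => h; rewrite /= addr0 {2}/flat ltxx subr0 /GRing.scale/= mulr1.
    by rewrite /flat; case: ifP => h0; rewrite ?mulr0// hornerMX mulrA [_ * h^-1]mulrC.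
  have C : h^-1 *: ((flat p \o shift 0) (h *: 1) - flat p 0) @[h --> (0:R)^'] --> (0:R).
    by rewrite E; apply: cvg_trans (flat_cvg0 (p * 'X)); apply: cvg_app; exact: cvg_within.
  split; first by apply/cvg_ex; exists 0.
  exact/cvg_lim.
Qed.

(** This is exp(-1/x) for positive x, extended by 0. *)
Definition bump (x : R) : R := flat 1 x.

Lemma bump_gt0 x : (0 < bump x) = (0 < x).
Proof.
rewrite /bump /flat; case: ifP => x0; last by rewrite ltxx.
by rewrite hornerC mul1r expR_gt0.
Qed.

Lemma bump_ge0 x : 0 <= bump x.
Proof.
by rewrite /bump /flat; case: ifP => x0; rewrite ?hornerC ?mul1r ?expR_ge0.
Qed.

Lemma bump_eq0 x : x <= 0 -> bump x = 0.
Proof. by move=> x0; rewrite /bump /flat ltNge x0. Qed.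

(** Smooth transition from 0 on the nonpositive reals to 1 from 1 on; the denominator is positive
    because [x] and [1 - x] are never both nonpositive. *)
Definition step (x : R) : R := bump x / (bump x + bump (1 - x)).

Lemma step_den_gt0 x : 0 < bump x + bump (1 - x).
Proof.
have [x0|x0] := ltP 0 x; first by rewrite ltr_wpDr ?bump_ge0 ?bump_gt0.
by rewrite ltr_wpDl ?bump_ge0// bump_gt0; lra.
Qed.

Lemma step_gt0 x : (0 < step x) = (0 < x).
Proof. by rewrite /step pmulr_lgt0 ?bump_gt0// invr_gt0 step_den_gt0. Qed.

Lemma step_eq0 x : x <= 0 -> step x = 0.
Proof. by move=> x0; rewrite /step bump_eq0// mul0r. Qed.

Lemma step_eq1 x : 1 <= x -> step x = 1.
Proof.
move=> x1; rewrite /step (@bump_eq0 (1 - x)) ?addr0 ?divff//; last by lra.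
by rewrite gt_eqF// bump_gt0; lra.
Qed.

Lemma step_ge0 x : 0 <= step x.
Proof. by rewrite /step divr_ge0 ?bump_ge0// addr_ge0 ?bump_ge0. Qed.

Lemma step_le1 x : step x <= 1.
Proof. by rewrite /step ler_pdivrMr ?step_den_gt0// mul1r lerDl bump_ge0. Qed.

Lemma Ck_bump m k (U : set 'rV[R]_m) (a : 'rV[R]_m -> R) : open U ->
  Ck k U a -> Ck k U (fun x => bump (a x)).
Proof.
move=> oU Ca; apply: (@Ck_comp1 _ _ _ U setT [set h | exists p, h = flat p] a) => //.
  move=> _ [p ->]; exists (flat ('X^2 * (p - p^`()))); first by eexists.
  by move=> y _; exact: is_derive_flat.
by exists 1.
Qed.

Lemma Ck_step m k (U : set 'rV[R]_m) (a : 'rV[R]_m -> R) : open U ->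
  Ck k U a -> Ck k U (fun x => step (a x)).
Proof.
move=> oU Ca; apply: CkM => //; first exact: Ck_bump.
apply: Ck_inv => //; first by move=> x _; rewrite gt_eqF ?step_den_gt0.
apply: CkD => //; first exact: Ck_bump.
by apply: Ck_bump => //; apply: CkB => //; exact: Ck_cst.
Qed.

End Flat.

Section Lipschitz.
Context {R : realType} {n : nat}.

Lemma compact_closed_ball_rV (x : 'rV[R]_n) r : compact [set y | `|y - x| <= r].
Proof.
apply: bounded_closed_compact.
  exists (`|x| + r); split; first exact: num_real.
  move=> M hM y /= yr; apply: ltW; apply: le_lt_trans hM.
  by rewrite -[y](subrKC x); apply: le_trans (ler_normD _ _) _; rewrite lerD2l.
have -> : [set y | `|y - x| <= r] = (fun y => `|y - x|) @^-1` [set z : R | z <= r].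
  by [].
apply: closed_comp; last exact: closed_le.
move=> y _; apply: (@continuous_comp _ _ _ (fun y => y - x) (fun y => `|y|)).
  exact: (@cvgB R 'rV[R]_n _ (nbhs y) _ id (fun=> x) y x cvg_id (cvg_cst _)).
exact: norm_continuous.
Qed.

Lemma smooth_support_lipschitz (U : 'rV[R]_n -> 'rV[R]_n) r :
  smooth_on setT U -> (forall x : 'rV[R]_n, r <= `|x| -> U x = 0) ->
  exists2 C : R, 0 <= C & forall x y, `|U x - U y| <= C * `|x - y|.
Proof.
move=> /(smooth_on_coordP _ openT) Usm U0.
have B j i : exists C : R, 0 <= C /\
    forall x, `|'D_(delta_mx 0 i) (fun y => U y 0 j) x| <= C.
  have [_ /(_ i)[_ K]] := Usm 1%N j.
  pose D : 'rV[R]_n -> R := 'D_(delta_mx 0 i) (fun y => U y 0 j).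
  have Dc : continuous D by move=> x; exact: (proj1 K).
  (* The maximum with 0 keeps the ball nonempty when [r] is negative, as the extreme value theorem
     demands. *)
  pose B : set 'rV[R]_n := [set y | `|y - 0| <= Num.max r 0].
  have [|||y _ yP] := @EVT_max_rV R n (fun x => `|D x|) B.
  - by exists 0; rewrite /B /= subrr normr0 le_max lexx orbT.
  - exact: compact_closed_ball_rV.
  - apply: continuous_subspaceT => x; apply: continuous_comp; first exact: Dc.
    exact: norm_continuous.
  exists `|D y|; split=> // x; rewrite -/(D x).
  have [xr|xr] := leP `|x| (Num.max r 0); first by apply: yP; rewrite inE /B /= subr0.
  suff -> : D x = 0 by rewrite normr0.
  have N : \forall z \near x, (cst 0 : 'rV[R]_n -> R) z = U z 0 j.
    have o : open [set z : 'rV[R]_n | r < `|z|].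
      have -> : [set z : 'rV[R]_n | r < `|z|] = (fun z => `|z|) @^-1` [set z : R | z > r] by [].
      by apply: open_comp; [move=> z _; exact: norm_continuous|exact: open_gt].
    have xo : [set z : 'rV[R]_n | r < `|z|] x.
      by apply: le_lt_trans xr; rewrite le_max lexx.
    apply: filterS (open_nbhs_nbhs (conj o xo)) => z /= /ltW /U0 ->.
    by rewrite mxE.
  by rewrite /D -(near_eq_derive _ N) derive_cst.
have /choice[C CP] : forall p : 'I_n * 'I_n, exists C : R, 0 <= C /\
    forall x, `|'D_(delta_mx 0 p.2) (fun y => U y 0 p.1) x| <= C.
  by move=> [j i]; exact: B.
pose M := \sum_p C p.
have CM p : C p <= M.
  by rewrite /M (bigD1 p)//= lerDl; apply: sumr_ge0 => q _; case: (CP q).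
have M0 : 0 <= M by apply: sumr_ge0 => q _; case: (CP q).
exists (M *+ n); first exact: mulrn_wge0.
move=> x y; apply: row_norm_le => [|j]; first by rewrite mulr_ge0// mulrn_wge0.
rewrite !mxE.
have := @mean_value_cube R n (fun y => U y 0 j) 0 (`|x| + `|y| + 1) M (fun=> 0) x y.
rewrite big1 ?subr0; last by move=> i _; rewrite mul0r.
apply.
- move=> z _ i; split; last by rewrite subr0; apply: le_trans (CM (j, i)); case: (CP (j, i)).
  by have [_ /(_ i)[d _]] := Usm 1%N j; exact: d.
- by rewrite ?subr0; have := normr_ge0 x; have := normr_ge0 y; lra.
- by rewrite ?subr0; have := normr_ge0 x; have := normr_ge0 y; lra.
Qed.

End Lipschitz.

(** * The cutoff, the hyperbolic field and the kick *)

Section Fields.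
Context {R : realType} {m : nat}.
Local Notation vec := 'rV[R]_m.+1.

Implicit Types (w : vec).

(** Equal to 1 on [-2, 2] and to 0 outside (-3, 3): 2 leaves room for the balls of radius 1/3 around
    0 and e_0, and 3 stays inside the cube of radius 4 that the chart contains. *)
Definition plateau (u : R) : R := step (3 - u) * step (3 + u).

Definition cutoff (w : vec) : R := \prod_i plateau (w 0 i).

(** Equal to [x] up to 1/3 and to [1 - x] from 2/3 on. On the unit interval it is a convex
    combination of the two, hence at least their minimum; the kick is later confined to the middle
    third. *)
Definition profile (x : R) : R :=
  x * step (2 - 3 * x) + (1 - x) * (1 - step (2 - 3 * x)).

Definition field (w : vec) : vec :=
  \row_i (cutoff w * (if i == 0 then profile (w 0 0) else - w 0 i)).

(** The product of bumps is positive exactly for s < w_0 < t; only its sign matters, so it is not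
    normalised. It pushes along the axis alone and thus keeps the axis invariant. *)
Definition kick (s t : R) (w : vec) : vec :=
  \row_i (if i == 0 then cutoff w * (bump (w 0 0 - s) * bump (t - w 0 0)) else 0).

Lemma cutoff_eq1 w : `|w| <= 2 -> cutoff w = 1.
Proof.
move=> w2; rewrite /cutoff big1// => i _.
have := le_trans (normr_coord_le w i) w2; rewrite ler_norml => /andP[h1 h2].
by rewrite /plateau !step_eq1 ?mulr1//; lra.
Qed.

Lemma cutoff_gt0 w : `|w| < 3 -> 0 < cutoff w.
Proof.
move=> w2; rewrite /cutoff; apply: prodr_gt0 => i _.
have := le_lt_trans (normr_coord_le w i) w2; rewrite ltr_norml => /andP[h1 h2].
by rewrite /plateau mulr_gt0// step_gt0; lra.
Qed.

Lemma cutoff_eq0 w : 3 <= `|w| -> cutoff w = 0.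
Proof.
move=> w3.
have [i wi] : exists i, 3 <= `|w 0 i|.
  apply: contrapT => H; move: w3; rewrite leNgt => /negP; apply.
  apply: row_norm_lt => // i; rewrite ltNge; apply/negP => K; apply: H.
  by exists i.
rewrite /cutoff (bigD1 i)//= /plateau; move: wi; rewrite ler_normr => /orP[h|h].
  by rewrite step_eq0 ?mul0r//; lra.
by rewrite (@step_eq0 _ (3 + w 0 i)) ?mulr0 ?mul0r//; lra.
Qed.

Lemma field_eq0 w : 3 <= `|w| -> field w = 0.
Proof. by move=> h; apply/rowP => i; rewrite !mxE cutoff_eq0// mul0r. Qed.

Lemma kick_eq0 s t w : 3 <= `|w| -> kick s t w = 0.
Proof. by move=> h; apply/rowP => i; rewrite !mxE cutoff_eq0// mul0r if_same. Qed.

Lemma kick_eq0_out s t w : w 0 0 <= s \/ t <= w 0 0 -> kick s t w = 0.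
Proof.
move=> h; apply/rowP => i; rewrite !mxE; case: ifP => // _.
case: h => h; first by rewrite (@bump_eq0 _ (_ - s)) ?mul0r ?mulr0//; lra.
by rewrite (@bump_eq0 _ (t - _)) ?mulr0//; lra.
Qed.

Lemma profile_near0 x : x <= 3^-1 -> profile x = x.
Proof. by move=> h; rewrite /profile step_eq1; [ring|lra]. Qed.

Lemma profile_near1 x : 2 * 3^-1 <= x -> profile x = 1 - x.
Proof. by move=> h; rewrite /profile step_eq0; [ring|lra]. Qed.

Lemma profile_gt0 x : 0 < x -> x < 1 -> 0 < profile x.
Proof.
move=> x0 x1; rewrite /profile.
have := step_ge0 (2 - 3 * x); have := step_le1 (2 - 3 * x).
set b := step _ => b1 b0; nra.
Qed.

Lemma field_near0 w : `|w| <= 3^-1 ->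
  field w = \row_i (if i == 0 then w 0 0 else - w 0 i).
Proof.
move=> h; apply/rowP => i; rewrite !mxE cutoff_eq1 ?mul1r; last by lra.
by rewrite profile_near0//; apply: le_trans h; apply: le_trans (ler_norm _) (normr_coord_le _ _).
Qed.

Lemma delta00 i : (delta_mx 0 0 : vec) 0 i = (i == 0)%:R.
Proof. by rewrite mxE eqxx. Qed.

Lemma norm_delta0 : `|delta_mx 0 0 : vec| <= 1.
Proof. by apply: row_norm_le => // i; rewrite delta00; case: (_ == _); rewrite ?normr1 ?normr0. Qed.

Lemma field_near1 w : `|w - delta_mx 0 0| <= 3^-1 ->
  field w = - (w - delta_mx 0 0).
Proof.
move=> h; have h2 : `|w| <= 2.
  rewrite -[w](subrK (delta_mx 0 0)); apply: le_trans (ler_normD _ _) _.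
  by have := norm_delta0; lra.
apply/rowP => i; rewrite [LHS]mxE cutoff_eq1// mul1r.
rewrite [RHS]mxE [in RHS]mxE [X in _ = - (_ + X)]mxE delta00.
case: eqVneq => [->|_]; last by rewrite subr0.
rewrite profile_near1 ?opprB//.
have := le_trans (normr_coord_le (w - delta_mx 0 0) 0) h.
by rewrite !mxE !eqxx /= ler_norml => /andP[h3 _]; lra.
Qed.

Lemma field_axis (x : R) : `|x| <= 2 ->
  field (x *: delta_mx 0 0) = profile x *: delta_mx 0 0.
Proof.
move=> x2; have h : `|x *: delta_mx 0 0 : vec| <= 2.
  by rewrite normrZ; have := norm_delta0; have := normr_ge0 x; nra.
apply/rowP => i; rewrite !mxE cutoff_eq1// !mul1r !eqxx /= mulr1.
by case: (i == 0) => /=; rewrite ?mulr1// !mulr0 oppr0.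
Qed.

Lemma kick_axis s t (x : R) : `|x| <= 2 ->
  kick s t (x *: delta_mx 0 0) = (bump (x - s) * bump (t - x)) *: delta_mx 0 0.
Proof.
move=> x2; have h : `|x *: delta_mx 0 0 : vec| <= 2.
  by rewrite normrZ; have := norm_delta0; have := normr_ge0 x; nra.
apply/rowP => i; rewrite !mxE cutoff_eq1// !mul1r !eqxx /= mulr1.
by case: (i == 0) => /=; rewrite ?mulr1 ?mulr0.
Qed.

Lemma Ck_plateau k (a : vec -> R) : Ck k setT a -> Ck k setT (fun x => plateau (a x)).
Proof.
have oT := @openT vec => Ca; apply: CkM => //; apply: Ck_step => //.
  by apply: CkB => //; exact: Ck_cst.
by apply: CkD => //; exact: Ck_cst.
Qed.

Lemma Ck_cutoff k : Ck k setT cutoff.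
Proof.
apply: Ck_prod; first exact: openT.
by move=> i; apply: Ck_plateau; exact: Ck_coord.
Qed.

Lemma Ck_profile k (a : vec -> R) : Ck k setT a -> Ck k setT (fun x => profile (a x)).
Proof.
have oT := @openT vec => Ca.
have C : Ck k setT (fun x => step (2 - 3 * a x)).
  apply: Ck_step => //; apply: CkB => //; first exact: Ck_cst.
  by apply: CkM => //; exact: Ck_cst.
apply: CkD => //; apply: CkM => //; apply: CkB => //; exact: Ck_cst.
Qed.

Lemma field_smooth : smooth_on setT field.
Proof.
have oT := @openT vec.
apply/smooth_on_coordP => // k j; under eq_fun do rewrite mxE.
apply: CkM => //; first exact: Ck_cutoff.
case: (j == 0); first by apply: Ck_profile; exact: Ck_coord.
by apply: CkN => //; exact: Ck_coord.
Qed.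

Lemma kick_smooth s t : smooth_on setT (kick s t).
Proof.
have oT := @openT vec.
apply/smooth_on_coordP => // k j; under eq_fun do rewrite mxE.
case: (j == 0); last exact: Ck_cst.
apply: CkM => //; first exact: Ck_cutoff.
apply: CkM => //; apply: Ck_bump => //; apply: CkB => //;
  by [exact: Ck_cst|exact: Ck_coord].
Qed.

End Fields.

(** * Perturbations supported in a chart *)

Section SmoothAt.
Context {R : realType}.

(** Smoothness of germs: composites need no bookkeeping of domains. *)
Definition smooth_at {m n} (f : 'rV[R]_m -> 'rV[R]_n) (x : 'rV[R]_m) : Prop :=
  exists V, [/\ open V, V x & smooth_on V f].

Lemma smooth_on_at m n (U : set 'rV[R]_m) (f : 'rV[R]_m -> 'rV[R]_n) x :
  open U -> smooth_on U f -> U x -> smooth_at f x.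
Proof. by move=> oU sf Ux; exists U. Qed.

Lemma smooth_at_on m n (U : set 'rV[R]_m) (f : 'rV[R]_m -> 'rV[R]_n) :
  (forall x, U x -> smooth_at f x) -> smooth_on U f.
Proof.
move=> H; apply: smooth_on_local => x Ux.
by have [V [_ Vx Vf]] := H x Ux; exists V.
Qed.

Lemma smooth_at_pder m n (f : 'rV[R]_m -> 'rV[R]_n) x s :
  smooth_at f x -> {for x, continuous (pder s f)}.
Proof. by move=> [V [_ Vx Vf]]; have [] := Vf s x Vx. Qed.

Lemma smooth_at_continuous m n (f : 'rV[R]_m -> 'rV[R]_n) x :
  smooth_at f x -> {for x, continuous f}.
Proof. exact: (@smooth_at_pder _ _ _ _ [::]). Qed.

Lemma smooth_at_coord_differentiable m n (f : 'rV[R]_m -> 'rV[R]_n) x j :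
  smooth_at f x -> differentiable (fun y => f y 0 j) x.
Proof.
move=> [V [oV Vx /(smooth_on_coordP _ oV) Vf]].
exact: (Ck_differentiable oV (Vf 1%N j)).
Qed.

Lemma smooth_at_comp l m n (f : 'rV[R]_l -> 'rV[R]_m) (g : 'rV[R]_m -> 'rV[R]_n) x :
  smooth_at f x -> smooth_at g (f x) -> smooth_at (g \o f) x.
Proof.
move=> [U [oU Ux sf]] [V [oV Vx sg]].
have oW : open (U `&` f @^-1` V).
  rewrite openE => y [Uy Vy]; apply: filterI.
    exact: open_nbhs_nbhs (conj oU Uy).
  have [c _] := sf [::] y Uy; apply: c.
  exact: open_nbhs_nbhs (conj oV Vy).
exists (U `&` f @^-1` V); split=> //.
apply: (smooth_on_comp oW oV _ sg); last by move=> y [].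
by apply: smooth_on_sub sf => y [].
Qed.

Lemma smooth_at_near_eq m n (f g : 'rV[R]_m -> 'rV[R]_n) (x : 'rV[R]_m) :
  (\forall y \near x, f y = g y) -> smooth_at f x -> smooth_at g x.
Proof.
move=> fg [V [oV Vx sf]].
exists (V `&` interior [set y | f y = g y]); split.
- by apply: openI => //; exact: open_interior.
- by split=> //.
- apply: (@smooth_on_eq _ _ _ _ f).
  + by apply: openI => //; exact: open_interior.
  + by move=> y [_ /interior_subset].
  + by apply: smooth_on_sub sf => y [].
Qed.

Lemma smooth_at_coordP m n (f : 'rV[R]_m -> 'rV[R]_n) x :
  (forall k j, Ck k setT (fun y => f y 0 j)) -> smooth_at f x.
Proof.
move=> H; exists setT; split=> //; first exact: openT.
by apply/smooth_on_coordP => //; exact: openT.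
Qed.

Lemma smooth_at_affine m (a : R) (u v : 'rV[R]_m) x :
  smooth_at (fun y => a *: (y + u) + v) x.
Proof.
have oT := @openT 'rV[R]_m.
apply: smooth_at_coordP => k j.
have -> : (fun y : 'rV[R]_m => (a *: (y + u) + v) 0 j) =
    (fun y => a * (y 0 j + u 0 j) + v 0 j).
  by apply/funext => y; rewrite !mxE.
apply: CkD => //; last exact: Ck_cst.
apply: CkM => //; first exact: Ck_cst.
by apply: CkD => //; [exact: Ck_coord|exact: Ck_cst].
Qed.

Lemma smooth_at_rsubmx p m (x : 'rV[R]_(p + m)) : smooth_at rsubmx x.
Proof.
apply: smooth_at_coordP => k j.
have -> : (fun y : 'rV[R]_(p + m) => rsubmx y 0 j) = (fun y => y 0 (rshift p j)).
  by apply/funext => y; rewrite mxE.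
exact: Ck_coord.
Qed.

Lemma smooth_at_row_mx m p n (f : 'rV[R]_m -> 'rV[R]_n) (x : 'rV[R]_(p + m)) :
  smooth_at f (rsubmx x) ->
  smooth_at (fun y => row_mx (lsubmx y) (f (rsubmx y))) x.
Proof.
move=> sf.
have [V [oV Vx /(smooth_on_coordP _ oV) sV]] := smooth_at_comp (smooth_at_rsubmx x) sf.
exists V; split=> //; apply/smooth_on_coordP => // k j.
case: (split_ordP j) => i ->.
  have -> : (fun y : 'rV[R]_(p + m) => row_mx (lsubmx y) (f (rsubmx y)) 0 (lshift n i)) =
    (fun y => y 0 (lshift m i)).
    by apply/funext => y; rewrite row_mxEl mxE.
  exact: Ck_coord.
have -> : (fun y : 'rV[R]_(p + m) => row_mx (lsubmx y) (f (rsubmx y)) 0 (rshift p i)) =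
    (fun y => (f \o rsubmx) y 0 i).
  by apply/funext => y; rewrite row_mxEr.
exact: sV.
Qed.

Lemma smooth_at_row_mxr m p (t : 'rV[R]_p) (x : 'rV[R]_m) :
  smooth_at (fun y => row_mx t y) x.
Proof.
apply: smooth_at_coordP => k j; case: (split_ordP j) => i ->.
  by under eq_fun do rewrite row_mxEl; exact: Ck_cst.
by under eq_fun do rewrite row_mxEr; exact: Ck_coord.
Qed.

End SmoothAt.

Section Charts.
Context {R : realType} {n : nat}.

Lemma chart_cinv_continuous (M : topologicalType) (c : chart R n M) x :
  cdom c x -> {for cmap c x, continuous (cinv c)}.
Proof.
move=> cx; have := @cinv_continuous _ _ _ c.
rewrite continuous_open_subspace; last exact: cimg_open.
by apply; rewrite inE; exists x.
Qed.

Lemma chart_cmap_continuous (M : topologicalType) (c : chart R n M) x :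
  cdom c x -> {for x, continuous (cmap c)}.
Proof.
move=> cx; have := @cmap_continuous _ _ _ c.
rewrite continuous_open_subspace; last exact: cdom_open.
by apply; rewrite inE.
Qed.

Lemma chart_open_image (M : topologicalType) (c : chart R n M) (A : set M) :
  open A -> A `<=` cdom c -> open (cmap c @` A).
Proof.
move=> oA Ac.
have -> : cmap c @` A = cmap c @` cdom c `&` cinv c @^-1` A.
  apply/seteqP; split=> [_ [x Ax <-]|_ [[x cx <-] /=]].
    by split; [exists x => //; exact: Ac|rewrite /= cmapK//; exact: Ac].
  by rewrite cmapK// => Ax; exists x.
rewrite openE => _ [[x cx <-] /= ]; rewrite cmapK// => Ax.
have N1 : nbhs (cmap c x) (cmap c @` cdom c).
  by apply: open_nbhs_nbhs; split; [exact: cimg_open|exists x].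
have N2 : nbhs (cmap c x) (cinv c @^-1` A).
  apply: (chart_cinv_continuous cx); rewrite cmapK//.
  exact: open_nbhs_nbhs (conj oA Ax).
exact: filterI N1 N2.
Qed.

Lemma smooth_at_transition (M : smoothManifold R n) (c c' : chart R n M) x :
  atlas M c -> atlas M c' -> cdom c x -> cdom c' x ->
  smooth_at (cmap c' \o cinv c) (cmap c x).
Proof.
move=> Ac Ac' cx c'x; exists (local_dom c c' id); split.
- apply: chart_open_image; last by move=> y [].
  by rewrite preimage_id; apply: openI; exact: cdom_open.
- by exists x.
- exact: (atlas_compat Ac Ac').
Qed.

End Charts.

(** A chart with affine coordinates in which it contains the closed sup-norm cube of radius 4.
    Perturbations live in radius 3; the collar between 3 and 4 serves to glue them with the
    identity. *)
Record cube {R : realType} {n : nat} (M : smoothManifold R n) := Cube {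
  cube_chart :> chart R n M;
  cube_center : 'rV[R]_n;
  cube_scale : R;
  cube_atlas : atlas M cube_chart;
  cube_scale_gt0 : 0 < cube_scale;
  cube_sub : forall w : 'rV[R]_n, `|w| <= 4 ->
    (cmap cube_chart @` cdom cube_chart) (cube_scale *: w + cube_center) }.

Section Push.
Context {R : realType} {n : nat} {M : smoothManifold R n} (q : cube M).
Local Notation vec := 'rV[R]_n.
Implicit Types (w : vec) (x : M).

Definition pinv w : M := cinv q (cube_scale q *: w + cube_center q).

Definition pmap x : vec := (cube_scale q)^-1 *: (cmap q x - cube_center q).

Let r_neq0 : cube_scale q != 0.
Proof. by rewrite gt_eqF// cube_scale_gt0. Qed.

Lemma pinv_dom w : `|w| <= 4 -> cdom q (pinv w).
Proof. by move=> /(cube_sub q)[x qx E]; rewrite /pinv -E cmapK. Qed.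

Lemma cmap_pinv w : `|w| <= 4 ->
  cmap q (pinv w) = cube_scale q *: w + cube_center q.
Proof. by move=> /(cube_sub q)[x qx E]; rewrite /pinv -E cmapK. Qed.

Lemma pinvK w : `|w| <= 4 -> pmap (pinv w) = w.
Proof. by move=> h; rewrite /pmap cmap_pinv// addrK scalerA mulVf// scale1r. Qed.

Lemma pmapK x : cdom q x -> pinv (pmap x) = x.
Proof.
by move=> qx; rewrite /pinv /pmap scalerA mulfV// scale1r subrK cmapK.
Qed.

Lemma affine_center_smooth w :
  smooth_at (fun w => cube_scale q *: w + cube_center q) w.
Proof.
have -> : (fun w => cube_scale q *: w + cube_center q) =
  (fun w => cube_scale q *: (w + 0) + cube_center q).
  by apply/funext => y; rewrite addr0.
exact: smooth_at_affine.
Qed.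

Lemma affine_inv_smooth w :
  smooth_at (fun z => (cube_scale q)^-1 *: (z - cube_center q)) w.
Proof.
have -> : (fun z => (cube_scale q)^-1 *: (z - cube_center q)) =
  (fun z => (cube_scale q)^-1 *: (z + - cube_center q) + 0).
  by apply/funext => y; rewrite addr0.
exact: smooth_at_affine.
Qed.

Lemma pinv_continuous w : `|w| <= 4 -> {for w, continuous pinv}.
Proof.
move=> h; apply: continuous_comp.
  exact: smooth_at_continuous (affine_center_smooth w).
by rewrite -cmap_pinv//; apply: chart_cinv_continuous; exact: pinv_dom.
Qed.

Lemma pmap_continuous x : cdom q x -> {for x, continuous pmap}.
Proof.
move=> h; apply: (@continuous_comp _ _ _ (cmap q)
   (fun z => (cube_scale q)^-1 *: (z - cube_center q))).
  exact: chart_cmap_continuous.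
exact: smooth_at_continuous (affine_inv_smooth _).
Qed.

Definition zone (s : R) : set M := [set x | cdom q x /\ `|pmap x| < s].

Lemma zone_pinv s w : `|w| < s -> s <= 4 -> zone s (pinv w).
Proof.
move=> h s4; have w4 : `|w| <= 4 by rewrite (le_trans (ltW h)).
by split; [exact: pinv_dom|rewrite pinvK].
Qed.

Lemma pinv_zone s x : zone s x -> exists2 w, `|w| < s & x = pinv w.
Proof. by move=> [qx h]; exists (pmap x) => //; rewrite pmapK. Qed.

Lemma zone_open s : open (zone s).
Proof.
rewrite openE => x [qx h].
have N1 : nbhs x (cdom q).
  by apply: open_nbhs_nbhs; split => //; exact: cdom_open.
have N2 : nbhs x [set y | `|pmap y| < s].
  have c : {for x, continuous (fun y => `|pmap y|)}.
    apply: (@continuous_comp _ _ _ pmap (fun z : vec => `|z|)).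
      exact: pmap_continuous.
    exact: norm_continuous.
  exact: c (lt_nbhsl h).
exact: filterI N1 N2.
Qed.

Definition core : set M := pinv @` [set w | `|w| <= 3].

Lemma core_compact : compact core.
Proof.
apply: continuous_compact.
  apply: continuous_in_subspaceT => w /[1!inE] /= h.
  by apply: pinv_continuous; apply: le_trans h _; lra.
have -> : [set w : vec | `|w| <= 3] = [set w : vec | `|w - 0| <= 3].
  by apply/seteqP; split => w /=; rewrite subr0.
exact: compact_closed_ball_rV.
Qed.

Lemma core_closed : closed core.
Proof.
by apply: compact_closed; [exact: manifold_hausdorff|exact: core_compact].
Qed.

(** An open cover: on one set a pushed map is read in the cube, on the other it is the identity. The
    complement of [core] is open by compactness and the Hausdorff property. *)
Lemma zone4_or_notcore x : zone 4 x \/ (~` core) x.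
Proof.
have [[w /= h <-]|] := pselect (core x); last by right.
by left; apply: zone_pinv => //; apply: le_lt_trans h _; lra.
Qed.

Definition push (Phi : vec -> vec) (x : M) : M :=
  if `[< zone 4 x >] then pinv (Phi (pmap x)) else x.

Lemma push_zone Phi x : zone 4 x -> push Phi x = pinv (Phi (pmap x)).
Proof. by move=> h; rewrite /push asboolT. Qed.

Lemma push_pinv Phi w : `|w| < 4 -> push Phi (pinv w) = pinv (Phi w).
Proof. by move=> h; rewrite push_zone ?pinvK//; [exact: ltW|exact: zone_pinv]. Qed.

Definition cubical Phi := forall w, 3 <= `|w| -> Phi w = w.

Lemma push_out Phi x : cubical Phi -> ~ zone 3 x -> push Phi x = x.
Proof.
move=> Phi3 h; rewrite /push; case: asboolP => // -[qx x4].
by rewrite Phi3 ?pmapK// leNgt; apply/negP => x3; apply: h.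
Qed.

Lemma push_notcore Phi x : cubical Phi -> (~` core) x -> push Phi x = x.
Proof.
move=> Phi3 h; apply: push_out => // /pinv_zone[w w3 E]; apply: h.
by exists w => //=; exact: ltW.
Qed.

Lemma push_id x : push id x = x.
Proof. by rewrite /push; case: asboolP => // -[qx _]; rewrite pmapK. Qed.

Definition preserves4 Phi := forall w, `|w| < 4 -> `|Phi w : vec| < 4.

(** Points of norm at least 3 are fixed, so by injectivity no point of norm below 3 can land
    there. *)
Lemma cubical_preserves4 Phi : cubical Phi -> injective Phi -> preserves4 Phi.
Proof.
move=> Phi3 PhiI w w4.
have [/Phi3 -> //|w3] := leP 3 `|w|.
suff : `|Phi w| < 3 by lra.
rewrite ltNge; apply/negP => h; have /PhiI E := Phi3 _ h.
by move: h; rewrite E leNgt w3.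
Qed.

Lemma push_comp Phi Psi x : preserves4 Psi ->
  push Phi (push Psi x) = push (Phi \o Psi) x.
Proof.
move=> Psi4; have [z|z] := pselect (zone 4 x); last by rewrite /push !asboolF.
by have [w w4 ->] := pinv_zone z; rewrite !push_pinv//; exact: Psi4.
Qed.

Lemma push_continuous Phi : continuous Phi -> cubical Phi -> preserves4 Phi ->
  continuous (push Phi).
Proof.
move=> Pc Phi3 Phi4 x; have [z|z] := zone4_or_notcore x.
  have N : \forall y \near x, (pinv \o (Phi \o pmap)) y = push Phi y.
    have := open_nbhs_nbhs (conj (zone_open 4) z).
    by apply: filterS => y zy; rewrite push_zone.
  rewrite /continuous_at push_zone//.
  apply: cvg_trans (near_eq_cvg _) _; first exact: N.
  have [qx x4] := z.
  apply: continuous_comp; last by apply: pinv_continuous; apply/ltW/Phi4.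
  by apply: continuous_comp; [exact: pmap_continuous|exact: Pc].
have N : \forall y \near x, id y = push Phi y.
  have oc : open (~` core) by apply: closed_openC; exact: core_closed.
  have := open_nbhs_nbhs (conj oc z).
  by apply: filterS => y zy; rewrite push_notcore.
rewrite /continuous_at push_notcore//.
by apply: cvg_trans (near_eq_cvg N) _; exact: cvg_id.
Qed.

Section Family.
Variable Theta : 'rV[R]_(1 + n) -> vec.
Hypothesis Theta_smooth : smooth_on setT Theta.
Hypothesis Theta_cubical : forall t, cubical (fun w => Theta (row_mx t w)).

(** Time is an extra first coordinate, so smoothness jointly in time and space is ordinary
    smoothness in dimension [1 + n]; chart changes act on the last [n] coordinates only. *)
Lemma push_family_smooth (t0 : 'rV[R]_1) (c c' : chart R n M) (x : M) :
  atlas M c -> atlas M c' -> cdom c x ->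
  preserves4 (fun w => Theta (row_mx t0 w)) ->
  cdom c' (push (fun w => Theta (row_mx t0 w)) x) ->
  smooth_at (fun y => local_rep c c'
     (push (fun w => Theta (row_mx (lsubmx y) w))) (rsubmx y))
    (row_mx t0 (cmap c x)).
Proof.
move=> Ac Ac' cx P4 c'x.
have sr := smooth_at_rsubmx (row_mx t0 (cmap c x)).
have cr : {for row_mx t0 (cmap c x), continuous (cinv c \o rsubmx)}.
  apply: continuous_comp; first exact: smooth_at_continuous sr.
  by rewrite row_mxKr; exact: chart_cinv_continuous.
have crE : (cinv c \o rsubmx) (row_mx t0 (cmap c x)) = x.
  by rewrite /= row_mxKr cmapK.
have [z|z] := zone4_or_notcore x.
  have [qx x4] := z.
  have N := cr _; rewrite crE in N.
  have {}N : nbhs (row_mx t0 (cmap c x)) ((cinv c \o rsubmx) @^-1` zone 4) :=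
    N _ (open_nbhs_nbhs (conj (zone_open 4) z)).
  pose g2 (v : vec) : vec := cube_scale q *: v + cube_center q.
  pose T := cmap c' \o cinv q.
  apply: (@smooth_at_near_eq _ _ _ (T \o (g2 \o (Theta \o
      (fun y => row_mx (lsubmx y)
        ((fun z => (cube_scale q)^-1 *: ((cmap q \o cinv c) z - cube_center q)) (rsubmx y))))))).
    apply: filterS N => y zy; rewrite /local_rep /=.
    by rewrite push_zone.
  apply: smooth_at_comp.
    apply: smooth_at_comp; last exact: affine_center_smooth.
    apply: smooth_at_comp.
      apply: (@smooth_at_row_mx _ _ _ _ (fun z => (cube_scale q)^-1 *:
        ((cmap q \o cinv c) z - cube_center q))); rewrite row_mxKr.
      apply: (@smooth_at_comp _ _ _ _ (cmap q \o cinv c)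
        (fun z => (cube_scale q)^-1 *: (z - cube_center q))).
        by apply: smooth_at_transition => //; exact: cube_atlas.
      exact: affine_inv_smooth.
    by exists setT; split => //; exact: openT.
  rewrite /= row_mxKr row_mxKl cmapK// -/(pmap x) /g2 -cmap_pinv; last first.
    by apply: ltW; exact: P4.
  rewrite push_zone// in c'x.
  apply: smooth_at_transition => //; first exact: cube_atlas.
  by apply: pinv_dom; apply: ltW; exact: P4.
have oc : open (~` core) by apply: closed_openC; exact: core_closed.
have N := cr _; rewrite crE in N.
have {}N : nbhs (row_mx t0 (cmap c x)) ((cinv c \o rsubmx) @^-1` (~` core)) :=
  N _ (open_nbhs_nbhs (conj oc z)).
apply: (@smooth_at_near_eq _ _ _ ((cmap c' \o cinv c) \o rsubmx)).
  apply: filterS N => y zy; rewrite /local_rep /=.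
  by rewrite push_notcore.
apply: smooth_at_comp => //; rewrite row_mxKr.
apply: smooth_at_transition => //.
by move: c'x; rewrite push_notcore.
Qed.

End Family.

Lemma push_smooth_map Phi : smooth_on setT Phi -> cubical Phi ->
  preserves4 Phi -> smooth_map (push Phi).
Proof.
move=> sP Phi3 Phi4; split.
  apply: push_continuous => // w.
  apply: smooth_at_continuous; exists setT; split => //; exact: openT.
move=> c c' Ac Ac'; apply: smooth_at_on => _ [x [cx c'x] <-].
(* A single map is viewed as a family that does not depend on time. *)
have sT : smooth_on setT (Phi \o @rsubmx _ 1 1 n).
  apply: smooth_at_on => y _; apply: smooth_at_comp (smooth_at_rsubmx y) _.
  by exists setT; split => //; exact: openT.
have E t : (fun w => (Phi \o rsubmx) (row_mx t w : 'rV[R]_(1 + n))) = Phi.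
  by apply/funext => w; rewrite /= row_mxKr.
have := @push_family_smooth _ sT _ 0 c c' x Ac Ac' cx.
rewrite !E => H.
have TC t : cubical (fun w => (Phi \o rsubmx) (row_mx t w : 'rV[R]_(1 + n))).
  by rewrite E.
have := smooth_at_comp (smooth_at_row_mxr (0 : 'rV[R]_1) (cmap c x)) (H TC Phi4 c'x).
suff -> : (fun y : 'rV[R]_(1 + n) =>
     local_rep c c' (push (fun w => (Phi \o rsubmx) (row_mx (lsubmx y) w)))
       (rsubmx y)) \o [eta row_mx 0] = local_rep c c' (push Phi) by [].
by apply/funext => y; rewrite /= E row_mxKr.
Qed.

End Push.

(** * The C^oo topology *)

Section Topology.
Context {R : realType} {n : nat} {M : smoothManifold R n}.

Lemma diffc_weak_continuous (T : topologicalType) (F : T -> diffc_weak M) (x0 : T) :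
  (forall B, @Cinfty_subbase R n M B -> B (F x0) -> \forall x \near x0, B (F x)) ->
  {for x0, continuous F}.
Proof.
move=> H A NA.
have [B [oB BF] BA] : exists2 B, open_nbhs (F x0) B & B `<=` A.
  by move: NA; rewrite nbhsE.
apply: (@filterS _ (nbhs x0) _ (F @^-1` B)); first by move=> x /BA.
move: oB => [D' sD' E]; move: BF; rewrite -E => -[C D'C CF].
have [S Ssub CE] := sD' C D'C.
apply: (filterS _ (@filter_bigI T _ S (fun B => F @^-1` B) (nbhs x0) _ _)).
  move=> x K; exists C => //.
  by change ((C : set (diffc_weak M)) (F x)); rewrite -CE => B' SB; exact: (K B').
move=> B' SB; apply: H; first by have := Ssub _ SB; rewrite inE.
have CF' : (C : set (diffc_weak M)) (F x0) by [].
by move: CF'; rewrite -CE; apply.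
Qed.

(** On maps supported in one compact set [K] the two topologies have the same traces, by definition
    of [Cinfty_open]; only the coarser one has to be tested. *)
Lemma diffc_continuous (T : topologicalType) (F : T -> diffc M) (K : set M) :
  compact K -> (forall x, supp (F x) `<=` K) ->
  continuous (F : T -> diffc_weak M) -> continuous F.
Proof.
move=> cK sK Fc; apply/continuousP => A oA.
have [V oV E] : exists2 V : set (diffc_weak M),
      open V & A `&` diff_supp_in K = V `&` diff_supp_in K by exact: oA cK.
have -> : F @^-1` A = F @^-1` V.
  apply/seteqP; split => x Ax.
    suff [] : (V `&` diff_supp_in K) (F x) by [].
    by rewrite -E; split => //; exact: sK.
  suff [] : (A `&` diff_supp_in K) (F x) by [].
  by rewrite E; split => //; exact: sK.
by move/continuousP : Fc; apply.
Qed.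

End Topology.

(** * Isotopies pushed from the cube to the manifold *)

Section Isotopy.
Context {R : realType} {n : nat} {M : smoothManifold R n} (q : cube M).
Local Notation vec := 'rV[R]_n.

Lemma perturb_cubical (U : vec -> vec) :
  (forall w : vec, 3 <= `|w| -> U w = 0) -> cubical (fun w => w + U w).
Proof. by move=> U0 w h; rewrite U0// addr0. Qed.

(** The inverse diffeomorphism is the push of the inverse map, which is cubical as well because it
    has the same fixed points. *)
Lemma perturb_diffc (U : vec -> vec) :
  smooth_on setT U -> (forall w : vec, 3 <= `|w| -> U w = 0) ->
  (forall v w, `|U v - U w| <= 2^-1 * `|v - w|) ->
  preserves4 (fun w => w + U w) /\
  exists d : diffc M, (d : M -> M) = push q (fun w => w + U w) /\
    supp d `<=` core q.
Proof.
move=> Usm U0 Ulip.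
have [Psi [PhiK PsiK Psm]] := perturb_inverse Ulip Usm.
have oT := @openT vec.
have Phism : smooth_on setT (fun w => w + U w).
  move/(smooth_on_coordP _ oT) : Usm => Usm.
  apply/smooth_on_coordP => // k j; under eq_fun do rewrite mxE.
  by apply: CkD => //; exact: Ck_coord.
have Phi3 := perturb_cubical U0.
have Psi3 : cubical Psi.
  by move=> w w3; rewrite -{1}(Phi3 w w3) PhiK.
have Phi4 : preserves4 (fun w => w + U w).
  by apply: cubical_preserves4 => //; exact: can_inj PhiK.
have Psi4 : preserves4 Psi.
  by apply: cubical_preserves4 => //; exact: can_inj PsiK.
split=> //.
have K1 : cancel (push q (fun w => w + U w)) (push q Psi).
  move=> x; rewrite push_comp// (_ : _ \o _ = id) ?push_id//.
  by apply/funext => w /=; rewrite PhiK.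
have K2 : cancel (push q Psi) (push q (fun w => w + U w)).
  move=> x; rewrite push_comp// (_ : _ \o _ = id) ?push_id//.
  by apply/funext => w /=; rewrite PsiK.
have dPhi : is_diffeo (push q (fun w => w + U w)).
  split; first exact: push_smooth_map.
  by exists (push q Psi); split=> //; exact: push_smooth_map.
have sPhi : supp (push q (fun w => w + U w)) `<=` core q.
  rewrite /supp [X in _ `<=` X]((closure_id _).1 (@core_closed _ _ _ q)).
  apply: closure_subset.
  move=> x /= h; apply: contrapT => xc; apply: h.
  by rewrite push_notcore.
have cPhi : compact (supp (push q (fun w => w + U w))).
  by apply: subclosed_compact sPhi; [exact: closed_closure|exact: core_compact].
by exists (Diffc dPhi cPhi).
Qed.

Lemma near_prod_swap (T1 T2 : topologicalType) (s0 : T1) (x0 : T2)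
    (P : T1 -> T2 -> Prop) :
  (\forall p \near (s0, x0), P p.1 p.2) ->
  \forall x \near x0 & s \near s0, P s x.
Proof.
move=> [[A B] [/= NA NB] AB]; exists (B, A) => // -[x s] [/= Bx As].
exact: (AB (s, x)).
Qed.

Section Continuity.
Variable Theta : 'rV[R]_(1 + n) -> vec.
Hypothesis Theta_smooth : smooth_on setT Theta.
Hypothesis Theta_cubical : forall t, cubical (fun w => Theta (row_mx t w)).
Variables (theta : R -> R) (F : R -> diffc M).
Hypothesis theta_cont : continuous theta.
Let tt s : 'rV[R]_1 := const_mx (theta s).
Hypothesis F_push : forall s, (F s : M -> M) = push q (fun w => Theta (row_mx (tt s) w)).
Hypothesis F_preserves4 : forall s, preserves4 (fun w => Theta (row_mx (tt s) w)).

Lemma row_mx_param_continuous (g : M -> vec) s0 x0 :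
  {for x0, continuous g} ->
  {for (s0, x0), continuous (fun p : R * M => row_mx (tt p.1) (g p.2))}.
Proof.
move=> cg; apply: continuous_rV => j; case: (split_ordP j) => i ->.
  have E : (fun p : R * M => row_mx (tt p.1) (g p.2) 0 (lshift n i)) = (fun p => theta p.1).
    by apply/funext => p; rewrite row_mxEl mxE.
  rewrite /prop_for /continuous_at E row_mxEl mxE.
  apply: (@continuous_comp _ _ _ fst theta); first exact: cvg_fst.
  exact: theta_cont.
have E : (fun p : R * M => row_mx (tt p.1) (g p.2) 0 (rshift 1 i)) = (fun p => g p.2 0 i).
  by apply/funext => p; rewrite row_mxEr.
rewrite /prop_for /continuous_at E row_mxEr.
apply: (@continuous_comp _ _ _ snd (fun x => g x 0 i)); first exact: cvg_snd.
apply: (@continuous_comp _ _ _ g (fun v : vec => v 0 i)) => //.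
exact: coord_continuous.
Qed.

Lemma push_path_jointly_continuous s0 x0 :
  {for (s0, x0), continuous (fun p : R * M => F p.1 p.2)}.
Proof.
have [z|z] := zone4_or_notcore q x0.
  have [qx x4] := z.
  have N : \forall p \near (s0, x0),
     (pinv q \o (Theta \o (fun p : R * M => row_mx (tt p.1) (pmap q p.2)))) p = F p.1 p.2.
    have : \forall p \near (s0, x0), zone q 4 p.2.
      exact: (@cvg_snd _ _ (nbhs s0) (nbhs x0) _ _ (open_nbhs_nbhs (conj (zone_open q 4) z))).
    by apply: filterS => p zp; rewrite F_push push_zone.
  have C : {for (s0, x0), continuous (pinv q \o
      (Theta \o (fun p : R * M => row_mx (tt p.1) (pmap q p.2))))}.
    apply: continuous_comp; last by apply: pinv_continuous; apply/ltW/F_preserves4.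
    apply: continuous_comp.
      by apply: row_mx_param_continuous; exact: pmap_continuous.
    by apply: smooth_at_continuous; exists setT; split=> //; exact: openT.
  rewrite /prop_for /continuous_at /= F_push push_zone//.
  exact: cvg_trans (near_eq_cvg N) C.
have oc : open (~` core q) by apply: closed_openC; exact: core_closed.
have N : \forall p \near (s0, x0), p.2 = F p.1 p.2.
  have : \forall p \near (s0, x0), (~` core q) p.2.
    exact: (@cvg_snd _ _ (nbhs s0) (nbhs x0) _ _ (open_nbhs_nbhs (conj oc z))).
  by apply: filterS => p zp; rewrite F_push push_notcore.
rewrite /prop_for /continuous_at /= F_push push_notcore//.
by apply: cvg_trans (near_eq_cvg N) _; exact: cvg_snd.
Qed.

(** A subbasic condition is uniform over the compact [L]. Each of its finitely many inequalities is
    open in time and point jointly, by joint smoothness, and compactness of [L] then gives a common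
    time interval. *)
Lemma push_path_weak_continuous : continuous (F : R -> diffc_weak M).
Proof.
move=> s0; apply: diffc_weak_continuous.
move=> _ [c [c' [L [k [e [f [[Ac Ac' cL Lc] [fL e0 ->]]]]]]]] [FL Fe].
(* Tuples of length at most [k] form a finite type, unlike lists: the conjunction over derivatives
   becomes a finite intersection of neighbourhoods. *)
pose P (s : R) (x : M) := cdom c' (F s x) /\
   forall j : 'I_k.+1, forall s' : j.-tuple 'I_n,
   `|pder s' (local_rep c c' (F s)) (cmap c x) -
     pder s' (local_rep c c' f) (cmap c x)| < e.
have /compact_near_coveringP/(_ R (nbhs s0) P (nbhs_filter s0)) := cL => Cov.
have {Cov} : \forall s \near s0, L `<=` P s.
  apply: Cov => x Lx.
  have cx := Lc _ Lx.
  have c'x : cdom c' (F s0 x) by apply: FL; exists x.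
  apply: (near_prod_swap (P := P)).
  suff main : forall (j : 'I_k.+1) (s' : j.-tuple 'I_n),
      \forall p \near (s0, x), `|pder s' (local_rep c c' (F p.1)) (cmap c p.2) -
        pder s' (local_rep c c' f) (cmap c p.2)| < e.
    apply: filterI.
      apply: (@push_path_jointly_continuous s0 x (cdom c')).
      exact: open_nbhs_nbhs (conj (cdom_open c') c'x).
    apply: (filter_forall (nbhs_filter (s0, x))) => j.
    by apply: (filter_forall (nbhs_filter (s0, x))) => s'; exact: main.
  move=> j s'.
  pose J (y : 'rV[R]_(1 + n)) := local_rep c c'
     (push q (fun w => Theta (row_mx (lsubmx y) w))) (rsubmx y).
  have JE s : (fun z => J (row_mx (tt s) z)) = local_rep c c' (F s).
    by apply/funext => z; rewrite /J row_mxKl row_mxKr F_push.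
  have sJ : smooth_at J (row_mx (tt s0) (cmap c x)).
    by apply: push_family_smooth => //; rewrite -F_push.
  pose g1 (p : R * M) := pder (map (@rshift 1 n) s') J (row_mx (tt p.1) (cmap c p.2)).
  pose g2 (p : R * M) := pder s' (local_rep c c' f) (cmap c p.2).
  have c1 : {for (s0, x), continuous g1}.
    apply: (@continuous_comp _ _ _ (fun p : R * M => row_mx (tt p.1) (cmap c p.2))
      (pder (map (@rshift 1 n) s') J)).
      by apply: row_mx_param_continuous; exact: chart_cmap_continuous.
    exact: smooth_at_pder.
  have c2 : {for (s0, x), continuous g2}.
    apply: (@continuous_comp _ _ _ snd (fun y => pder s' (local_rep c c' f) (cmap c y))).
      exact: cvg_snd.
    apply: (@continuous_comp _ _ _ (cmap c)); first exact: chart_cmap_continuous.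
    have [[_ sf] _] := diffc_diffeo f.
    have [] // := sf c c' Ac Ac' s' (cmap c x).
    by exists x => //; split => //; apply: fL; exists x.
  have c3 : `|g1 p - g2 p| @[p --> (s0, x)] --> `|g1 (s0, x) - g2 (s0, x)|.
    by apply: cvg_norm; apply: cvgB; [exact: c1|exact: c2].
  have g1E p : g1 p = pder s' (local_rep c c' (F p.1)) (cmap c p.2).
    by rewrite -JE pder_row_mx.
  have lte : `|g1 (s0, x) - g2 (s0, x)| < e.
    by rewrite g1E /g2 /=; apply: Fe => //; rewrite size_tuple -ltnS.
  have N : \forall p \near (s0, x), `|g1 p - g2 p| < e := c3 _ (lt_nbhsl lte).
  by apply: filterS N => p; rewrite g1E.
apply: filterS => s K; split.
  by move=> _ [x Lx <-]; case: (K x Lx).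
move=> s' s'k x Lx; have [_ /(_ (Ordinal (s'k : (size s' < k.+1)%N)) (in_tuple s'))] := K x Lx.
exact.
Qed.

End Continuity.

End Isotopy.

Section SmallIsotopy.
Context {R : realType} {n : nat} {M : smoothManifold R n} (q : cube M).
Local Notation vec := 'rV[R]_n.

Lemma diffc_eq (f g : diffc M) : (f : M -> M) = g -> f = g.
Proof.
case: f g => [f df cf] [g dg cg] /= E; move: df cf; rewrite E => df cf.
by rewrite (Prop_irrelevance df dg) (Prop_irrelevance cf cg).
Qed.

(** The path is affine in the perturbation. Its continuity keeps it in [A] for small times, and the
    image of a time interval is connected, hence within one component. Two such paths are
    concatenated later: from the identity to a saddle, then to its kicked version. *)
Lemma small_isotopy (U0 U1 : vec -> vec) (d0 : diffc M) (A : set (diffc M)) :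
  smooth_on setT U0 -> smooth_on setT U1 ->
  (forall w : vec, 3 <= `|w| -> U0 w = 0) -> (forall w : vec, 3 <= `|w| -> U1 w = 0) ->
  (forall v w, `|U0 v - U0 w| <= 4^-1 * `|v - w|) ->
  (d0 : M -> M) = push q (fun w => w + U0 w) ->
  open A -> A d0 ->
  exists2 e : R, 0 < e & forall s, 0 <= s -> s <= e -> exists d : diffc M,
    [/\ (d : M -> M) = push q (fun w => w + (U0 w + s *: U1 w)), A d &
        connected_component setT d0 d].
Proof.
move=> s0 s1 z0 z1 l0 d0E oA Ad0.
have oT := @openT vec.
have [C C0 l1] := smooth_support_lipschitz s1 z1.
(* [de * C <= 4^-1], so that adding [de * s] times [U1] to the 1/4-Lipschitz [U0] stays
   1/2-Lipschitz for [s] in [0, 1]. *)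
pose de : R := (4 * (C + 1))^-1.
have de0 : 0 < de by rewrite invr_gt0 mulr_gt0// ltr_wpDl.
have deC : de * C <= 4^-1.
  rewrite /de invfM -mulrA ler_piMr// ?invr_ge0// mulrC ler_pdivrMr ?mul1r ?lerDl//.
  by rewrite ltr_wpDl.
(* Clamping to [0, 1] defines a continuous path for all real times, without subspace topologies. *)
pose clamp (s : R) := Num.max 0 (Num.min s 1).
have clamp01 s : 0 <= clamp s <= 1.
  by rewrite /clamp le_max lexx /= ge_max ler01 /= ge_min lexx orbT.
have clampE s : 0 <= s -> s <= 1 -> clamp s = s.
  by move=> h0 h1; rewrite /clamp (min_idPl h1) (max_idPr h0).
pose theta (s : R) := de * clamp s.
have theta_cont : continuous theta.
  move=> s; apply: cvgM; first exact: cvg_cst.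
  have cc (a : R) : {for s, continuous ((fun=> a) : R -> R^o)} by exact: cvg_cst.
  have ci : {for s, continuous (id : R -> R^o)} by exact: cvg_id.
  exact: (continuous_max (cc 0) (continuous_min ci (cc 1))).
pose U t w : vec := U0 w + t *: U1 w.
have Usm t : smooth_on setT (U t).
  move/(smooth_on_coordP _ oT) : s0 => s0; move/(smooth_on_coordP _ oT) : s1 => s1.
  apply/smooth_on_coordP => // k j; under eq_fun do rewrite !mxE.
  by apply: CkD => //; apply: CkM => //; exact: Ck_cst.
have Uz t (w : vec) : 3 <= `|w| -> U t w = 0.
  by move=> h; rewrite /U z0// z1// scaler0 addr0.
have Ul s v w : `|U (theta s) v - U (theta s) w| <= 2^-1 * `|v - w|.
  have -> : U (theta s) v - U (theta s) w = (U0 v - U0 w) + theta s *: (U1 v - U1 w).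
    by rewrite /U opprD addrACA scalerBr.
  apply: le_trans (ler_normD _ _) _; rewrite normrZ.
  have /andP[c0 c1] := clamp01 s.
  rewrite ger0_norm; last by rewrite /theta mulr_ge0// ltW.
  have := l0 v w; have := l1 v w; have := normr_ge0 (v - w).
  set X := `|U0 v - _|; set Y := `|U1 v - _|; set Z := `|v - w| => Z0 hY hX.
  have : theta s * Y <= 4^-1 * Z.
    apply: (@le_trans _ _ (de * (C * Z))); last by rewrite mulrA ler_wpM2r.
    apply: ler_pM => //; first by rewrite /theta mulr_ge0// ltW.
      exact: normr_ge0.
    by rewrite /theta ler_piMr// ltW.
  by lra.
have /choice[F FP] : forall s, exists d : diffc M,
    (d : M -> M) = push q (fun w => w + U (theta s) w) /\ supp d `<=` core q.
  by move=> s; have [_] := perturb_diffc q (Usm (theta s)) (@Uz (theta s)) (Ul s).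
pose Theta (y : 'rV[R]_(1 + n)) : vec := rsubmx y + U (lsubmx y 0 0) (rsubmx y).
have ThetaE t w : Theta (row_mx (const_mx t) w) = w + U t w.
  by rewrite /Theta row_mxKl row_mxKr mxE.
have ThetaE' (t : 'rV[R]_1) w : Theta (row_mx t w) = w + U (t 0 0) w.
  by rewrite /Theta row_mxKl row_mxKr.
have Tsm : smooth_on setT Theta.
  have oT1 := @openT 'rV[R]_(1 + n).
  have cs (g : vec -> vec) : smooth_on setT g -> forall k j,
      Ck k setT (fun y : 'rV[R]_(1 + n) => g (rsubmx y) 0 j).
    move=> sg k j; have : smooth_on setT (g \o @rsubmx _ 1 1 n).
      apply: smooth_at_on => y _; apply: smooth_at_comp (smooth_at_rsubmx y) _.
      by exists setT; split => //; exact: openT.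
    by move/(smooth_on_coordP _ oT1) => /(_ k j).
  apply/smooth_on_coordP => // k j.
  have -> : (fun y => Theta y 0 j) = (fun y : 'rV[R]_(1 + n) =>
     y 0 (rshift 1 j) + (U0 (rsubmx y) 0 j + y 0 (lshift n 0) * U1 (rsubmx y) 0 j)).
    by apply/funext => y; rewrite !mxE.
  apply: CkD => //; first exact: Ck_coord.
  apply: CkD => //; first exact: cs.
  by apply: CkM => //; [exact: Ck_coord|exact: cs].
have Tcub (t : 'rV[R]_1) : cubical (fun w => Theta (row_mx t w)).
  by move=> w h; rewrite ThetaE' Uz// addr0.
have Fcont : continuous F.
  apply: (@diffc_continuous _ _ _ _ _ (core q)).
  - exact: core_compact.
  - by move=> s; case: (FP s).
  - apply: (@push_path_weak_continuous _ _ _ q Theta Tsm Tcub theta) => // s.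
      by under eq_fun do rewrite ThetaE; case: (FP s).
    under eq_fun do rewrite ThetaE.
    by have [] := perturb_diffc q (Usm (theta s)) (@Uz (theta s)) (Ul s).
have F0 : F 0 = d0.
  apply: diffc_eq; rewrite (proj1 (FP 0)) d0E; congr push; apply/funext => w.
  by rewrite /theta clampE// mulr0 /U scale0r addr0.
have : \forall s \near (0:R), A (F s).
  by apply: Fcont; rewrite F0; exact: open_nbhs_nbhs (conj oA Ad0).
move=> /nbhs_ballP[r /= r0 rP].
pose e1 : R := Num.min (r / 2) 1.
have e10 : 0 < e1 by rewrite lt_min divr_gt0//=.
exists (de * e1); first by rewrite mulr_gt0.
move=> s h0 h1; pose s' := s / de.
have s'0 : 0 <= s' by rewrite divr_ge0// ltW.
have s'e : s' <= e1 by rewrite ler_pdivrMr// mulrC.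
have s'1 : s' <= 1 by apply: le_trans s'e _; rewrite ge_min lexx orbT.
have ths : theta s' = s by rewrite /theta clampE// /s' mulrC divfK// gt_eqF.
exists (F s'); split.
- by rewrite (proj1 (FP s')) ths.
- apply: rP; rewrite -ball_normE /= sub0r normrN ger0_norm//.
  apply: le_lt_trans s'e _; apply: (@le_lt_trans _ _ (r / 2)); first by rewrite ge_min lexx.
  by rewrite ltr_pdivrMr// ltr_pMr// ltr1n.
- exists (F @` `[0, s']%classic); last by exists s' => //=; rewrite in_itv/= s'0 lexx.
  split => //.
    by exists 0; rewrite ?F0//= in_itv/= lexx.
  apply: connected_continuous_connected; first exact: segment_connected.
  exact: continuous_subspaceT.
Qed.

End SmallIsotopy.

(** * Square roots of interval maps *)

Section IntervalMaps.
Context {R : realType}.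
Implicit Types (f g : R -> R).

Definition unit_pt (x : R) := 0 < x /\ x < 1.

(** The growth bound is explicit, so orbits leave every compact part of (0, 1) after finitely many
    steps, forwards and backwards. *)
Record interval_map (tau : R) f : Prop := IntervalMap {
  im_tau : 0 < tau;
  im_unit : forall x, unit_pt x -> unit_pt (f x);
  im_incr : forall x y, unit_pt x -> unit_pt y -> x < y -> f x < f y;
  im_growth : forall x, unit_pt x -> tau * Num.min x (1 - x) <= f x - x;
  im_surj : forall y, unit_pt y -> exists2 x, unit_pt x & f x = y
}.

Section One.
Variables (tau : R) (f : R -> R).
Hypothesis fI : interval_map tau f.

Lemma im_gt x : unit_pt x -> x < f x.
Proof.
move=> ux; have [x0 x1] := ux; rewrite -subr_gt0.
apply: lt_le_trans (im_growth fI ux); rewrite mulr_gt0 ?(im_tau fI)//.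
by rewrite lt_min x0 subr_gt0.
Qed.

Lemma im_inj x y : unit_pt x -> unit_pt y -> f x = f y -> x = y.
Proof.
move=> ux uy E; have [h|h|//] := ltgtP x y.
  by have := im_incr fI ux uy h; rewrite E ltxx.
by have := im_incr fI uy ux h; rewrite E ltxx.
Qed.

Lemma im_iter_unit n x : unit_pt x -> unit_pt (iter n f x).
Proof. by move=> ux; elim: n => //= n; exact: (im_unit fI). Qed.

Lemma im_iter_le n x : unit_pt x -> x <= iter n f x.
Proof.
move=> ux; elim: n => //= n IH; apply: le_trans IH _.
by apply/ltW/im_gt/im_iter_unit.
Qed.

Lemma im_iter_incr n x y : unit_pt x -> unit_pt y -> x < y -> iter n f x < iter n f y.
Proof.
move=> ux uy h; elim: n => //= n; apply: (im_incr fI); exact: im_iter_unit.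
Qed.

Lemma im_reach_up x d : unit_pt x -> 0 < d -> exists n, 1 - d < iter n f x.
Proof.
move=> ux d0; have [x0 x1] := ux; apply: contrapT => H.
have B n : iter n f x <= 1 - d.
  by rewrite leNgt; apply/negP => h; apply: H; exists n.
(* As long as the orbit stays in [x, 1 - d], each step gains at least [c]; the Archimedean property
   concludes. *)
pose c := tau * Num.min x d.
have c0 : 0 < c by rewrite mulr_gt0 ?(im_tau fI)// lt_min x0.
have S n : x + c *+ n <= iter n f x.
  elim: n => [|n IH]; first by rewrite addr0.
  rewrite mulrSr addrA /=; have un := im_iter_unit n ux.
  rewrite -lerBrDl; apply: le_trans (lerB (lexx _) IH).
  apply: le_trans (im_growth fI un); rewrite ler_wpM2l ?(ltW (im_tau fI))//.
  rewrite le_min !ge_min (im_iter_le n ux) /=; apply/orP; right.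
  by have := B n; lra.
have := archi_boundP (ltW (_ : 0 < c^-1)); rewrite invr_gt0 => /(_ c0).
set n := Num.bound _ => nP.
have := le_trans (S n) (B n); rewrite -mulr_natr.
have : 1 < c * n%:R by rewrite -ltr_pdivrMl// mulr1.
by lra.
Qed.

Lemma im_reach_down x d : unit_pt x -> 0 < d ->
  exists n z, [/\ unit_pt z, z < d & iter n f z = x].
Proof.
move=> ux d0; have [x0 x1] := ux; apply: contrapT => H.
(* [h] selects preimages under [f]; its default 0 outside the interval is never met on the backward
   orbit of [x]. *)
have /choice[h hP] : forall y, exists z, unit_pt y -> unit_pt z /\ f z = y.
  move=> y; have [uy|nuy] := pselect (unit_pt y); last by exists 0.
  by have [z uz fz] := im_surj fI uy; exists z.
have hU n : unit_pt (iter n h x).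
  by elim: n => //= n IH; case: (hP _ IH).
have hf n : iter n f (iter n h x) = x.
  elim: n => // n IH; rewrite iterSr /=.
  by have [_ ->] := hP _ (hU n).
have B n : d <= iter n h x.
  by rewrite leNgt; apply/negP => lt; apply: H; exists n, (iter n h x).
have L n : iter n h x <= x.
  by rewrite -{2}(hf n); exact: im_iter_le.
pose c := tau * Num.min d (1 - x).
have c0 : 0 < c by rewrite mulr_gt0 ?(im_tau fI)// lt_min d0 subr_gt0.
have S n : iter n h x <= x - c *+ n.
  elim: n => [|n IH]; first by rewrite subr0.
  have [un E] := hP _ (hU n).
  have := im_growth fI un; rewrite E /=.
  have : c <= tau * Num.min (h (iter n h x)) (1 - h (iter n h x)).
    rewrite ler_wpM2l ?(ltW (im_tau fI))// le_min !ge_min; apply/andP; split.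
      by have := B n.+1; rewrite /= => ->.
    by apply/orP; right; have := L n.+1; rewrite /=; lra.
  by rewrite mulrSr; lra.
have := archi_boundP (ltW (_ : 0 < c^-1)); rewrite invr_gt0 => /(_ c0).
set n := Num.bound _ => nP.
have := le_trans (B n) (S n); rewrite -mulr_natr.
have : 1 < c * n%:R by rewrite -ltr_pdivrMl// mulr1.
by lra.
Qed.

Lemma im_iter_inj n x y : unit_pt x -> unit_pt y -> iter n f x = iter n f y -> x = y.
Proof.
move=> ux uy; elim: n => //= n IH E; apply: IH.
by apply: im_inj E; exact: im_iter_unit.
Qed.

End One.

(* [g] and [g1] agree left of [s] (propagate from 0) and right of [t] (propagate
   from 1).  For [s < x < t] write [x = f y]: since [t < g s], [g y < s] and
   [t <= g x], so that [g1 x = g1 (g1 (g y)) = f1 (g y) = g x]. *)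
Lemma interval_maps_eq (tau : R) f f1 g g1 (s t : R) :
  interval_map tau f -> interval_map tau f1 ->
  (forall x, unit_pt x -> unit_pt (g x)) -> (forall x, unit_pt x -> unit_pt (g1 x)) ->
  (forall x, unit_pt x -> g (g x) = f x) -> (forall x, unit_pt x -> g1 (g1 x) = f1 x) ->
  (forall x, unit_pt x -> x < g x) -> (forall x, unit_pt x -> x < g1 x) ->
  (forall x y, unit_pt x -> unit_pt y -> x < y -> g x < g y) ->
  (exists2 d, 0 < d & forall x, 0 < x -> x < d -> g x = g1 x) ->
  (exists2 d, 0 < d & forall x, 1 - d < x -> x < 1 -> g x = g1 x) ->
  (forall x, x <= s \/ t <= x -> f x = f1 x) ->
  0 < s -> s < t -> t < g s ->
  forall x, unit_pt x -> f x = f1 x.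
Proof.
move=> fI f1I gU g1U gf gf1 gx g1x gincr [d d0 gl] [d' d'0 gr] ff1 s0 st tgs.
have gcomm x : unit_pt x -> g (f x) = f (g x).
  by move=> ux; rewrite -!gf//; exact: gU.
have g1comm x : unit_pt x -> g1 (f1 x) = f1 (g1 x).
  by move=> ux; rewrite -!gf1//; exact: g1U.
have gcommn n x : unit_pt x -> g (iter n f x) = iter n f (g x).
  move=> ux; elim: n => //= n <-; apply: gcomm; exact: (im_iter_unit fI).
have g1commn n x : unit_pt x -> g1 (iter n f1 x) = iter n f1 (g1 x).
  move=> ux; elim: n => //= n <-; apply: g1comm; exact: (im_iter_unit f1I).
(* From [t] on the orbits of [f] and [f1] are the same; some iterate enters the zone near 1 where
   [g] and [g1] agree, and injectivity of the iterates of [f1] brings the equality back to [x]. *)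
have right x : unit_pt x -> t <= x -> g1 x = g x.
  move=> ux tx.
  have iterE n y : unit_pt y -> t <= y -> iter n f1 y = iter n f y.
    move=> uy ty; elim: n => //= n ->; rewrite ff1//; right.
    by apply: le_trans ty _; exact: (im_iter_le fI).
  have [n nP] := im_reach_up fI ux d'0.
  have un := im_iter_unit fI n ux.
  have E : g (iter n f x) = g1 (iter n f x) by apply: gr => //; case: un.
  apply: (im_iter_inj f1I (n := n)); [exact: g1U|exact: gU|].
  rewrite -g1commn// iterE// -E gcommn// iterE//; first exact: gU.
  by apply: le_trans tx _; apply/ltW/gx.
(* Here [x] is an iterate of some [z] close to 0. The orbit of [z] up to [x] does not exceed [s],
   hence is common to [f] and [f1]. *)
have left x : unit_pt x -> x <= s -> g1 x = g x.
  move=> ux xs.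
  have [n [z [uz zd E]]] := im_reach_down fI ux d0.
  have zP k : (k < n)%N -> iter k.+1 f z <= x.
    move=> kn; rewrite -E -(subnKC kn) addnC iterD.
    by apply: (im_iter_le fI); exact: (im_iter_unit fI).
  have zf k : (k <= n)%N -> iter k f1 z = iter k f z.
    elim: k => //= k IH kn; rewrite IH; last exact: ltnW.
    rewrite ff1//; left; apply: le_trans xs; apply: le_trans (zP _ kn).
    by apply/ltW/(im_gt fI); exact: (im_iter_unit fI).
  have gzf k : (k <= n)%N -> iter k f1 (g z) = iter k f (g z).
    elim: k => //= k IH kn; rewrite IH; last exact: ltnW.
    rewrite ff1//; left; apply: le_trans xs; apply: le_trans (zP _ kn).
    (* The image of a point under [g] lies below its image under [f], so the first [n] points of the
       orbit of [g z] do not exceed [s] either. *)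
    rewrite -gcommn//= -gf; last exact: (im_iter_unit fI).
    by apply/ltW/gx/gU; exact: (im_iter_unit fI).
  rewrite -{1}E -(zf n)// g1commn// -gl ?gzf//; last by case: uz.
  by rewrite -gcommn// E.
move=> x ux; have [xs|sx] := leP x s; first by apply: ff1; left.
have [tx|xt] := leP t x; first by apply: ff1; right.
have [y uy E] := im_surj fI ux.
have ugy := gU _ uy.
have us : unit_pt s by split => //; case: ux => _; exact: lt_trans.
have gys : g y < s.
  rewrite ltNge; apply/negP => h.
  have : g s <= g (g y).
    by move: h; rewrite le_eqVlt => /orP[/eqP ->//|h]; apply/ltW/gincr.
  by rewrite gf// E; lra.
have gyE : g1 (g y) = x by rewrite left ?gf ?E//; exact: ltW.
have gw : g (g y) = x by rewrite gf.
have g1xE : g1 x = g x.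
  by rewrite -{1}gyE gf1// -ff1 -?gf ?gw//; left; exact: ltW.
have gs : g s < g x by exact: gincr.
by rewrite -gf// -gf1// g1xE right//; [exact: gU|lra].
Qed.

End IntervalMaps.

(** * Saddles and their square roots *)

Section Saddle.
Context {R : realType} {m : nat} {M : smoothManifold R m.+1} (q : cube M).
Local Notation vec := 'rV[R]_m.+1.
Local Notation e0 := (delta_mx 0 0 : vec).

Definition axis (x : R) : M := pinv q (x *: e0).

Lemma axisE x : axis x = pinv q (x *: e0). Proof. by []. Qed.

Definition saddle_linear (tau : R) (w : vec) : vec :=
  \row_i (if i == 0 then (1 + tau) * w 0 0 else (1 - tau) * w 0 i).

(* [sd_left] forbids a root to reverse the direction of the axis at 0. *)
Record saddle (tau : R) (f : R -> R) (phi : M -> M) : Prop := Saddle {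
  sd_tau : 0 < tau < 1;
  sd_interval : interval_map tau f;
  sd_axis : forall x, unit_pt x -> phi (axis x) = axis (f x);
  sd_near0 : forall w : vec, `|w| <= 3^-1 -> phi (pinv q w) = pinv q (saddle_linear tau w);
  sd_near1 : forall w : vec, `|w| <= 3^-1 ->
    phi (pinv q (e0 + w)) = pinv q (e0 + (1 - tau) *: w);
  sd_left : forall w : vec, `|w| < 4 -> w 0 0 <= 0 ->
    exists w' : vec, [/\ `|w'| < 4, w' 0 0 <= 0 & phi (pinv q w) = pinv q w'];
  sd_fix : forall x, phi x = x -> [\/ x = axis 0, x = axis 1 | ~ zone q 3 x];
  sd_out : forall x, ~ zone q 3 x -> phi x = x
}.

(* The constant [b] is not prescribed: it can only be [Num.sqrt (1 - tau)]. *)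
Definition good_root (tau : R) (phi psi : M -> M) : Prop :=
  [/\ forall x, psi (psi x) = phi x,
   exists2 d : R, 0 < d & forall x, 0 < x -> x < d ->
     psi (axis x) = axis (Num.sqrt (1 + tau) * x) &
   exists b d : R, 0 < d /\ forall x, 0 < x -> x < d ->
     pmap q (psi (axis (1 - x))) 0 0 = 1 - b * x].

Lemma axis_norm (x : R) : `|x *: e0| = `|x|.
Proof.
apply/eqP; rewrite eq_le; apply/andP; split.
  by rewrite normrZ ler_piMr// norm_delta0.
have := normr_coord_le (x *: e0) 0.
by rewrite !mxE !eqxx /= mulr1.
Qed.

Lemma pmap_axis x : `|x| <= 4 -> pmap q (axis x) = x *: e0.
Proof. by move=> h; rewrite pinvK// axis_norm. Qed.

Lemma pmap_axis0 x : `|x| <= 4 -> pmap q (axis x) 0 0 = x.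
Proof. by move=> h; rewrite pmap_axis// !mxE !eqxx mulr1. Qed.

Lemma axis_inj x y : `|x| <= 4 -> `|y| <= 4 -> axis x = axis y -> x = y.
Proof.
by move=> hx hy E; rewrite -(pmap_axis0 hx) E pmap_axis0.
Qed.

Lemma unit_norm (x : R) : unit_pt x -> `|x| <= 4.
Proof. by move=> [h0 h1]; rewrite ger0_norm; lra. Qed.

Section Root.
Variables (tau : R) (f : R -> R) (phi : M -> M).
Hypothesis S : saddle tau f phi.

Let lam := Num.sqrt (1 + tau).

Lemma lam_gt1 : 1 < lam.
Proof. by have /andP[h _] := sd_tau S; rewrite -sqrtr1 ltr_sqrt; lra. Qed.

Lemma lam_lt2 : lam < 2.
Proof.
have /andP[h h1] := sd_tau S.
have -> : 2 = Num.sqrt (2 ^+ 2) :> R by rewrite sqrtr_sqr ger0_norm.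
by rewrite ltr_sqrt; lra.
Qed.

Lemma saddle_iter_axis n x : unit_pt x -> iter n phi (axis x) = axis (iter n f x).
Proof.
move=> ux; elim: n => //= n ->; rewrite (sd_axis S)//.
exact: (im_iter_unit (sd_interval S)).
Qed.

Lemma saddle_f_near0 x : 0 < x -> x <= 3^-1 -> f x = (1 + tau) * x.
Proof.
move=> x0 x3; have /andP[t0 t1] := sd_tau S.
have ux : unit_pt x by split => //; lra.
have := sd_axis S ux; rewrite {1}/axis (sd_near0 S); last first.
  by rewrite axis_norm ger0_norm// ltW.
have -> : saddle_linear tau (x *: e0) = ((1 + tau) * x) *: e0.
  by apply/rowP => i; rewrite !mxE !eqxx /=; case: (i == 0); rewrite ?mulr1 ?mulr0.
move/axis_inj => -> //; last by apply: unit_norm; exact: (im_unit (sd_interval S)).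
by rewrite ger0_norm; nra.
Qed.

Lemma saddle_f_near1 x : 0 < x -> x <= 3^-1 -> f (1 - x) = 1 - (1 - tau) * x.
Proof.
move=> x0 x3; have /andP[t0 t1] := sd_tau S.
have ux : unit_pt (1 - x) by split; lra.
have := sd_axis S ux; rewrite {1}/axis.
have -> : (1 - x) *: e0 = e0 + (- x) *: e0 by rewrite scalerBl scale1r scaleNr.
rewrite (sd_near1 S); last by rewrite axis_norm normrN ger0_norm// ltW.
have -> : e0 + (1 - tau) *: (- x *: e0) = (1 - (1 - tau) * x) *: e0.
  by rewrite [RHS]scalerBl scale1r scalerA mulrN scaleNr.
move/axis_inj => -> //; last by apply: unit_norm; exact: (im_unit (sd_interval S)).
by rewrite ger0_norm; nra.
Qed.

(** Every point of the segment is an iterate under [f] of some [z] close to 0, and [psi] commutes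
    with [phi]; hence [psi] sends it to the same iterate of [lam * z]. So [psi] preserves the whole
    segment, a fact that [good_root] asserts near 0 only, and there it is increasing and moves
    points towards 1. *)
Lemma good_root_interval psi : good_root tau phi psi ->
  exists g : R -> R,
  [/\ forall x, unit_pt x -> unit_pt (g x),
      forall x, unit_pt x -> g (g x) = f x,
      forall x, unit_pt x -> x < g x,
      forall x y, unit_pt x -> unit_pt y -> x < y -> g x < g y &
      (exists2 d : R, 0 < d & forall x, 0 < x -> x < d -> g x = lam * x) /\
      (exists2 d : R, 0 < d & forall x, 1 - d < x -> x < 1 ->
         g x = 1 - Num.sqrt (1 - tau) * (1 - x))].
Proof.
move=> [pp [d d0 dP] [b [d1 [d10 bP]]]].
have fI := sd_interval S; have l1 := lam_gt1; have l2 := lam_lt2.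
have /andP[t0 t1] := sd_tau S.
have comm n x : psi (iter n phi x) = iter n phi (psi x).
  by elim: n => //= n <-; rewrite -!pp.
(* For [z] below 1/2, [lam * z] stays below 1, as [lam < 2]. *)
pose d' := Num.min d 2^-1.
have d'0 : 0 < d' by rewrite lt_min d0 invr_gt0//=.
have d'd x : x < d' -> x < d by rewrite lt_min => /andP[].
have d'2 x : x < d' -> x < 2^-1 by rewrite lt_min => /andP[].
have ul z : unit_pt z -> z < d' -> unit_pt (lam * z).
  move=> [z0 z1] /d'2 h; split; first by rewrite mulr_gt0//; lra.
  by nra.
have key n z : unit_pt z -> z < d' ->
    psi (axis (iter n f z)) = axis (iter n f (lam * z)).
  move=> uz zd; rewrite -saddle_iter_axis// comm dP; last 2 first.
  - by case: uz.
  - exact: d'd.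
  by rewrite saddle_iter_axis//; exact: ul.
have /choice[g gP] : forall x, exists y, unit_pt x -> unit_pt y /\ psi (axis x) = axis y.
  move=> x; have [ux|] := pselect (unit_pt x); last by exists 0.
  have [n [z [uz zd <-]]] := im_reach_down fI ux d'0.
  exists (iter n f (lam * z)) => _; split; last exact: key.
  by apply: (im_iter_unit fI); exact: ul.
have gU x : unit_pt x -> unit_pt (g x) by move=> /gP[].
have gE x : unit_pt x -> psi (axis x) = axis (g x) by move=> /gP[].
have gkey n z : unit_pt z -> z < d' -> g (iter n f z) = iter n f (lam * z).
  move=> uz zd; have un := im_iter_unit fI n uz.
  apply: axis_inj; rewrite -?gE ?key//; first by apply/unit_norm/gU.
  by apply/unit_norm/(im_iter_unit fI)/ul.
have gf x : unit_pt x -> g (g x) = f x.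
  move=> ux; apply: axis_inj.
  - by apply/unit_norm/gU/gU.
  - by apply/unit_norm/(im_unit fI).
  - by rewrite -(gE _ (gU _ ux)) -(gE _ ux) pp (sd_axis S).
have gx x : unit_pt x -> x < g x.
  move=> ux; have [n [z [uz zd <-]]] := im_reach_down fI ux d'0.
  rewrite gkey//; apply: (im_iter_incr fI) => //; first exact: ul.
  by case: uz => z0 _; nra.
have gincr x y : unit_pt x -> unit_pt y -> x < y -> g x < g y.
  move=> ux uy xy; have [n [z [uz zd E]]] := im_reach_down fI uy d'0.
  have [z' uz' E'] : exists2 z', unit_pt z' & iter n f z' = x.
    elim: n {z uz zd E} => [|n [z' uz' E']]; first by exists x.
    by have [z'' uz'' E''] := im_surj fI uz'; exists z'' => //; rewrite iterSr E''.
  have zz : z' < z.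
    rewrite ltNge; apply/negP; rewrite le_eqVlt => /orP[/eqP h|h].
      by move: xy; rewrite -E -E' h ltxx.
    by have := im_iter_incr fI n uz uz' h; rewrite E E'; lra.
  rewrite -E -E' !gkey//; last exact: lt_trans zd.
  apply: (im_iter_incr fI); [apply: ul => //; exact: lt_trans zd|exact: ul|].
  by rewrite ltr_pM2l//; lra.
exists g; split => //; split.
  exists d' => // x x0 xd.
  have ux : unit_pt x by split => //; have := d'2 _ xd; lra.
  by rewrite -[x in LHS]/(iter 0 f x) gkey.
pose d2 := Num.min d1 3^-1.
have d20 : 0 < d2 by rewrite lt_min d10 invr_gt0//=.
have d21 x : x < d2 -> x < d1 by rewrite lt_min => /andP[].
have d23 x : x < d2 -> x < 3^-1 by rewrite lt_min => /andP[].
have gb x : 0 < x -> x < d2 -> g (1 - x) = 1 - b * x.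
  move=> x0 xd; have u1 : unit_pt (1 - x) by split; [have := d23 _ xd; lra|lra].
  by rewrite -bP//; [rewrite gE// pmap_axis0//; exact/unit_norm/gU|exact: d21].
pose x := d2 / 2.
have x0 : 0 < x by rewrite divr_gt0.
have xd : x < d2 by rewrite ltr_pdivrMr// ltr_pMr// ltr1n.
have u1 : unit_pt (1 - x) by split; [have := d23 _ xd; lra|lra].
have bx := gb _ x0 xd.
have [gl gr] := gU _ u1; have gg := gx _ u1.
(* [1 - x < g (1 - x) < 1] puts [b * x] between 0 and [x], so the formula near 1 applies a second
   time; comparison with [f] gives [b * b = 1 - tau]. *)
have bx0 : 0 < b * x by lra.
have bx1 : b * x < d2 by lra.
have b0 : 0 < b by move: bx0; rewrite pmulr_lgt0.
have := gf _ u1; rewrite bx gb// saddle_f_near1//; last by have := d23 _ xd; lra.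
move=> E; have E2 : b * b = 1 - tau.
  by apply: (mulIf (lt0r_neq0 x0)); move: E; lra.
have bE : b = Num.sqrt (1 - tau) by rewrite -E2 -expr2 sqrtr_sqr gtr0_norm.
exists d2 => // y y0 y1.
have -> : y = 1 - (1 - y) by ring.
rewrite gb; [|lra|lra].
by rewrite -bE; ring.
Qed.

End Root.

(** One root selects an interval [1/2, t]; a saddle modified only inside it that also has a good
    root must have the same interval map. The germs of the two roots agree at both ends because they
    depend on [tau] only. *)
Lemma good_root_rigidity tau f phi psi :
  saddle tau f phi -> good_root tau phi psi ->
  exists t : R, [/\ 2^-1 < t, t < 2 * 3^-1 &
    forall f1 phi1 psi1, saddle tau f1 phi1 ->
      (forall x, x <= 2^-1 \/ t <= x -> f x = f1 x) ->
      good_root tau phi1 psi1 -> forall x, unit_pt x -> f x = f1 x].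
Proof.
move=> S gr; have [g [gU gf gx gincr [[d d0 dP] [d' d'0 d'P]]]] := good_root_interval S gr.
have u2 : unit_pt (2^-1 : R) by split; lra.
have g2 := gx _ u2.
(* The midpoint keeps [t] below [g 2^-1]; 7/12 lies between 1/2 and 2/3, where the linear part near
   e_0 begins. *)
pose t := Num.min ((2^-1 + g 2^-1) / 2) (7 / 12).
have tg : t < g 2^-1 by apply: (@le_lt_trans _ _ ((2^-1 + g 2^-1) / 2)); [rewrite ge_min lexx|lra].
have t2 : 2^-1 < t by rewrite lt_min; apply/andP; split; lra.
have t3 : t <= 7 / 12 by rewrite ge_min lexx orbT.
exists t; split => //; first by lra.
move=> f1 phi1 psi1 S1 ff1 gr1.
have [g1 [g1U gf1 g1x _ [[d1 d10 d1P] [d1' d1'0 d1'P]]]] := good_root_interval S1 gr1.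
apply: (interval_maps_eq (sd_interval S) (sd_interval S1) gU g1U gf gf1 gx g1x gincr
  _ _ ff1 _ t2 tg); last by lra.
- exists (Num.min d d1); first by rewrite lt_min d0.
  by move=> x x0; rewrite lt_min => /andP[xd xd1]; rewrite dP// d1P.
- exists (Num.min d' d1'); first by rewrite lt_min d'0.
  move=> x; rewrite ltrBlDr -ltrBlDl lt_min => /andP[h1 h2] x1.
  by rewrite d'P ?d1'P//; lra.
Qed.

End Saddle.

(** * Saddles of the form id + tau field + sigma kick *)

Section ExplicitSaddle.
Context {R : realType} {m : nat} {M : smoothManifold R m.+1} (q : cube M).
Local Notation vec := 'rV[R]_m.+1.
Local Notation e0 := (delta_mx 0 0 : vec).
Variables (tau sigma s t : R).
Hypotheses (tau_gt0 : 0 < tau) (tau_lt1 : tau < 1) (sigma_ge0 : 0 <= sigma).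
Hypotheses (s_ge : 3^-1 <= s) (t_le : t <= 2 * 3^-1).

Definition kicked_field (w : vec) : vec := tau *: field w + sigma *: kick s t w.

Hypothesis U_lip : forall v w, `|kicked_field v - kicked_field w| <= 2^-1 * `|v - w|.
Local Notation U := kicked_field.

Definition axis_map (x : R) : R := (x *: e0 + U (x *: e0)) 0 0.

Lemma kicked_field_smooth : smooth_on setT U.
Proof.
have oT := @openT vec.
have := @field_smooth R m; have := @kick_smooth R m s t.
move=> /(smooth_on_coordP _ oT) ks /(smooth_on_coordP _ oT) fs.
apply/smooth_on_coordP => // k j.
have -> : (fun x => U x 0 j) = (fun x => tau * field x 0 j + sigma * kick s t x 0 j).
  by apply/funext => x; rewrite !mxE.
by apply: CkD => //; apply: CkM => //; exact: Ck_cst.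
Qed.

Lemma kicked_field_eq0 (w : vec) : 3 <= `|w| -> U w = 0.
Proof. by move=> h; rewrite /U field_eq0// kick_eq0// !scaler0 addr0. Qed.

Lemma axis_mapE x : `|x| <= 2 ->
  axis_map x = x + tau * profile x + sigma * (bump (x - s) * bump (t - x)).
Proof.
by move=> h; rewrite /axis_map /U field_axis// kick_axis// !mxE !eqxx /= !mulr1 addrA.
Qed.

Lemma axis_perturb x : `|x| <= 2 -> x *: e0 + U (x *: e0) = axis_map x *: e0.
Proof.
move=> h; rewrite axis_mapE// /U field_axis// kick_axis// !scalerA -!scalerDl.
by rewrite addrA.
Qed.

(** The 1/2-Lipschitz bound on the perturbation leaves at least half of [y - x]. This yields
    monotonicity, and keeps the images of points of the interval below 1. *)
Lemma axis_map_expanding x y : x <= y -> 2^-1 * (y - x) <= axis_map y - axis_map x.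
Proof.
move=> xy.
have -> : axis_map y - axis_map x = (y - x) + (U (y *: e0) - U (x *: e0)) 0 0.
  rewrite /axis_map; move: (U (y *: e0)) (U (x *: e0)) => a b.
  by rewrite !mxE !eqxx /=; ring.
have h1 := normr_coord_le (U (y *: e0) - U (x *: e0)) 0.
have := le_trans h1 (U_lip _ _).
rewrite -scalerBl axis_norm (@ger0_norm _ (y - x)) ?subr_ge0// ler_norml => /andP[h2 _].
by lra.
Qed.

Lemma profile_ge_min (x : R) : unit_pt x -> Num.min x (1 - x) <= profile x.
Proof.
move=> [x0 x1]; rewrite /profile.
have := step_ge0 (2 - 3 * x); have := step_le1 (2 - 3 * x).
have h1 : Num.min x (1 - x) <= x by rewrite ge_min lexx.
have h2 : Num.min x (1 - x) <= 1 - x by rewrite ge_min lexx orbT.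
by set b := step _ => b1 b0; nra.
Qed.

Lemma axis_map0 : axis_map 0 = 0.
Proof.
have s_ge' := s_ge.
have b0 : bump (0 - s) = 0 by apply: bump_eq0; lra.
have p0 : profile (0 : R) = 0 by apply: profile_near0; lra.
by rewrite axis_mapE ?normr0// p0 b0 mul0r !mulr0 !addr0.
Qed.

Lemma axis_map1 : axis_map 1 = 1.
Proof.
have t_le' := t_le.
have b0 : bump (t - 1) = 0 by apply: bump_eq0; lra.
have p0 : profile (1 : R) = 0 by rewrite profile_near1 ?subrr//; lra.
by rewrite axis_mapE ?normr1 ?ler1n// p0 b0 !mulr0 !addr0.
Qed.

Lemma axis_map_interval : interval_map tau axis_map.
Proof.
have tau_gt0' := tau_gt0; have tau_lt1' := tau_lt1.
have gt x : unit_pt x -> tau * Num.min x (1 - x) <= axis_map x - x.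
  move=> ux; have [x0 x1] := ux; rewrite axis_mapE; last by rewrite ger0_norm; lra.
  have h : 0 <= sigma * (bump (x - s) * bump (t - x)).
    by rewrite mulr_ge0// mulr_ge0// bump_ge0.
  have := ler_wpM2l (ltW tau_gt0) (profile_ge_min ux); lra.
split => //.
- move=> x ux; have [x0 x1] := ux; split.
    have : 0 <= tau * Num.min x (1 - x).
      by rewrite mulr_ge0 ?(ltW tau_gt0)// le_min; apply/andP; split; lra.
    by have := gt _ ux; lra.
  by have := axis_map_expanding (ltW x1); rewrite axis_map1; lra.
- move=> x y _ _ xy; have := axis_map_expanding (ltW xy).
  by move: (axis_map x) (axis_map y) => a b; lra.
- move=> y [y0 y1].
  have c : continuous axis_map.
    move=> x.
    have -> : axis_map = (fun w : vec => (w + U w) 0 0) \o (fun x : R => x *: e0) by [].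
    apply: continuous_comp.
      by apply: cvgZr_tmp; exact: cvg_id.
    have -> : (fun w : vec => (w + U w) 0 0) = (fun w => w 0 0 + U w 0 0).
      by apply/funext => w; rewrite mxE.
    apply: (@Ck_continuous _ _ _ 0 setT) => //; apply: CkD; [exact: openT|exact: Ck_coord|].
    by move: kicked_field_smooth => /(smooth_on_coordP _ openT); apply.
  have [|||x /[!in_itv]/= /andP[x0 x1] E] := @IVT R axis_map 0 1 y.
  + exact: ler01.
  + exact: continuous_subspaceT.
  + by rewrite axis_map0 axis_map1 (min_idPl ler01) (max_idPr ler01) !ltW.
  exists x => //; split; rewrite lt_neqAle ?x0 ?x1 ?andbT; apply/eqP => X.
    by move: y0; rewrite -E -X axis_map0 ltxx.
  by move: y1; rewrite -E X axis_map1 ltxx.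
Qed.

Lemma explicit_saddle : saddle q tau axis_map (push q (fun w => w + U w)).
Proof.
have tau_gt0' := tau_gt0; have tau_lt1' := tau_lt1; have s_ge' := s_ge; have t_le' := t_le.
have [P4 [d [dE _]]] := perturb_diffc q kicked_field_smooth kicked_field_eq0 U_lip.
have n3 : 3^-1 <= 4 :> R by lra.
split => //.
- by rewrite tau_gt0.
- exact: axis_map_interval.
- move=> x [x0 x1]; rewrite /axis push_pinv; last by rewrite axis_norm ger0_norm; lra.
  by rewrite axis_perturb// ger0_norm; lra.
- move=> w w3; rewrite push_pinv; last by lra.
  congr pinv; rewrite /U field_near0// kick_eq0_out; last first.
    by left; have := le_trans (ler_norm _) (normr_coord_le w 0); lra.
  by apply/rowP => i; rewrite !mxE; case: eqVneq => [->|_]; ring.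
- move=> w w3.
  have h4 : `|e0 + w| < 4.
    by apply: le_lt_trans (ler_normD _ _) _; have := @norm_delta0 R m; lra.
  rewrite push_pinv//; congr pinv.
  have h : `|(e0 + w) - e0| <= 3^-1 by rewrite addrC addKr.
  rewrite /U field_near1// kick_eq0_out; last first.
    right; rewrite mxE delta00 eqxx.
    have := le_trans (normr_coord_le w 0) w3; rewrite ler_norml => /andP[h1 _].
    by rewrite mulr1n; lra.
  rewrite scaler0 addr0 -addrA; congr (_ + _).
  by rewrite [e0 + w]addrC addrK scalerN scalerBl scale1r.
- move=> w w4 w0; exists (w + U w); split; [exact: P4| |exact: push_pinv].
  (* For [w 0 0 <= 0] the kick vanishes and the new first coordinate is
     [(1 + tau * cutoff w) * w 0 0]. *)
  rewrite /U kick_eq0_out; last by left; lra.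
  rewrite scaler0 addr0 !mxE eqxx profile_near0; last by lra.
  have c0 : 0 <= cutoff w.
    have [h|h] := leP 3 `|w|; first by rewrite cutoff_eq0.
    by apply/ltW/cutoff_gt0.
  have : 0 <= tau * cutoff w by rewrite mulr_ge0// ltW.
  by nra.
- move=> x; have [z|z] := pselect (zone q 3 x); last by move=> _; apply: Or33.
  have [w w3 ->] := pinv_zone z.
  have w4 : `|w| < 4 by lra.
  rewrite push_pinv// => /(congr1 (pmap q)); rewrite !pinvK; [|exact: ltW|exact/ltW/P4].
  move=> /(congr1 (fun v => v - w)); rewrite addrAC subrr add0r => U0.
  have c0 := cutoff_gt0 w3.
  (* Inside the cube the cutoff is positive, so a vanishing perturbation forces all transverse
     coordinates to vanish. On the axis the field and the kick cannot cancel: between 0 and 1 the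
     field is positive and the kick nonnegative, elsewhere the kick is zero. *)
  have wi i : i != 0 -> w 0 i = 0.
    move=> i0; have := congr1 (fun v : vec => v 0 i) U0; rewrite !mxE (negPf i0) mulr0 addr0.
    move/eqP; rewrite mulf_eq0 gt_eqF//= mulf_eq0 gt_eqF//= oppr_eq0 => /eqP //.
  have wE : w = w 0 0 *: e0.
    apply/rowP => i; rewrite mxE delta00; case: (eqVneq i 0) => [->|/wi ->].
      by rewrite mulr1.
    by rewrite mulr0.
  have := congr1 (fun v : vec => v 0 0) U0; rewrite !mxE !eqxx.
  rewrite mulrCA [sigma * _]mulrCA -mulrDr => /eqP; rewrite mulf_eq0 gt_eqF//= => /eqP E.
  have k0 : 0 <= sigma * (bump (w 0 0 - s) * bump (t - w 0 0)).
    by rewrite mulr_ge0// mulr_ge0// bump_ge0.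
  have [h|h|h] := ltgtP (w 0 0) 0.
  + move: E; rewrite profile_near0; last by lra.
    rewrite (@bump_eq0 _ (w 0 0 - s)) ?mul0r ?mulr0 ?addr0; last by lra.
    have : tau * w 0 0 < 0 by rewrite pmulr_rlt0.
    by lra.
  + have [h1|h1|h1] := ltgtP (w 0 0) 1.
    * have : 0 < tau * profile (w 0 0) by rewrite mulr_gt0// profile_gt0.
      by lra.
    * move: E; rewrite profile_near1; last by lra.
      rewrite (@bump_eq0 _ (t - w 0 0)) ?mulr0 ?addr0; last by lra.
      have : tau * (1 - w 0 0) < 0 by rewrite pmulr_rlt0// subr_lt0.
      by lra.
    * by apply: Or32; rewrite wE h1.
  + by apply: Or31; rewrite wE h.
- move=> x; apply: push_out; exact: perturb_cubical kicked_field_eq0.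
Qed.

End ExplicitSaddle.

(** One-sided, since germs at the ends of the segment are followed for positive [x] only. *)
Lemma derive_right (R : realType) (V : normedModType R) (g : V -> R) (v w : V) :
  derivable g v w ->
  (g (v + x *: w) - g v) / x @[x --> 0^'+] --> 'D_w g v.
Proof.
move=> dP A /dP NA.
have {}NA : nbhs (0:R) (fun h => h != 0 ->
  A (h^-1 *: ((g \o shift v) (h *: w) - g v))) by exact: NA.
suff : nbhs (0:R) (fun x => 0 < x -> A ((g (v + x *: w) - g v) / x)) by [].
apply: filterS NA => x K x0; have := K (lt0r_neq0 x0).
rewrite /= [x *: w + v]addrC; suff -> : forall y : R, x^-1 *: y = y / x by [].
by move=> y; rewrite mulrC.
Qed.

(* Under [u (a x) = k (u x)] the ratio [u x / x] is multiplied by [k / a] as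
   [x] is replaced by [a x], while it has a limit at 0. *)
Section Ratio.
Context {R : realType}.
Variables (u : R -> R) (a k d de : R).
Hypotheses (a0 : 0 < a) (a1 : a < 1) (ak : a <= k).
Hypothesis u_scale : forall x, 0 < x -> x < de -> u (a * x) = k * u x.
Hypothesis u_cvg : u x / x @[x --> 0^'+] --> d.

Lemma ratio_iter n x : 0 < x -> x < de -> u x = (a / k) ^+ n * (u (a ^+ n * x) / (a ^+ n * x)) * x.
Proof.
move=> x0 xd; have k0 : 0 < k by exact: lt_le_trans ak.
have an m : 0 < a ^+ m by rewrite exprn_gt0.
have xn m : a ^+ m * x < de.
  by apply: le_lt_trans xd; rewrite ler_piMl ?exprn_ile1// ltW.
elim: n => [|n ->]; first by rewrite !expr0 !mul1r divfK// gt_eqF.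
have -> : a ^+ n.+1 * x = a * (a ^+ n * x) by rewrite exprS mulrA.
rewrite u_scale ?mulr_gt0// [(a / k) ^+ n.+1]exprS.
have := an n; move: (u (a ^+ n * x)) ((a / k) ^+ n) (a ^+ n) => y z w w0.
by field; rewrite !gt_eqF.
Qed.

Lemma ratio_cvg x : 0 < x -> x < de -> u (a ^+ n * x) / (a ^+ n * x) @[n --> \oo] --> d.
Proof.
move=> x0 xd.
have an m : 0 < a ^+ m by rewrite exprn_gt0.
have c : (fun n => a ^+ n * x) @ \oo --> (0 : R)^'+.
  move=> A [e /= e0 eA].
  have c0 : a ^+ n * x @[n --> \oo] --> (0 * x : R).
    by apply: cvgMl; apply: cvg_expr; rewrite ger0_norm// ltW.
  rewrite mul0r in c0; move/cvgrPdist_lt : c0 => /(_ _ e0).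
  apply: filterS => n h; apply: eA => //=; last by rewrite mulr_gt0.
exact: cvg_comp c u_cvg.
Qed.

(** With [k = a] the ratio is constant along the sequence, hence equal to its limit. *)
Lemma ratio_linear x : k = a -> 0 < x -> x < de -> u x = d * x.
Proof.
move=> kE x0 xd; suff -> : d = u x / x by rewrite divfK// gt_eqF.
have c := ratio_cvg x0 xd.
have E : (fun n => u (a ^+ n * x) / (a ^+ n * x)) = fun=> u x / x.
  apply/funext => n; rewrite [in RHS](ratio_iter n x0 xd) kE divff ?gt_eqF//.
  by rewrite expr1n mul1r mulfK// gt_eqF.
rewrite E in c; apply/esym.
by have /cvg_lim <- // := c; rewrite lim_cst.
Qed.

(** The factor [(a / k) ^+ n] tends to 0 while the ratio converges. This is what excludes transverse
    components. *)
Lemma ratio_zero x : a < k -> 0 < x -> x < de -> u x = 0.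
Proof.
move=> kE x0 xd; have k0 : 0 < k by exact: lt_le_trans ak.
have c := ratio_cvg x0 xd.
have c2 : (a / k) ^+ n * (u (a ^+ n * x) / (a ^+ n * x)) * x @[n --> \oo] --> (0 * d * x : R).
  apply: cvgMl; apply: cvgM => //; apply: cvg_expr.
  by rewrite ger0_norm ?divr_ge0 ?ltW// ltr_pdivrMr// mul1r.
have E : (fun n => (a / k) ^+ n * (u (a ^+ n * x) / (a ^+ n * x)) * x) = fun=> u x.
  by apply/funext => n; rewrite -ratio_iter.
rewrite E !mul0r in c2.
by have /cvg_lim <- // := c2; rewrite lim_cst.
Qed.

End Ratio.

(* [lra] fails in the presence of equations between points of a manifold. *)
Ltac real_arith := repeat match goal with
  | H : @eq (Topological.sort (carrier _)) _ _ |- _ => clear H end; lra.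
Ltac real_nonlin := repeat match goal with
  | H : @eq (Topological.sort (carrier _)) _ _ |- _ => clear H end; nra.

(** * The fixed points of a root *)

Section DiffeoRoot.
Context {R : realType} {m : nat} {M : smoothManifold R m.+1} (q : cube M).
Local Notation vec := 'rV[R]_m.+1.
Local Notation e0 := (delta_mx 0 0 : vec).
Local Notation axis := (axis q).
Local Notation pmap := (pmap q).
Local Notation pinv := (pinv q).

Lemma line_continuous (v w : vec) : continuous (fun x : R => v + x *: w).
Proof. by move=> x; apply: cvgD; [exact: cvg_cst|apply: cvgZr_tmp; exact: cvg_id]. Qed.

Lemma pinv_line_near (v w : vec) (A : set M) :
  `|v| <= 4 -> nbhs (pinv v) A ->
  exists2 e : R, 0 < e & forall x, 0 <= x -> x < e -> A (pinv (v + x *: w)).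
Proof.
move=> v4 NA.
have c : {for (0 : R), continuous (pinv \o (fun x : R => v + x *: w))}.
  apply: continuous_comp; first exact: line_continuous.
  by rewrite scale0r addr0; exact: pinv_continuous.
have N : \forall x \near (0:R), A (pinv (v + x *: w)).
  by apply: c; rewrite /= scale0r addr0.
move: N => /nbhs_ballP[e /= e0 eA]; exists e => // x x0 xe; apply: eA.
by rewrite -ball_normE /= sub0r normrN ger0_norm.
Qed.

Lemma pmap_nbhs (x : M) (e : R) : cdom q x -> 0 < e ->
  \forall y \near x, cdom q y /\ `|pmap y - pmap x| < e.
Proof.
move=> qx e0.
have N1 : \forall y \near x, cdom q y.
  by apply: open_nbhs_nbhs; split=> //; exact: cdom_open.
have := pmap_continuous qx => /cvgrPdist_lt/(_ _ e0).
by apply: filterS2 N1 => y qy; rewrite distrC.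
Qed.

Lemma axis0E : axis 0 = pinv 0.
Proof. by rewrite axisE scale0r. Qed.

Lemma axis1E : axis 1 = pinv e0.
Proof. by rewrite axisE scale1r. Qed.

Lemma e0_le4 : `|e0| <= 4.
Proof. by have := @norm_delta0 R m; lra. Qed.

Lemma axis01 : axis 0 <> axis 1.
Proof.
move=> /(congr1 (fun x => pmap x 0 0)); rewrite !pmap_axis0 ?normr0 ?normr1; lra.
Qed.

Section Fixed.
Variables (tau : R) (f : R -> R) (phi psi psi' : M -> M).
Hypothesis S : saddle q tau f phi.
Hypothesis psic : continuous psi.
Hypothesis psic' : continuous psi'.
Hypothesis psiK : cancel psi psi'.
Hypothesis psiK' : cancel psi' psi.
Hypothesis psiE : forall x, psi (psi x) = phi x.

Let comm x : psi (phi x) = phi (psi x).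
Proof. by rewrite -!psiE. Qed.

Let comm' x : psi' (phi x) = phi (psi' x).
Proof. by apply: (can_inj psiK); rewrite psiK' comm psiK'. Qed.

Lemma saddle_fix0 : phi (axis 0) = axis 0.
Proof.
rewrite axis0E (sd_near0 S) ?normr0 ?invr_ge0//; congr pinv.
by apply/rowP => i; rewrite !mxE !mulr0 if_same.
Qed.

Lemma saddle_fix1 : phi (axis 1) = axis 1.
Proof.
have := sd_near1 S (w := 0); rewrite normr0 invr_ge0 ler0n => /(_ isT).
by rewrite scaler0 !addr0 axis1E.
Qed.

Lemma saddle_isolated (r : R) : r = 0 \/ r = 1 ->
  exists2 A : set M, nbhs (axis r) A & forall x, A x -> phi x = x -> x = axis r.
Proof.
move=> r01.
have r4 : `|r| <= 4 by case: r01 => ->; rewrite ?normr0 ?normr1; real_arith.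
have re4 : `|r *: e0| <= 4 by rewrite axis_norm.
(* Radius 1/2 separates 0 from e_0 and stays within norm 3. *)
pose A : set M := [set x | cdom q x /\ `|pmap x - pmap (axis r)| < 2^-1].
exists A.
  by apply: pmap_nbhs; [exact: pinv_dom|real_arith].
move=> x [qx h] /(sd_fix S).
have c (r' : R) : r' = 0 \/ r' = 1 -> x = axis r' -> x = axis r.
  move=> r'01 E; move: h; rewrite E !pmap_axis//; last first.
    by case: r'01 => ->; rewrite ?normr0 ?normr1; real_arith.
  rewrite -scalerBl axis_norm; case: r'01 => ->; case: r01 => -> //.
    by rewrite sub0r normrN normr1 => h01; exfalso; real_arith.
  by rewrite subr0 normr1 => h01; exfalso; real_arith.
case; [by apply: c; left|by apply: c; right|].
move=> nz3; exfalso; apply: nz3; split => //.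
rewrite -[pmap x](subrK (pmap (axis r))); apply: le_lt_trans (ler_normD _ _) _.
rewrite pmap_axis// axis_norm in h *.
by case: r01 h => -> h; rewrite ?normr0 ?normr1; real_arith.
Qed.

(** The image of an isolated fixed point is again one, since [psi] commutes with [phi]. But all
    points off [zone q 3] are fixed: one on the boundary of the cube has fixed points radially
    outwards, and one off [core] has a neighbourhood of fixed points, which would have to be a
    single point although [axis r] is not isolated in M. *)
Lemma root_fixed_or (r : R) : r = 0 \/ r = 1 -> phi (axis r) = axis r ->
  psi (axis r) = axis 0 \/ psi (axis r) = axis 1.
Proof.
move=> r01 rfix.
have r4 : `|r| <= 4 by case: r01 => ->; rewrite ?normr0 ?normr1; real_arith.
have re4 : `|r *: e0| <= 4 by rewrite axis_norm.
have pfix : phi (psi (axis r)) = psi (axis r) by rewrite -comm rfix.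
have [h|h|nz] := sd_fix S pfix; [by left|by right|exfalso].
have [A NA Afix] := saddle_isolated r01.
have NB : nbhs (psi (axis r)) (psi' @^-1` A).
  by apply: psic'; rewrite psiK.
have Bfix y : A (psi' y) -> phi y = y -> y = psi (axis r).
  move=> Ay yfix; rewrite -[y]psiK'; congr psi; apply: Afix => //.
  by rewrite -comm' yfix.
have Bz y : A (psi' y) -> y <> psi (axis r) -> zone q 3 y.
  by move=> Ay yr; apply: contrapT => z; apply: yr; apply: Bfix => //; exact: (sd_out S).
have [[w w3 wE]|nc] := pselect (core q (psi (axis r))).
  have w4 : `|w| <= 4 by rewrite (le_trans w3)//; real_arith.
  have w33 : 3 <= `|w|.
    by rewrite leNgt; apply/negP => h; apply: nz; rewrite -wE; apply: zone_pinv => //; real_arith.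
  have [e e0' eP] := pinv_line_near w w4 (eq_ind_r (fun x => nbhs x _) NB wE).
  pose x := Num.min (e / 2) 4^-1.
  have x0 : 0 < x by rewrite lt_min divr_gt0//=; real_arith.
  have xe : x < e.
    by apply: (@le_lt_trans _ _ (e / 2)); [rewrite ge_min lexx|real_arith].
  have x4 : x <= 4^-1 by rewrite ge_min lexx orbT.
  have wxE : w + x *: w = (1 + x) *: w by rewrite scalerDl scale1r.
  have n1 : `|w + x *: w| = (1 + x) * `|w| by rewrite wxE normrZ ger0_norm//; real_arith.
  have n4 : `|w + x *: w| <= 4 by rewrite n1; move: w3; rewrite /=; real_nonlin.
  have [_] : zone q 3 (pinv (w + x *: w)).
    apply: Bz; first exact: eP (ltW x0) xe.
    rewrite -wE => /(congr1 pmap); rewrite !pinvK// wxE => /(congr1 (fun v : vec => `|v|)).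
    by rewrite normrZ ger0_norm; [real_nonlin|real_arith].
  by rewrite pinvK// n1 ltNge; apply/negP/negPn; real_nonlin.
have NC : nbhs (psi (axis r)) ((psi' @^-1` A) `&` ~` core q).
  apply: filterI => //; apply: open_nbhs_nbhs; split => //.
  by apply: closed_openC; exact: core_closed.
have Csing y : ((psi' @^-1` A) `&` ~` core q) y -> y = psi (axis r).
  move=> [Ay yc]; apply: contrapT => yr; have := Bz _ Ay yr.
  by move=> /pinv_zone[w w3 E]; apply: yc; exists w => //=; exact: ltW.
have ND := psic NC.
have [e e0' eP] := pinv_line_near e0 re4 ND.
have E : psi (axis (r + e / 2)) = psi (axis r).
  apply: Csing; have := eP (e / 2); rewrite -scalerDl; apply; real_arith.
have : axis (r + Num.min (e / 2) 1) = axis r.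
  apply: (can_inj psiK); apply: Csing.
  have := eP (Num.min (e / 2) 1); rewrite -scalerDl; apply.
    by rewrite le_min ler01 andbT; real_arith.
  by apply: (@le_lt_trans _ _ (e / 2)); [rewrite ge_min lexx|real_arith].
have h1 : 0 < Num.min (e / 2) 1 by rewrite lt_min ltr01 andbT; real_arith.
have h2 : Num.min (e / 2) 1 <= 1 by rewrite ge_min lexx orbT.
move/axis_inj => /(_ _ r4); set z := Num.min _ _ in h1 h2 *.
have rz : `|r + z| <= 4 by case: r01 => ->; rewrite ger0_norm; real_arith.
by move=> /(_ rz); real_arith.
Qed.

(** Along the segment 0 repels and e_0 attracts. If they were exchanged, [psi (axis x)] would lie
    near e_0 and its iterates would tend to e_0; the images of these under [psi], which tend to
    [axis 0], are iterates of [axis x] under [phi], and those stay at distance at least [x] from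
    0. *)
Lemma root_not_swap : psi (axis 0) <> axis 1.
Proof.
move=> E01.
have E10 : psi (axis 1) = axis 0.
  have [//|E] := @root_fixed_or 1 (or_intror erefl) saddle_fix1.
  by exfalso; apply: axis01; apply: (can_inj psiK); rewrite E01 E.
have fI := sd_interval S; have /andP[t0 t1] := sd_tau S.
have N1 : nbhs (axis 0) (psi @^-1` [set x | cdom q x /\ `|pmap x - pmap (axis 1)| < 3^-1]).
  apply: psic; rewrite E01; apply: pmap_nbhs; last by real_arith.
  by rewrite axis1E; apply: pinv_dom; exact: e0_le4.
rewrite axis0E in N1.
have [e e0' eP] := pinv_line_near (v := 0) e0
  (eq_ind_r (fun x => x <= 4) (ler0n _ 4) (normr0 _)) N1.
pose x := Num.min (e / 2) 2^-1.
have x0 : 0 < x by rewrite lt_min divr_gt0//=; real_arith.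
have xe : x < e.
  by apply: (@le_lt_trans _ _ (e / 2)); [rewrite ge_min lexx|real_arith].
have x2 : x <= 2^-1 by rewrite ge_min lexx orbT.
have ux : unit_pt x by split => //; real_arith.
have [qx xb] := eP _ (ltW x0) xe.
rewrite add0r -/(axis x) in qx xb.
set w := pmap (psi (axis x)) - pmap (axis 1) in xb.
have wE : psi (axis x) = pinv (e0 + w).
  rewrite /w pmap_axis ?normr1; last by real_arith.
  by rewrite scale1r addrC subrK pmapK.
have iw n : iter n phi (psi (axis x)) = pinv (e0 + (1 - tau) ^+ n *: w).
  elim: n => [|n IH]; first by rewrite scale1r.
  rewrite iterS IH (sd_near1 S) ?scalerA ?exprS//.
  rewrite normrZ ger0_norm ?exprn_ge0; [|real_arith|real_arith].
  apply: le_trans (ltW xb); rewrite ler_piMl// exprn_ile1; real_arith.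
have commn n y : psi (iter n phi y) = iter n phi (psi y).
  by elim: n => //= n <-; exact: comm.
have N2 : nbhs (axis 1) (psi @^-1` [set y | cdom q y /\ `|pmap y - pmap (axis 0)| < x]).
  apply: psic; rewrite E10; apply: pmap_nbhs => //.
  by rewrite axis0E; apply: pinv_dom; rewrite normr0.
rewrite axis1E in N2.
have [e' e'0 e'P] := pinv_line_near w e0_le4 N2.
have c0 : (1 - tau) ^+ n @[n --> \oo] --> (0 : R).
  by apply: cvg_expr; rewrite ger0_norm; real_arith.
have [n _ nP] : \forall n \near \oo, `|0 - (1 - tau) ^+ n| < e'.
  by move/cvgrPdist_lt : c0 => /(_ _ e'0).
have := nP n (leqnn n); rewrite sub0r normrN ger0_norm ?exprn_ge0//; last by real_arith.
move=> ne; have ex : 0 <= (1 - tau) ^+ n by rewrite exprn_ge0//; real_arith.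
have [_] := e'P _ ex ne.
rewrite -iw commn psiE -iterSr (saddle_iter_axis S)//.
have ui := im_iter_unit fI n.+1 ux.
rewrite !pmap_axis ?normr0//; last exact: unit_norm.
rewrite -scalerBl subr0 axis_norm ger0_norm; last by case: ui => /ltW.
by rewrite ltNge (im_iter_le fI).
Qed.

Lemma root_fix0 : psi (axis 0) = axis 0.
Proof.
have [//|E] := @root_fixed_or 0 (or_introl erefl) saddle_fix0.
by have := root_not_swap.
Qed.

Lemma root_fix1 : psi (axis 1) = axis 1.
Proof.
have [E|//] := @root_fixed_or 1 (or_intror erefl) saddle_fix1.
by exfalso; apply: axis01; apply: (can_inj psiK); rewrite E root_fix0.
Qed.

End Fixed.

End DiffeoRoot.

Section DiffeoGoodRoot.
Context {R : realType} {m : nat} {M : smoothManifold R m.+1} (q : cube M).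
Local Notation vec := 'rV[R]_m.+1.
Local Notation e0 := (delta_mx 0 0 : vec).
Local Notation axis := (axis q).
Local Notation pmap := (pmap q).
Local Notation pinv := (pinv q).

Lemma smooth_map_local_rep (g : M -> M) (c c' : chart R m.+1 M) x :
  smooth_map g -> atlas M c -> atlas M c' -> cdom c x -> cdom c' (g x) ->
  smooth_at (local_rep c c' g) (cmap c x).
Proof.
move=> [gc gs] Ac Ac' cx c'gx; apply: (smooth_on_at (U := local_dom c c' g)).
- apply: chart_open_image; last by move=> y [].
  apply: openI; first exact: cdom_open.
  by move/continuousP : gc; apply; exact: cdom_open.
- exact: gs.
- by exists x.
Qed.

Lemma smooth_map_cube (g : M -> M) (v : vec) :
  smooth_map g -> `|v| <= 4 -> cdom q (g (pinv v)) ->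
  smooth_at (pmap \o g \o pinv) v.
Proof.
move=> gs v4 qg.
pose aff (w : vec) : vec := cube_scale q *: w + cube_center q.
pose affi (z : vec) : vec := (cube_scale q)^-1 *: (z - cube_center q).
have -> : pmap \o g \o pinv = affi \o (local_rep q q g \o aff) by [].
apply: smooth_at_comp; last exact: affine_inv_smooth.
apply: smooth_at_comp; first exact: affine_center_smooth.
rewrite /aff -cmap_pinv//; apply: smooth_map_local_rep => //; try exact: cube_atlas.
exact: pinv_dom.
Qed.

Lemma smooth_map_right (g : M -> M) (v w : vec) i :
  smooth_map g -> `|v| <= 4 -> cdom q (g (pinv v)) ->
  exists d : R, (pmap (g (pinv (v + x *: w))) 0 i - pmap (g (pinv v)) 0 i) / x
    @[x --> 0^'+] --> d.
Proof.
move=> gs v4 qg; have sm := smooth_map_cube gs v4 qg.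
have df := smooth_at_coord_differentiable i sm.
have dv : derivable (fun y : vec => (pmap \o g \o pinv) y 0 i) v w.
  exact: diff_derivable.
by eexists; exact: (derive_right dv).
Qed.

Lemma saddle_linearE (tau : R) (w : vec) i : saddle_linear tau w 0 i =
  if i == 0 then (1 + tau) * w 0 0 else (1 - tau) * w 0 i.
Proof. by rewrite mxE. Qed.

Lemma saddle_linear_norm (tau : R) (w : vec) : 0 < tau < 1 -> `|saddle_linear tau w| <= 2 * `|w|.
Proof.
move=> /andP[t0 t1]; apply: row_norm_le => [|i]; first by rewrite mulr_ge0.
have h1 : 0 <= 1 + tau by lra.
have h2 : 0 <= 1 - tau by lra.
rewrite mxE; case: eqP => _; rewrite normrM ?(ger0_norm h1) ?(ger0_norm h2).
  by have := normr_coord_le w 0; have := normr_ge0 (w 0 0); nra.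
by have := normr_coord_le w i; have := normr_ge0 (w 0 i); nra.
Qed.

Variables (tau : R) (f : R -> R) (phi : M -> M) (psi : diffc M).
Hypothesis S : saddle q tau f phi.
Hypothesis psiE : forall x, psi (psi x) = phi x.

Let comm x : psi (phi x) = phi (psi x).
Proof. by rewrite -!psiE. Qed.

Lemma diffeo_root_fix : psi (axis 0) = axis 0 /\ psi (axis 1) = axis 1.
Proof.
have [[psic _] [psi' [[psic' _] K K']]] := diffc_diffeo psi.
by split; [exact: (root_fix0 S psic psic' K K')|exact: (root_fix1 S psic psic' K K')].
Qed.

Lemma diffc_injective : injective psi.
Proof. by have [_ [psi' [_ K _]]] := diffc_diffeo psi; exact: can_inj K. Qed.

Lemma root_near_fixed (r : R) (w : vec) : `|r| <= 4 -> psi (axis r) = axis r ->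
  exists2 e : R, 0 < e & forall x, 0 <= x -> x < e ->
    cdom q (psi (pinv (r *: e0 + x *: w))) /\
    `|pmap (psi (pinv (r *: e0 + x *: w))) - r *: e0| < 3^-1.
Proof.
move=> r4 rfix; have re4 : `|r *: e0| <= 4 by rewrite axis_norm.
have [[psic _] _] := diffc_diffeo psi.
have N : nbhs (axis r) (psi @^-1` [set x | cdom q x /\ `|pmap x - pmap (axis r)| < 3^-1]).
  by apply: psic; rewrite rfix; apply: pmap_nbhs; [exact: pinv_dom|real_arith].
by rewrite pmap_axis// in N; exact: (pinv_line_near w re4 N).
Qed.

(** Write [axis x] as the image under [phi] of [axis (a * x)]. When [x] is replaced by [a * x],
    commutation multiplies the first coordinate of [psi (axis x)] by [a] and the others by
    [(1 - tau)^-1], which exceeds [a]; differentiability at 0 makes the first linear and kills the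
    others. *)
Lemma diffeo_root_near0 :
  exists d e : R, 0 < e /\ forall x, 0 < x -> x < e -> psi (axis x) = axis (d * x).
Proof.
have [fix0 _] := diffeo_root_fix; have /andP[t0 t1] := sd_tau S.
have := @root_near_fixed 0 e0; rewrite normr0 => /(_ (ler0n _ 4) fix0)[e1 e10 e1P].
have q0 : cdom q (psi (pinv 0)).
  by rewrite -axis0E fix0 axis0E; apply: pinv_dom; rewrite normr0.
have [psism _] := diffc_diffeo psi.
have v0 : `|0 : vec| <= 4 by rewrite normr0.
have p0 : pmap (psi (pinv 0)) = 0 by rewrite -axis0E fix0 axis0E pinvK.
have R0 i := smooth_map_right e0 i psism v0 q0.
pose u i x : R := pmap (psi (axis x)) 0 i.
have uE i x : pmap (psi (pinv (0 + x *: e0))) 0 i - pmap (psi (pinv 0)) 0 i = u i x.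
  have z0 : (0 : vec) 0 i = 0 by rewrite mxE.
  by rewrite add0r p0 z0 subr0.
have {}R0 i : exists d : R, u i x / x @[x --> 0^'+] --> d.
  have [d dP] := R0 i; exists d.
  suff <- : (fun x => (pmap (psi (pinv (0 + x *: e0))) 0 i - pmap (psi (pinv 0)) 0 i) / x)
      = (fun x => u i x / x) by [].
  by apply/funext => x; rewrite uE.
pose e := Num.min e1 4^-1.
have e_0 : 0 < e by rewrite lt_min e10; real_arith.
have ee1 x : x < e -> x < e1 by rewrite lt_min => /andP[].
have e3 x : x < e -> x < 4^-1 by rewrite lt_min => /andP[].
pose a := (1 + tau)^-1.
have a0 : 0 < a by rewrite invr_gt0; real_arith.
have a1 : a < 1 by rewrite invf_lt1; real_arith.
have aK : (1 + tau) * a = 1 by rewrite divff// gt_eqF//; real_arith.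
have LE x : 0 < x -> x < e ->
    pmap (psi (axis x)) = saddle_linear tau (pmap (psi (axis (a * x)))).
  move=> x0 xe.
  have ax0 : 0 < a * x by rewrite mulr_gt0.
  have axx : a * x <= x by rewrite ler_piMl// ltW.
  have := e1P _ (ltW ax0) (le_lt_trans axx (ee1 _ xe)).
  rewrite scale0r add0r subr0 -/(axis (a * x)) => -[qx bx].
  have -> : axis x = phi (axis (a * x)).
    rewrite (sd_near0 S); last first.
      by rewrite axis_norm ger0_norm ?ltW//; have := e3 _ xe; real_arith.
    congr pinv; apply/rowP => i; rewrite !mxE !eqxx /=.
    by case: (i == 0); rewrite ?mulr1 ?mulr0// mulrA aK mul1r.
  rewrite comm -{1}(pmapK qx) (sd_near0 S) ?(ltW bx)//.
  rewrite pinvK//; apply: le_trans (saddle_linear_norm _ (sd_tau S)) _.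
  by real_arith.
have [d dP] := R0 0.
have u0 x : 0 < x -> x < e -> u 0 x = d * x.
  apply: (@ratio_linear _ (u 0) a a d e) => // {}x x0 xe.
  by rewrite /u (LE x)// saddle_linearE eqxx mulrA [a * (1 + tau)]mulrC aK mul1r.
have ui i : i != 0 -> forall x, 0 < x -> x < e -> u i x = 0.
  move=> i0 x; have [di diP] := R0 i.
  have k1 : 1 < (1 - tau)^-1 by rewrite invf_gt1; real_arith.
  apply: (@ratio_zero _ (u i) a (1 - tau)^-1 di e) => //; try by real_arith.
  move=> {}x x0 xe; rewrite /u (LE x)// saddle_linearE (negPf i0).
  by rewrite mulKf// gt_eqF//; real_arith.
exists d, e; split=> // x x0 xe.
have := e1P _ (ltW x0) (ee1 _ xe); rewrite scale0r add0r subr0 -/(axis x) => -[qx _].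
rewrite -(pmapK qx); congr pinv; apply/rowP => i.
have -> : ((d * x) *: e0) 0 i = d * x * (i == 0)%:R by rewrite mxE delta00.
case: (eqVneq i 0) => [->|i0]; first by rewrite mulr1; exact: u0.
by rewrite mulr0; exact: ui.
Qed.

Lemma root_comm_iter n x : psi (iter n phi x) = iter n phi (psi x).
Proof. by elim: n => //= n <-; exact: comm. Qed.

Lemma saddle_iter_left n (w : vec) : `|w| < 4 -> w 0 0 <= 0 ->
  exists w' : vec, [/\ `|w'| < 4, w' 0 0 <= 0 & iter n phi (pinv w) = pinv w'].
Proof.
move=> w4 w0; elim: n => [|n [w' [w'4 w'0 E]]]; first by exists w.
by have [w'' [h1 h2 h3]] := sd_left S w'4 w'0; exists w''; split=> //=; rewrite E.
Qed.

Lemma axis_from1E x : pinv (1 *: e0 + x *: - e0) = axis (1 - x).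
Proof. by congr pinv; rewrite scalerN -scalerBl. Qed.

(** The slope [d] is nonzero by injectivity, and a positive one has square [1 + tau]. For a negative
    one the iterates of [axis x] approach e_0 while their images under [psi] remain in the half cube
    [w 0 0 <= 0], against continuity at e_0. *)
Lemma diffeo_root_slope0 : exists2 e : R, 0 < e & forall x, 0 < x -> x < e ->
  psi (axis x) = axis (Num.sqrt (1 + tau) * x).
Proof.
have [fix0 fix1] := diffeo_root_fix; have /andP[t0 t1] := sd_tau S.
have fI := sd_interval S.
have [d [e [e_0 dP]]] := diffeo_root_near0.
have D0 : 0 < `|d| + 1 by rewrite ltr_wpDl.
(* This divisor brings both [x] and its product with the absolute value of [d] within [e / 2] and
   1/3. *)
pose x := Num.min (e / 2) 3^-1 / (`|d| + 1).
have m0 : 0 < Num.min (e / 2) 3^-1 by rewrite lt_min; apply/andP; split; real_arith.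
have m1 : Num.min (e / 2) 3^-1 <= e / 2 by rewrite ge_min lexx.
have m2 : Num.min (e / 2) 3^-1 <= 3^-1 by rewrite ge_min lexx orbT.
have x0 : 0 < x by rewrite divr_gt0.
have dx : `|d| * x + x = Num.min (e / 2) 3^-1.
  by rewrite -[X in _ + X]mul1r -mulrDl mulrC divfK// gt_eqF.
have dx0 : 0 <= `|d| * x by rewrite mulr_ge0// ltW.
have xe : x < e by real_arith.
have x3 : x <= 3^-1 by real_arith.
have ux : unit_pt x by split=> //; real_arith.
have dxn : `|d * x| <= 3^-1 by rewrite normrM (gtr0_norm x0); real_arith.
have [dneg|dpos|d0] := ltgtP d 0; last first.
- exfalso; have := dP _ x0 xe; rewrite d0 mul0r -fix0 => /diffc_injective.
  move/axis_inj; rewrite normr0 (gtr0_norm x0) => h.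
  have h1 : x <= 4 by real_arith.
  by have := h h1 (ler0n _ 4); move: x0 => /lt0r_neq0/eqP.
- pose y := x / (`|d| + 1).
  have y0 : 0 < y by rewrite divr_gt0.
  have dy : d * y + y = x.
    by rewrite -[X in _ + X]mul1r -mulrDl -{1}(gtr0_norm dpos) mulrC divfK// gt_eqF.
  have dy0 : 0 < d * y by rewrite mulr_gt0.
  have ddy0 : 0 < d * (d * y) by rewrite mulr_gt0.
  have ddy : d * (d * y) <= 3^-1.
    apply: le_trans (le_trans (ler_norm _) dxn); rewrite ler_pM2l//; real_arith.
  have ye : y < e by real_arith.
  have dye : d * y < e by real_arith.
  have y3 : y <= 3^-1 by real_arith.
  have uy : unit_pt y by split=> //; real_arith.
  have := psiE (axis y); rewrite dP// dP// (sd_axis S)// (saddle_f_near0 S)//.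
  move/axis_inj => E.
  have E2 : d * d = 1 + tau.
    apply: (mulIf (lt0r_neq0 y0)); rewrite -mulrA; apply: E.
      by rewrite ger0_norm ?ltW//; real_arith.
    rewrite ger0_norm; last by rewrite mulr_ge0 ?ltW//; real_arith.
    by real_nonlin.
  have -> : Num.sqrt (1 + tau) = d by rewrite -E2 -expr2 sqrtr_sqr gtr0_norm.
  by exists e.
exfalso.
have := @root_near_fixed 1 (- e0); rewrite normr1 => /(_ _ fix1)[|e3 e30 e3P].
  by real_arith.
have [k kP] := im_reach_up fI ux e30.
have [k0 k1] := im_iter_unit fI k ux.
have w4 : `|(d * x) *: e0| < 4 by rewrite axis_norm; real_arith.
have w0 : ((d * x) *: e0) 0 0 <= 0.
  by rewrite mxE delta00 eqxx mulr1 nmulr_rle0// ltW.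
have [w' [w'4 w'0 E]] := saddle_iter_left k w4 w0.
have [] := e3P (1 - iter k f x).
- by real_arith.
- by real_arith.
rewrite axis_from1E opprB addrC subrK -(saddle_iter_axis S)// root_comm_iter dP// E.
rewrite pinvK ?(ltW w'4)// => _ h.
have := le_lt_trans (normr_coord_le _ 0) h.
have -> : (w' - 1 *: e0) 0 0 = w' 0 0 - 1 by rewrite !mxE eqxx !mulr1.
by rewrite ltr_norml => /andP[h1 h2]; real_arith.
Qed.

(** Every linear map commutes with a homothety, so at e_0 only the first coordinate is followed: its
    distance to 1 scales by [1 - tau], hence is linear in [x] by differentiability. *)
Lemma diffeo_good_root : good_root q tau phi psi.
Proof.
split=> //; first exact: diffeo_root_slope0.
have [fix0 fix1] := diffeo_root_fix; have /andP[t0 t1] := sd_tau S.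
have := @root_near_fixed 1 (- e0); rewrite normr1 => /(_ _ fix1)[|e1 e10 e1P].
  by real_arith.
have q1 : cdom q (psi (pinv e0)).
  by rewrite -axis1E fix1 axis1E; apply: pinv_dom; exact: e0_le4.
have [psism _] := diffc_diffeo psi.
have p1 : pmap (psi (pinv e0)) = e0.
  by rewrite -axis1E fix1 axis1E pinvK//; exact: e0_le4.
pose u x : R := 1 - pmap (psi (axis (1 - x))) 0 0.
have [d dP] := smooth_map_right (- e0) 0 psism e0_le4 q1.
have {}dP : u x / x @[x --> 0^'+] --> - d.
  suff -> : (fun x => u x / x) = (fun x => - ((pmap (psi (pinv (e0 + x *: - e0))) 0 0
      - pmap (psi (pinv e0)) 0 0) / x)) by exact: cvgN.
  apply/funext => x; rewrite /u p1 delta00 eqxx -axis_from1E scale1r -mulNr.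
  by congr (_ / _); rewrite opprB.
pose e := Num.min e1 3^-1.
have e_0 : 0 < e by rewrite lt_min e10; real_arith.
have ee1 x : x < e -> x < e1 by rewrite lt_min => /andP[].
have e3 x : x < e -> x < 3^-1 by rewrite lt_min => /andP[].
exists (- d), e; split=> // x x0 xe.
suff : u x = - d * x by rewrite /u => h; real_arith.
apply: (@ratio_linear _ u (1 - tau) (1 - tau) (- d) e) => //; try by real_arith.
move=> {x x0 xe} x x0 xe.
have [] := e1P _ (ltW x0) (ee1 _ xe); rewrite axis_from1E scale1r => qx bx.
have -> : u ((1 - tau) * x) = 1 - pmap (psi (phi (axis (1 - x)))) 0 0.
  rewrite /u; congr (1 - pmap (psi _) 0 0).
  have -> : axis (1 - x) = pinv (e0 + (- x) *: e0).
    by congr pinv; rewrite scalerBl scale1r scaleNr.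
  rewrite (sd_near1 S); last first.
    by rewrite axis_norm normrN gtr0_norm//; have := e3 _ xe; real_arith.
  by congr pinv; rewrite [LHS]scalerBl scale1r scalerA mulrN scaleNr.
rewrite comm; set w := pmap (psi (axis (1 - x))) - e0 in bx.
have wE : psi (axis (1 - x)) = pinv (e0 + w) by rewrite /w [e0 + _]addrC subrK pmapK.
have w0E : pmap (psi (axis (1 - x))) 0 0 = 1 + w 0 0.
  have sub0 (v : vec) : (v - e0) 0 0 = v 0 0 - 1 by rewrite !mxE !eqxx.
  by rewrite /w sub0; move: (pmap _ 0 0) => y; ring.
rewrite wE (sd_near1 S) ?(ltW bx)// pinvK; last first.
  apply: le_trans (ler_normD _ _) _; rewrite normrZ ger0_norm; last by real_arith.
  have := @norm_delta0 R m; have := normr_ge0 w; move: bx; move: `|w| `|e0| => y z.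
  by move=> h1 h2 h3; real_nonlin.
rewrite /u w0E.
have -> : (e0 + (1 - tau) *: w) 0 0 = 1 + (1 - tau) * w 0 0.
  by rewrite mxE delta00 eqxx [X in _ + X]mxE mulr1n.
by move: (w 0 0) => y; ring.
Qed.

End DiffeoGoodRoot.

(** * Autonomous square roots *)

Section LocalUniqueness.
Context {R : realType}.

(** Connectedness of [0, T]: the set where [P] holds is open and closed in it. *)
Lemma segment_locally_constant (T : R) (P : R -> Prop) :
  P 0 ->
  (forall t, 0 <= t -> t <= T -> P t ->
    \forall s \near t, 0 <= s -> s <= T -> P s) ->
  (forall t, 0 <= t -> t <= T -> ~ P t ->
    \forall s \near t, 0 <= s -> s <= T -> ~ P s) ->
  forall t, 0 <= t -> t <= T -> P t.
Proof.
move=> P0 Po Pc t t0 tT.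
pose I : set R := `[0, T]%classic.
have cI : connected I by exact: segment_connected.
pose B : set R := [set s | I s /\ P s].
suff BE : B = I by have [] : B t by rewrite BE /I /= in_itv/= t0.
have IE s : I s -> 0 <= s /\ s <= T by rewrite /I /= in_itv/= => /andP[].
apply: cI.
- by exists 0; split => //; rewrite /I /= in_itv/= lexx (le_trans t0).
- exists (interior [set s | 0 <= s -> s <= T -> P s]); first exact: open_interior.
  apply/seteqP; split => s.
    by move=> [Is Ps]; split => //; have [s0 sT] := IE _ Is; exact: Po.
  by move=> [Is /interior_subset H]; split => //; have [s0 sT] := IE _ Is; exact: H.
- exists (~` interior [set s | 0 <= s -> s <= T -> ~ P s]).
    by apply: open_closedC; exact: open_interior.
  apply/seteqP; split => s.
    move=> [Is Ps]; split => // /interior_subset H; have [s0 sT] := IE _ Is.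
    exact: H Ps.
  move=> [Is H]; split => //; have [s0 sT] := IE _ Is.
  by apply: contrapT => nP; apply: H; exact: Pc.
Qed.

Lemma smooth_at_lipschitz m n (f : 'rV[R]_m -> 'rV[R]_n) x :
  smooth_at f x -> exists C r : R, [/\ 0 <= C, 0 < r &
    forall y z, `|y - x| < r -> `|z - x| < r -> `|f y - f z| <= C * `|y - z|].
Proof.
move=> [V [oV Vx /(smooth_on_coordP _ oV) sf]].
pose D (i : 'I_m) (j : 'I_n) : 'rV[R]_m -> R := 'D_(delta_mx 0 i) (fun y => f y 0 j).
pose c (i : 'I_m) (j : 'I_n) : R := `|D i j x| + 1.
pose K : R := \sum_i \sum_j c i j.
have c0 i j : 0 <= c i j by rewrite addr_ge0.
have cK i j : c i j <= K.
  rewrite /K (bigD1 i)//= (bigD1 j)//= -addrA lerDl addr_ge0//; apply: sumr_ge0 => // k _.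
  exact: sumr_ge0.
have K0 : 0 <= K by apply: sumr_ge0 => i _; exact: sumr_ge0.
have : \forall y \near x, forall i j, derivable (fun y => f y 0 j) y (delta_mx 0 i) /\
    `|D i j y| <= c i j.
  apply: near_forall_ord => i; apply: near_forall_ord => j.
  have [_ /(_ i)[d [k _]]] := sf 1%N j.
  have h1 : \forall y \near x, derivable (fun y => f y 0 j) y (delta_mx 0 i).
    by apply: filterS (open_nbhs_nbhs (conj oV Vx)).
  have := k _ Vx => /cvgrPdist_lt/(_ _ ltr01).
  apply: filterS2 h1 => y dy h; split => //.
  rewrite /c -[D i j y](subrK (D i j x)) addrC; apply: le_trans (ler_normD _ _) _.
  by rewrite lerD2l distrC; exact: ltW.
move=> /nbhs_ballP[r /= r0 rP].
exists (K *+ m), r; split => //; first exact: mulrn_wge0.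
move=> y z yr zr; apply: row_norm_le => [|j]; first by rewrite mulr_ge0// mulrn_wge0.
rewrite !mxE.
have := @mean_value_cube R m (fun y => f y 0 j) x r K (fun=> 0) y z.
rewrite big1 ?subr0; last by move=> i _; rewrite mul0r.
apply=> // u ur i.
have [|d h] := rP u _ i j; first by rewrite -ball_normE /= distrC.
by split => //; rewrite subr0; apply: le_trans h (cK i j).
Qed.

(** On an interval of half-length [h] with [C * h <= 2^-1], the mean value theorem bounds the
    maximal distance between the two solutions by half of itself. *)
Lemma ode_local_unique n (v : 'rV[R]_n -> 'rV[R]_n) (y1 y2 : R -> 'rV[R]_n) t0 :
  smooth_at v (y1 t0) -> y1 t0 = y2 t0 ->
  (\forall t \near t0, is_derive (t : R) (1 : R) y1 (v (y1 t))) ->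
  (\forall t \near t0, is_derive (t : R) (1 : R) y2 (v (y2 t))) ->
  \forall t \near t0, y1 t = y2 t.
Proof.
move=> sv y12 d1 d2.
have [C [r [C0 r0 Cr]]] := smooth_at_lipschitz sv.
have cont (y : R -> 'rV[R]_n) : (\forall t \near t0, is_derive (t : R) (1 : R) y (v (y t))) ->
    y t0 = y1 t0 -> \forall t \near t0, `|y t - y1 t0| < r.
  move=> d E; have [dy _] := nbhs_singleton d.
  have c : {for t0, continuous y}.
    by apply: differentiable_continuous; apply/derivable1_diffP.
  by move/cvgrPdist_lt : c => /(_ _ r0); rewrite E; under eq_near do rewrite distrC.
have N1 := cont y1 d1 erefl; have N2 := cont y2 d2 (esym y12).
have N : \forall t \near t0, [/\ is_derive (t : R) (1 : R) y1 (v (y1 t)),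
   is_derive (t : R) (1 : R) y2 (v (y2 t)), `|y1 t - y1 t0| < r & `|y2 t - y1 t0| < r].
  near=> t; split; near: t => //.
move: N => /nbhs_ballP[e /= e0 eP].
pose h := Num.min (e / 2) (2 * (C + 1))^-1.
have C10 : 0 < 2 * (C + 1) by rewrite mulr_gt0// ltr_wpDl.
have h0 : 0 < h by rewrite lt_min divr_gt0//= invr_gt0.
have he : h < e by apply: (@le_lt_trans _ _ (e / 2)); [rewrite ge_min lexx|lra].
have hC : C * h <= 2^-1.
  have : h <= (2 * (C + 1))^-1 by rewrite ge_min lexx orbT.
  move=> /(ler_wpM2l C0) /le_trans; apply.
  rewrite ler_pdivrMr//; lra.
have P t : `|t - t0| <= h -> [/\ is_derive (t : R) (1 : R) y1 (v (y1 t)),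
   is_derive (t : R) (1 : R) y2 (v (y2 t)), `|y1 t - y1 t0| < r & `|y2 t - y1 t0| < r].
  by move=> th; apply: eP; rewrite -ball_normE /= distrC; apply: le_lt_trans he.
pose I : set R := `[t0 - h, t0 + h]%classic.
have IE t : I t -> `|t - t0| <= h.
  by rewrite /I /= in_itv/= ler_norml => /andP[a1 a2]; apply/andP; split; lra.
have [||t1 /[!inE] It1 t1P] := @EVT_max R (fun t => `|y1 t - y2 t|) (t0 - h) (t0 + h).
- by lra.
- apply: continuous_in_subspaceT => t /[1!inE] It; have [dy1 dy2 _ _] := P _ (IE _ It).
  have c1 : {for t, continuous y1}.
    by apply: differentiable_continuous; apply/derivable1_diffP; case: dy1.
  have c2 : {for t, continuous y2}.
    by apply: differentiable_continuous; apply/derivable1_diffP; case: dy2.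
  by apply: cvg_norm; apply: cvgB.
set mx := `|y1 t1 - y2 t1| in t1P.
have It1' := IE _ It1.
have mx2 : mx <= 2^-1 * mx.
  apply: row_norm_le => [|j]; first by rewrite mulr_ge0 ?normr_ge0.
  pose g (t : R) : R := y1 t 0 j - y2 t 0 j.
  have gd t : `|t - t0| <= h -> derivable g t 1 /\ `|'D_1 g t - 0| <= C * mx.
    move=> th; have [[e1 E1] [e2 E2] b1 b2] := P t th.
    have /derivable_mxP/(_ 0 j) k1 := e1; have /derivable_mxP/(_ 0 j) k2 := e2.
    split; first exact: derivableB.
    have -> : 'D_1 g t = (v (y1 t) - v (y2 t)) 0 j.
      rewrite deriveB// -E1 -E2 (derive_mx e1) (derive_mx e2).
      by rewrite !mxE.
    rewrite subr0; apply: le_trans (normr_coord_le _ _) _.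
    apply: le_trans (Cr _ _ b1 b2) _; rewrite ler_wpM2l//.
    apply: t1P; rewrite in_itv/=; move: th; rewrite ler_norml => /andP[a1 a2].
    by apply/andP; split; lra.
  have := @mean_value_line R R g t0 1 0 (t1 - t0) (C * mx).
  have E s : (s * (t1 - t0)) *: (1 : R) + t0 = s * (t1 - t0) + t0.
    by rewrite /GRing.scale/= mulr1.
  have -> : (t1 - t0) *: (1 : R) + t0 = t1 by rewrite /GRing.scale/= mulr1 subrK.
  have g0 : g t0 = 0 by rewrite /g y12 subrr.
  rewrite g0 mul0r !subr0 => H.
  rewrite [(y1 t1 - y2 t1) 0 j]mxE [X in `|_ + X|]mxE.
  apply: le_trans (H _) _.
    move=> s /andP[s0 s1]; rewrite E; apply: gd; rewrite addrK normrM (ger0_norm s0).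
    by apply: le_trans It1'; rewrite ler_piMl.
  have : C * mx * `|t1 - t0| <= C * mx * h by rewrite ler_wpM2l// mulr_ge0// normr_ge0.
  have mx0 : 0 <= mx by exact: normr_ge0.
  by move: It1' => _; nra.
have mx0 : mx = 0 by have : 0 <= mx by [exact: normr_ge0]; lra.
apply/nbhs_ballP; exists h => //= t; rewrite -ball_normE /= distrC => th.
apply/eqP; rewrite -subr_eq0 -normr_le0 -mx0; apply: t1P.
move: th; rewrite ltr_norml => /andP[a1 a2]; rewrite in_itv/=.
by apply/andP; split; lra.
Unshelve. all: by end_near. Qed.

End LocalUniqueness.

(** * Integral curves and flows on the manifold *)

Section Curves.
Context {R : realType} {n : nat} {M : smoothManifold R n}.
Variable X : vfield M.
Implicit Types (g : R -> M) (c : chart R n M).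

(** The explicit curves in the cube are known to solve the equation for a bounded time only, so
    [integral_curve] cannot be asked of them. *)
Definition integral_at c g (t0 : R) : Prop :=
  [/\ {for t0, continuous g}, cdom c (g t0) &
   \forall t \near t0, is_derive (t : R) (1 : R) (cmap c \o g) (X c (g t))].

Lemma integral_curve_at c g t : atlas M c -> integral_curve X g -> cdom c (g t) ->
  integral_at c g t.
Proof.
move=> Ac [gc gd] cg; split => //; first exact: gc.
have N : \forall s \near t, cdom c (g s).
  by apply: gc; apply: open_nbhs_nbhs; split => //; exact: cdom_open.
by apply: filterS N => s cs; exact: gd.
Qed.

Lemma vfield_smooth_at c x : atlas M c -> cdom c x ->
  smooth_at (X c \o cinv c) (cmap c x).
Proof.
move=> Ac cx; apply: (smooth_on_at (U := cmap c @` cdom c)).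
- exact: cimg_open.
- exact: vcomp_smooth.
- by exists x.
Qed.

Lemma integral_unique_local c g1 g2 t0 : atlas M c ->
  integral_at c g1 t0 -> integral_at c g2 t0 -> g1 t0 = g2 t0 ->
  \forall t \near t0, g1 t = g2 t.
Proof.
move=> Ac [g1c cg1 d1] [g2c cg2 d2] E.
have near_dom g : {for t0, continuous g} -> cdom c (g t0) -> \forall t \near t0, cdom c (g t).
  by move=> gc cg; apply: gc; apply: open_nbhs_nbhs; split => //; exact: cdom_open.
have N1 := near_dom _ g1c cg1; have N2 := near_dom _ g2c cg2.
have : \forall t \near t0, (cmap c \o g1) t = (cmap c \o g2) t.
  apply: (@ode_local_unique _ _ (X c \o cinv c)).
  - exact: vfield_smooth_at.
  - by rewrite /= E.
  - by apply: filterS2 N1 d1 => t ct; rewrite /= cmapK.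
  - by apply: filterS2 N2 d2 => t ct; rewrite /= cmapK.
by apply: filterS3 N1 N2 => t c1 c2 h; rewrite -(cmapK c1) -(cmapK c2); congr cinv.
Qed.

Lemma neq_near (g1 g2 : R -> M) t0 : {for t0, continuous g1} -> {for t0, continuous g2} ->
  g1 t0 <> g2 t0 -> \forall t \near t0, g1 t <> g2 t.
Proof.
move=> c1 c2 /eqP ne; have := @manifold_hausdorff _ _ M.
rewrite open_hausdorff => /(_ _ _ ne)[[A B] /= [/set_mem Ag /set_mem Bg] [oA oB AB]].
have N1 : \forall t \near t0, A (g1 t) by apply: c1; exact: open_nbhs_nbhs.
have N2 : \forall t \near t0, B (g2 t) by apply: c2; exact: open_nbhs_nbhs.
apply: filterS2 N1 N2 => t At Bt E; rewrite E in At.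
by have : (A `&` B) (g2 t) by []; rewrite (eqP AB).
Qed.

(** The set of times of agreement is open by local uniqueness in a chart and closed because M is
    Hausdorff. *)
Lemma integral_unique (g1 g2 : R -> M) T :
  (forall t, 0 <= t -> t <= T -> {for t, continuous g1}) ->
  (forall t, 0 <= t -> t <= T -> {for t, continuous g2}) ->
  (forall t, 0 <= t -> t <= T -> g1 t = g2 t ->
     exists2 c, atlas M c & integral_at c g1 t /\ integral_at c g2 t) ->
  g1 0 = g2 0 -> forall t, 0 <= t -> t <= T -> g1 t = g2 t.
Proof.
move=> c1 c2 H E0; apply: segment_locally_constant => // t t0 tT.
  move=> E; have [c Ac [i1 i2]] := H t t0 tT E.
  by apply: filterS (integral_unique_local Ac i1 i2 E).
move=> ne; apply: filterS (neq_near (c1 t t0 tT) (c2 t t0 tT) ne) => s h _ _.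
exact: h.
Qed.

Lemma integral_curve_unique g1 g2 : integral_curve X g1 -> integral_curve X g2 ->
  g1 0 = g2 0 -> forall t, 0 <= t -> g1 t = g2 t.
Proof.
move=> i1 i2 E0 t t0.
apply: (@integral_unique g1 g2 t) => //.
- by move=> s _ _; case: i1 => h _; exact: h.
- by move=> s _ _; case: i2 => h _; exact: h.
move=> s s0 st E; have [c Ac cg] := @atlas_cover _ _ M (g1 s).
by exists c => //; split; apply: integral_curve_at => //; rewrite -E.
Qed.

Lemma integral_curve_shift g a : integral_curve X g -> integral_curve X (fun t => g (t + a)).
Proof.
move=> [gc gd]; split.
  move=> t; apply: (@continuous_comp _ _ _ (fun t => t + a) g); last exact: gc.
  by apply: cvgD; [exact: cvg_id|exact: cvg_cst].
move=> c t Ac ct; have := gd c (t + a) Ac ct.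
move=> [d1 d2].
have E : (fun h : R => h^-1 *: (((cmap c \o (fun t => g (t + a))) \o shift t) (h *: 1)
    - (cmap c \o (fun t => g (t + a))) t))
    = (fun h : R => h^-1 *: (((cmap c \o g) \o shift (t + a)) (h *: 1) - (cmap c \o g) (t + a))).
  by apply/funext => h /=; rewrite addrA.
by split; [rewrite /derivable E|rewrite /derive E].
Qed.

Section Flow.
Variable Phi : R -> M -> M.
Hypothesis PhiX : is_flow X Phi.

Lemma flow_add s t x : 0 <= s -> Phi (s + t) x = Phi s (Phi t x).
Proof.
move=> s0.
have [_ i1] := PhiX x; have [E2 i2] := PhiX (Phi t x).
apply: (integral_curve_unique (integral_curve_shift t i1) i2) => //.
by rewrite add0r E2.
Qed.

Lemma flow_comm t x : 0 <= t -> Phi t (Phi 1 x) = Phi 1 (Phi t x).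
Proof. by move=> t0; rewrite -!flow_add// addrC. Qed.

Lemma flow_half x : Phi 2^-1 (Phi 2^-1 x) = Phi 1 x.
Proof. by rewrite -flow_add ?invr_ge0//; congr (Phi _ x); lra. Qed.

End Flow.

End Curves.

Lemma is_derive_scalel (R : realType) (V : normedModType R) (c : R -> R) (dc t : R) (v z : V) :
  is_derive t 1 c dc -> is_derive t (1 : R) (fun s => c s *: v + z) (dc *: v).
Proof.
move=> [/cvg_ex[l lP] dE].
have lE : l = dc by rewrite -dE /derive; apply/esym/cvg_lim.
have E : (fun h : R => h^-1 *: (((fun s => c s *: v + z) \o shift t) (h *: 1) - (c t *: v + z)))
    = (fun h : R => (h^-1 *: ((c \o shift t) (h *: 1) - c t)) *: v).
  by apply/funext => h /=; rewrite opprD addrACA subrr addr0 -scalerBl scalerA.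
have C : (h^-1 *: ((c \o shift t) (h *: 1) - c t)) *: v @[h --> (0:R)^'] --> dc *: v.
  by rewrite -lE; exact: cvgZr_tmp lP.
split; first by rewrite /derivable E; apply/cvg_ex; eexists; exact: C.
by rewrite /derive E; exact/cvg_lim.
Qed.

(** * The vector field in the coordinates of the cube *)

Section Autonomous.
Context {R : realType} {m : nat} {M : smoothManifold R m.+1} (q : cube M).
Local Notation vec := 'rV[R]_m.+1.
Local Notation e0 := (delta_mx 0 0 : vec).
Local Notation axis := (axis q).
Local Notation pmap := (pmap q).
Local Notation pinv := (pinv q).
Variables (X : vfield M) (Phi : R -> M -> M).
Hypothesis PhiX : is_flow X Phi.

Let Phi0 x : Phi 0 x = x. Proof. by case: (PhiX x). Qed.

Let Phic x : continuous (Phi ^~ x). Proof. by case: (PhiX x) => _ []. Qed.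

Definition velocity (w : vec) : vec := (cube_scale q)^-1 *: X q (pinv w).

Lemma velocityE w : X q (pinv w) = cube_scale q *: velocity w.
Proof. by rewrite /velocity scalerA mulfV ?scale1r// gt_eqF// cube_scale_gt0. Qed.

Lemma velocity_right x i : cdom q x ->
  (pmap (Phi t x) 0 i - pmap x 0 i) / t @[t --> 0^'+] -->
  ((cube_scale q)^-1 *: X q x) 0 i.
Proof.
move=> qx; have [_ [_ gd]] := PhiX x.
have := gd q 0 (cube_atlas q); rewrite Phi0 => /(_ qx)[d dE].
have dP : is_derive (0:R) (1:R) (fun t => (cube_scale q)^-1 *: ((cmap q \o Phi ^~ x) t)
      + - ((cube_scale q)^-1 *: cube_center q)) ((cube_scale q)^-1 *: X q x).
  have h1 : is_derive (0:R) (1:R) (cmap q \o Phi ^~ x) (X q x) by split.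
  have h2 := is_deriveZ (cube_scale q)^-1 h1.
  have h3 := is_deriveD h2 (is_derive_cst (- ((cube_scale q)^-1 *: cube_center q)) (0:R) (1:R)).
  by apply: is_derive_eq h3 _; rewrite addr0.
have E : (fun t => (cube_scale q)^-1 *: ((cmap q \o Phi ^~ x) t)
      + - ((cube_scale q)^-1 *: cube_center q)) = (fun t => pmap (Phi t x)).
  by apply/funext => t; rewrite -scalerBr.
rewrite E in dP; case: dP => d1 d1E.
have /derivable_mxP/(_ 0 i) d2 := d1.
have D : 'D_1 (fun t => pmap (Phi t x) 0 i) 0 = ((cube_scale q)^-1 *: X q x) 0 i.
  by rewrite -d1E (derive_mx d1) [RHS]mxE.
have := derive_right d2; rewrite D.
suff -> : (fun x0 : R => (pmap (Phi (0 + x0 *: 1) x) 0 i - pmap (Phi 0 x) 0 i) / x0) =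
   (fun t => (pmap (Phi t x) 0 i - pmap x 0 i) / t) by [].
by apply/funext => t; rewrite Phi0 add0r /GRing.scale/= mulr1.
Qed.

Lemma velocity_rightE x i (l : R) : cdom q x ->
  (\forall t \near 0^'+, (pmap (Phi t x) 0 i - pmap x 0 i) / t = l) ->
  ((cube_scale q)^-1 *: X q x) 0 i = l.
Proof.
move=> qx N; have c := @velocity_right _ i qx.
by apply: (cvg_unique (@norm_hausdorff _ _) c); exact: cvg_near_cst.
Qed.

Lemma near_flow (A : set M) x : nbhs x A -> \forall t \near 0, A (Phi t x).
Proof. by move=> NA; apply: Phic; rewrite Phi0. Qed.

(** Differentiate at time 0 the commutation of the flow with [phi], which reads as the diagonal
    affine map [T]: such symmetries of the flow are symmetries of X. *)
Lemma velocity_equivariant (k b : 'I_m.+1 -> R) (w : vec) (T : vec -> vec) (phi : M -> M) :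
  (forall v i, T v 0 i = b i + k i * v 0 i) ->
  (forall t x, 0 <= t -> Phi t (phi x) = phi (Phi t x)) ->
  `|w| < 4 ->
  (\forall v \near w, `|T v| <= 4 /\ phi (pinv v) = pinv (T v)) ->
  forall i, velocity (T w) 0 i = k i * velocity w 0 i.
Proof.
move=> TE comm w4 N i.
have qw : cdom q (pinv w) by apply: pinv_dom; exact: ltW.
have [Tw4 phiw] := nbhs_singleton N.
have qTw : cdom q (pinv (T w)) by exact: pinv_dom.
have N2 : \forall t \near 0^'+, (pmap (Phi t (pinv (T w))) 0 i - pmap (pinv (T w)) 0 i) / t =
    k i * ((pmap (Phi t (pinv w)) 0 i - pmap (pinv w) 0 i) / t).
  have N3 : \forall x \near pinv w, cdom q x /\
     (`|T (pmap x)| <= 4 /\ phi (pinv (pmap x)) = pinv (T (pmap x))).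
    apply: filterI; first by apply: open_nbhs_nbhs; split => //; exact: cdom_open.
    have c := pmap_continuous qw.
    apply: (c [set v | `|T v| <= 4 /\ phi (pinv v) = pinv (T v)]).
    by rewrite pinvK ?ltW.
  have := near_flow N3; rewrite /at_right /within /=.
  apply: filterS => t [qt [T4 phit]] t0.
  rewrite -phiw comm ?ltW// -{1}(pmapK qt) phit phiw !pinvK// ?(ltW w4)//.
  by rewrite !TE; ring.
have c1 := @velocity_right _ i qTw; have c2 := @velocity_right _ i qw.
have c3 : k i * ((pmap (Phi t (pinv w)) 0 i - pmap (pinv w) 0 i) / t) @[t --> 0^'+] -->
   k i * velocity w 0 i by apply: cvgM; [exact: cvg_cst|exact: c2].
have N4 : {near 0^'+, (fun t => k i * ((pmap (Phi t (pinv w)) 0 i - pmap (pinv w) 0 i) / t)) =1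
    (fun t => (pmap (Phi t (pinv (T w))) 0 i - pmap (pinv (T w)) 0 i) / t)}.
  by apply: filterS N2 => t ->.
have c4 := cvg_trans (near_eq_cvg N4) c3.
exact: (cvg_unique (@norm_hausdorff _ _) c1 (c4 _)).
Qed.

Lemma velocity_smooth w : `|w| <= 4 -> smooth_at velocity w.
Proof.
move=> w4.
pose sc (z : vec) : vec := (cube_scale q)^-1 *: (z + 0) + 0.
have E : velocity = sc \o ((X q \o cinv q) \o (fun w => cube_scale q *: w + cube_center q)).
  by apply/funext => v; rewrite /sc /= !addr0.
rewrite E; apply: smooth_at_comp; last exact: smooth_at_affine.
apply: smooth_at_comp; first exact: affine_center_smooth.
rewrite -cmap_pinv//; apply: vfield_smooth_at; first exact: cube_atlas.
exact: pinv_dom.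
Qed.

Lemma velocity_derive (v w : vec) i : `|v| <= 4 -> velocity v = 0 ->
  exists d : R, velocity (v + x *: w) 0 i / x @[x --> 0^'+] --> d.
Proof.
move=> v4 v0; have sm := velocity_smooth v4.
have df := smooth_at_coord_differentiable i sm.
have dv : derivable (fun y : vec => velocity y 0 i) v w by exact: diff_derivable.
eexists; have := derive_right dv.
suff -> : (fun x => (velocity (v + x *: w) 0 i - velocity v 0 i) / x) =
  (fun x => velocity (v + x *: w) 0 i / x) by exact.
have z0 : (0 : vec) 0 i = 0 by rewrite mxE.
by apply/funext => x; rewrite v0 z0 subr0.
Qed.

(** On a ray where the field is linear with rate [k] the solution is exponential, and uniqueness
    identifies it with the flow. The pairs ([v0], [s]) in use are (0, 1) at 0 and (1, -1) at e_0;
    the exponential of the absolute value of [k] keeps the curve in the linear range up to time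
    1. *)
Lemma explicit_curve (v0 s k de : R) :
  (forall x, 0 < x -> x < de -> `|v0 + s * x| <= 4 /\
     velocity ((v0 + s * x) *: e0) = (s * k * x) *: e0) ->
  forall x, 0 < x -> expR `|k| * x < de -> forall t, 0 <= t -> t <= 1 ->
    Phi t (axis (v0 + s * x)) = axis (v0 + s * (expR (k * t) * x)).
Proof.
move=> H x x0 xd.
pose c (t : R) : R := v0 + s * (expR (k * t) * x).
have c_cont : continuous c.
  move=> t; apply: cvgD; first exact: cvg_cst.
  apply: cvgM; first exact: cvg_cst.
  apply: cvgMl; apply: (@continuous_comp _ _ _ (fun t => k * t) (@expR R)).
    by apply: cvgM; [exact: cvg_cst|exact: cvg_id].
  exact: continuous_expR.
have c_der t : is_derive t (1:R) c (s * k * (expR (k * t) * x)).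
  have h1 : is_derive t (1:R) (fun t : R => k * t) k.
    have := is_deriveZ k (is_derive_id t (1:R)).
    by rewrite /GRing.scale/= mulr1.
  have h2 : is_derive t (1:R) (expR \o (fun t : R => k * t)) (expR (k * t) * k).
    exact: is_derive1_comp.
  have h3 := is_deriveZ (s * x) h2.
  have h4 := is_deriveD (is_derive_cst v0 t (1:R)) h3.
  have -> : c = (cst v0 + (s * x) *: (expR \o (fun t : R => k * t))).
    by apply/funext => r; rewrite /c !fctE /GRing.scale/=; ring.
  by apply: is_derive_eq h4 _; rewrite /GRing.scale/=; ring.
have xP (t : R) : 0 <= t -> t <= 1 -> 0 < expR (k * t) * x /\ expR (k * t) * x < de.
  move=> t0 t1; split; first by rewrite mulr_gt0 ?expR_gt0.
  apply: le_lt_trans xd; rewrite ler_wpM2r ?(ltW x0)// ler_expR.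
  apply: le_trans (ler_norm _) _; rewrite normrM (ger0_norm t0).
  by rewrite ler_piMr.
have nP (t : R) : 0 <= t -> t <= 1 ->
    \forall r \near t, 0 < expR (k * r) * x /\ expR (k * r) * x < de.
  move=> t0 t1; have [_ h2] := xP t t0 t1.
  have cc : {for t, continuous (fun r => expR (k * r) * x)}.
    apply: cvgMl; apply: (@continuous_comp _ _ _ (fun t => k * t) (@expR R)).
      by apply: cvgM; [exact: cvg_cst|exact: cvg_id].
    exact: continuous_expR.
  have N : \forall r \near t, expR (k * r) * x < de := cc _ (lt_nbhsl h2).
  by apply: filterS N => r hr; split => //; rewrite mulr_gt0 ?expR_gt0.
pose g2 t := axis (c t).
have g2c (t : R) : 0 <= t -> t <= 1 -> {for t, continuous g2}.
  move=> t0 t1; have [h1 h2] := xP t t0 t1; have [h3 _] := H _ h1 h2.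
  apply: (@continuous_comp _ _ _ c axis); first exact: c_cont.
  apply: (@continuous_comp _ _ _ (fun x : R => x *: e0) pinv).
    by apply: cvgZr_tmp; exact: cvg_id.
  by apply: pinv_continuous; rewrite axis_norm.
move=> t t0 t1.
apply: (@integral_unique _ _ _ X (Phi ^~ (axis (v0 + s * x))) g2 1) => //.
- by move=> r _ _; exact: Phic.
- move=> r r0 r1 E; exists q; first exact: cube_atlas.
  have [h1 h2] := xP r r0 r1; have [h3 _] := H _ h1 h2.
  have qg : cdom q (g2 r) by apply: pinv_dom; rewrite axis_norm.
  split.
    apply: integral_curve_at; [exact: cube_atlas|by case: (PhiX (axis (v0 + s * x)))|].
    by rewrite E.
  split => //; first exact: g2c.
  have N : \forall u \near r, cmap q (g2 u) =
      c u *: (cube_scale q *: e0) + cube_center q.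
    apply: filterS (nP r r0 r1) => u [u1 u2]; have [u3 _] := H _ u1 u2.
    by rewrite /g2 axisE cmap_pinv ?axis_norm// !scalerA mulrC.
  have N2 := nbhs_interior N; have N3 := nP r r0 r1.
  apply: filterS2 N2 N3 => u Nu [u1 u2]; have [u3 u4] := H _ u1 u2.
  have -> : X q (g2 u) = (s * k * (expR (k * u) * x)) *: (cube_scale q *: e0).
    by rewrite /g2 axisE velocityE u4 !scalerA mulrC.
  apply: near_eq_is_derive (is_derive_scalel (cube_scale q *: e0) (cube_center q) (c_der u)).
  by apply: filterS Nu => ? Hu; exact: esym.
- by rewrite Phi0 /g2 /c mulr0 expR0 mul1r.
Qed.

End Autonomous.

Section AutonomousRoot.
Context {R : realType} {m : nat} {M : smoothManifold R m.+1} (q : cube M).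
Local Notation vec := 'rV[R]_m.+1.
Local Notation e0 := (delta_mx 0 0 : vec).
Local Notation axis := (axis q).
Local Notation pmap := (pmap q).
Local Notation pinv := (pinv q).
Variables (X : vfield M) (Phi : R -> M -> M).
Hypothesis PhiX : is_flow X Phi.
Variables (tau : R) (f : R -> R).
Hypothesis S : saddle q tau f (Phi 1).
Local Notation velocity := (velocity q X).

Let Phi0 x : Phi 0 x = x. Proof. by case: (PhiX x). Qed.

Let Phic x : continuous (Phi ^~ x). Proof. by case: (PhiX x) => _ []. Qed.

Let comm t x : 0 <= t -> Phi t (Phi 1 x) = Phi 1 (Phi t x).
Proof. exact: flow_comm. Qed.

(** The flow commutes with [Phi 1], so it moves a fixed point of [Phi 1] continuously among its
    fixed points; an isolated one cannot move. *)
Lemma flow_fixed (r t : R) : r = 0 \/ r = 1 -> 0 <= t -> Phi t (axis r) = axis r.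
Proof.
move=> r01 t0.
have rfix : Phi 1 (axis r) = axis r.
  by case: r01 => ->; [exact: saddle_fix0 S|exact: saddle_fix1 S].
have [A NA Afix] := saddle_isolated S r01.
apply: (@segment_locally_constant _ t (fun t => Phi t (axis r) = axis r)) => //.
- move=> s s0 _ E.
  have N : \forall u \near s, A (Phi u (axis r)) by apply: Phic; rewrite E.
  apply: filterS N => u Au u0 _; apply: Afix => //.
  by rewrite -comm// rfix.
- move=> s s0 _ E; have c : {for s, continuous (fun _ : R => axis r)} by exact: cvg_cst.
  have N := neq_near (g1 := Phi ^~ (axis r)) (@Phic (axis r) s) c E.
  by apply: filterS N => u h _ _.
Qed.

Lemma velocity_fixed (r : R) : r = 0 \/ r = 1 -> velocity (r *: e0) = 0.
Proof.
move=> r01; have r4 : `|r| <= 4.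
  by case: r01 => ->; rewrite ?normr0 ?normr1; real_arith.
have qr : cdom q (axis r) by apply: pinv_dom; rewrite axis_norm.
apply/rowP => i; rewrite [RHS]mxE.
apply: (velocity_rightE PhiX qr).
suff : nbhs (0:R) (fun t => 0 < t -> (pmap (Phi t (axis r)) 0 i - pmap (axis r) 0 i) / t = 0) by [].
have := lt_nbhsl (ltr01 : (0:R) < 1); apply: filterS => t _ t0.
by rewrite flow_fixed ?ltW// subrr mul0r.
Qed.

Lemma near_norm_lt (v : vec) (r : R) (u : vec) : `|v - u| < r -> \forall w \near v, `|w - u| < r.
Proof.
move=> h; have c : {for v, continuous (fun w : vec => `|w - u|)}.
  apply: (@continuous_comp _ _ _ (fun w : vec => w - u) (fun w => `|w|)).
    exact: (@cvgB R vec _ (nbhs v) _ id (fun=> u) v u cvg_id (cvg_cst _)).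
  exact: norm_continuous.
exact: c _ (lt_nbhsl h).
Qed.

(** X vanishes at 0 and inherits the scaling of the saddle, so the ratio argument used for the
    coordinates of a root applies to its components. *)
Lemma velocity_near0 : exists k de : R, 0 < de /\ forall x, 0 < x -> x < de ->
  velocity (x *: e0) = (k * x) *: e0.
Proof.
have /andP[t0 t1] := sd_tau S.
have v0 : velocity 0 = 0 by have := velocity_fixed (or_introl erefl); rewrite scale0r.
have n0 : `|0 : vec| <= 4 by rewrite normr0.
have D i : exists d : R, velocity (x *: e0) 0 i / x @[x --> 0^'+] --> d.
  have [d dP] := velocity_derive (q := q) e0 i n0 v0; exists d.
  suff <- : (fun x => velocity (0 + x *: e0) 0 i / x) = (fun x => velocity (x *: e0) 0 i / x) by [].
  by apply/funext => x; rewrite add0r.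
pose a := (1 + tau)^-1.
have a0 : 0 < a by rewrite invr_gt0; real_arith.
have a1 : a < 1 by rewrite invf_lt1; real_arith.
have aK : (1 + tau) * a = 1 by rewrite divff// gt_eqF//; real_arith.
pose kk (i : 'I_m.+1) : R := if i == 0 then 1 + tau else 1 - tau.
have LE x i : 0 < x -> x < 3^-1 ->
    velocity (x *: e0) 0 i = kk i * velocity ((a * x) *: e0) 0 i.
  move=> x0 x3.
  have axx : a * x <= x by rewrite ler_piMl// ltW.
  have axn : `|(a * x) *: e0| < 3^-1.
    by rewrite axis_norm ger0_norm ?mulr_ge0 ?ltW//; real_arith.
  have <- : saddle_linear tau ((a * x) *: e0) = x *: e0.
    apply/rowP => j; rewrite saddle_linearE !mxE !eqxx.
    by case: (j == 0); rewrite ?mulr1 ?mulr0// mulrA aK mul1r.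
  apply: (velocity_equivariant (q := q) PhiX (k := kk) (b := fun=> 0) (phi := Phi 1)) => //.
  - move=> v j; rewrite saddle_linearE add0r /kk.
    by case: eqVneq => [->|_].
  - by real_arith.
  - have : `|(a * x) *: e0 - 0| < 3^-1 by rewrite subr0.
    move=> /near_norm_lt; apply: filterS => v; rewrite subr0 => v3; split.
      apply: le_trans (saddle_linear_norm _ (sd_tau S)) _; real_arith.
    by apply: (sd_near0 S); exact: ltW.
have [k kP] := D 0.
exists k, 3^-1; split; first by rewrite invr_gt0.
move=> x x0 x3; apply/rowP => i; have [di diP] := D i.
have -> : ((k * x) *: e0) 0 i = k * x * (i == 0)%:R by rewrite mxE delta00.
case: (eqVneq i 0) => [->|i0].
  rewrite mulr1.
  apply: (@ratio_linear _ (fun x => velocity (x *: e0) 0 0) a a k 3^-1) => //.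
  by move=> {x0 x3}x x0 x3; rewrite (LE x)// /kk eqxx mulrA [a * (1 + _)]mulrC aK mul1r.
rewrite mulr0.
have k1 : 1 < (1 - tau)^-1 by rewrite invf_gt1; real_arith.
apply: (@ratio_zero _ (fun x => velocity (x *: e0) 0 i) a (1 - tau)^-1 di 3^-1) => //;
  try by real_arith.
move=> {x0 x3}x x0 x3; rewrite (LE x)// /kk (negPf i0).
by rewrite mulKf// gt_eqF//; real_arith.
Qed.

Lemma flow_near0 : exists k de : R, 0 < de /\ forall x, 0 < x -> x < de ->
  forall t, 0 <= t -> t <= 1 -> Phi t (axis x) = axis (expR (k * t) * x).
Proof.
have [k [de [de0 kP]]] := velocity_near0.
pose de' := Num.min de 1.
have de'0 : 0 < de' by rewrite lt_min de0 ltr01.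
exists k, (de' / expR `|k|); split; first by rewrite divr_gt0// expR_gt0.
move=> x x0 xd t t0 t1.
have := @explicit_curve _ _ _ q X Phi PhiX 0 1 k de' _ x x0 _ t t0 t1.
rewrite add0r !mul1r add0r; apply.
- move=> y y0; rewrite lt_min => /andP[yd y1]; rewrite add0r !mul1r; split.
    by rewrite ger0_norm ?ltW//; real_arith.
  exact: kP.
- by rewrite mulrC -ltr_pdivlMr// expR_gt0.
Qed.

(** A point of the segment is an iterate under [Phi 1] of a point near 0, which flows along the
    axis; since the flow commutes with [Phi 1], the velocity is axial on the whole open segment. The
    homothety at e_0 alone could not give this there. *)
Lemma flow_axis x i : unit_pt x -> i != 0 -> velocity (x *: e0) 0 i = 0.
Proof.
move=> ux i0; have fI := sd_interval S.
have [k [de [de0 kP]]] := flow_near0.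
(* The second bound keeps [expR (k * t) * z] below 1 for all [t] in [0, 1]. *)
pose de' := Num.min de (expR (- `|k|)).
have de'0 : 0 < de' by rewrite lt_min de0 expR_gt0.
have [n [z [uz zd E]]] := im_reach_down fI ux de'0.
have [z0 z1] := uz.
have [zd1 zd2] : z < de /\ z < expR (- `|k|) by move: zd; rewrite lt_min => /andP.
have itc t y : 0 <= t -> Phi t (iter n (Phi 1) y) = iter n (Phi 1) (Phi t y).
  by move=> t0; elim: n {E} => //= n IH; rewrite comm// IH.
have ax t : 0 <= t -> t <= 1 -> pmap (Phi t (axis x)) 0 i = 0.
  move=> t0 t1; rewrite -E -(saddle_iter_axis S)// itc// kP//.
  have uy : unit_pt (expR (k * t) * z).
    split; first by rewrite mulr_gt0// expR_gt0.
    apply: (@lt_le_trans _ _ (expR (k * t) * expR (- `|k|))); first by rewrite ltr_pM2l ?expR_gt0.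
    rewrite -expRD -expR0 ler_expR subr_le0; apply: le_trans (ler_norm _) _.
    by rewrite normrM (ger0_norm t0) ler_piMr.
  rewrite (saddle_iter_axis S)// pmap_axis; last by apply/unit_norm/(im_iter_unit fI).
  by rewrite mxE delta00 (negPf i0) mulr0.
have qx : cdom q (axis x) by apply: pinv_dom; rewrite axis_norm; exact: unit_norm.
apply: (velocity_rightE PhiX qx).
suff : nbhs (0:R) (fun t => 0 < t -> (pmap (Phi t (axis x)) 0 i - pmap (axis x) 0 i) / t = 0) by [].
have := lt_nbhsl (ltr01 : (0:R) < 1); apply: filterS => t t1 t0.
by rewrite ax ?ltW// -(Phi0 (axis x)) ax// subrr mul0r.
Qed.

Lemma velocity_near1 : exists k de : R, 0 < de /\ forall x, 0 < x -> x < de ->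
  velocity ((1 - x) *: e0) = (k * x) *: e0.
Proof.
have /andP[t0 t1] := sd_tau S.
have v1 : velocity e0 = 0 by have := velocity_fixed (or_intror erefl); rewrite scale1r.
have E1 x : e0 + x *: - e0 = (1 - x) *: e0 by rewrite scalerN scalerBl scale1r.
have [k kP] : exists d : R, velocity ((1 - x) *: e0) 0 0 / x @[x --> 0^'+] --> d.
  have [d dP] := velocity_derive (q := q) (- e0) 0 e0_le4 v1; exists d.
  suff <- : (fun x => velocity (e0 + x *: - e0) 0 0 / x) =
    (fun x => velocity ((1 - x) *: e0) 0 0 / x) by [].
  by apply/funext => x; rewrite E1.
exists k, 3^-1; split; first by rewrite invr_gt0.
move=> x x0 x3; apply/rowP => i.
have -> : ((k * x) *: e0) 0 i = k * x * (i == 0)%:R by rewrite mxE delta00.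
case: (eqVneq i 0) => [->|i0]; last first.
  by rewrite mulr0; apply: flow_axis => //; split; real_arith.
rewrite mulr1.
apply: (@ratio_linear _ (fun x => velocity ((1 - x) *: e0) 0 0) (1 - tau) (1 - tau) k 3^-1) => //;
  try by real_arith.
move=> {x0 x3}x x0 x3.
pose T (v : vec) : vec := e0 + (1 - tau) *: (v - e0).
have E2 : (1 - x) *: e0 - e0 = (- x) *: e0.
  by rewrite scalerBl scale1r addrAC subrr add0r scaleNr.
have <- : T ((1 - x) *: e0) = (1 - (1 - tau) * x) *: e0.
  by rewrite /T E2 scalerA mulrN scaleNr [RHS]scalerBl scale1r.
apply: (velocity_equivariant (q := q) PhiX (k := fun=> 1 - tau)
  (b := fun i => e0 0 i - (1 - tau) * e0 0 i) (phi := Phi 1)) => //.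
- by move=> v j; rewrite /T !mxE; ring.
- by rewrite axis_norm ger0_norm; real_arith.
- have : `|(1 - x) *: e0 - e0| < 3^-1 by rewrite E2 axis_norm normrN gtr0_norm.
  move=> /near_norm_lt; apply: filterS => v v3; split.
    apply: le_trans (ler_normD _ _) _; rewrite normrZ ger0_norm; last by real_arith.
    have := @norm_delta0 R m; have := normr_ge0 (v - e0); move: v3.
    by move: `|v - e0| `|e0| => y z h1 h2 h3; real_nonlin.
  have := sd_near1 S (ltW v3); rewrite addrC subrK => ->.
  by rewrite /T.
Qed.

Lemma flow_near1 : exists b de : R, 0 < de /\ forall x, 0 < x -> x < de ->
  pmap (Phi 2^-1 (axis (1 - x))) 0 0 = 1 - b * x.
Proof.
have [k [de [de0 kP]]] := velocity_near1.
pose de' := Num.min de 1.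
have de'0 : 0 < de' by rewrite lt_min de0 ltr01.
exists (expR (- k * 2^-1)), (de' / expR `|- k|); split; first by rewrite divr_gt0// expR_gt0.
move=> x x0 xd.
have hx : expR `|- k| * x < de' by rewrite mulrC -ltr_pdivlMr// expR_gt0.
have H y : 0 < y -> y < de' -> `|1 + -1 * y| <= 4 /\
    velocity ((1 + -1 * y) *: e0) = (-1 * - k * y) *: e0.
  move=> y0; rewrite lt_min => /andP[yd y1]; rewrite mulN1r mulrNN mul1r; split.
    by rewrite ger0_norm; real_arith.
  exact: kP.
have := @explicit_curve _ _ _ q X Phi PhiX 1 (-1) (- k) de' H x x0 hx 2^-1.
rewrite !mulN1r => -> //; try by real_arith.
rewrite pmap_axis0//.
have h : expR (- k * 2^-1) <= expR `|- k|.
  rewrite ler_expR; apply: le_trans (ler_norm _) _.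
  by rewrite normrM ler_piMr// ger0_norm; real_arith.
have := expR_gt0 (- k * 2^-1); move: hx h; rewrite lt_min => /andP[_].
move: (expR `|- k|) (expR (- k * 2^-1)) => y z h1 h2 h3.
have : 0 < z * x by rewrite mulr_gt0.
have : z * x <= y * x by rewrite ler_wpM2r// ltW.
by move=> h4 h5; rewrite ger0_norm; real_arith.
Qed.

Lemma autonomous_good_root : good_root q tau (Phi 1) (Phi 2^-1).
Proof.
split; [exact: flow_half| |exact: flow_near1].
have [k [de [de0 kP]]] := flow_near0; have /andP[t0 t1] := sd_tau S.
(* At time 1 the flow is the saddle, which multiplies by [1 + tau] on the axis near 0; at time 1/2
   the factor is then the square root. *)
have kE : expR k = 1 + tau.
  pose x := Num.min (de / 2) 4^-1 / (expR k + 1).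
  have ek0 := expR_gt0 k.
  have m0 : 0 < Num.min (de / 2) 4^-1 by rewrite lt_min; apply/andP; split; real_arith.
  have m1 : Num.min (de / 2) 4^-1 <= de / 2 by rewrite ge_min lexx.
  have m2 : Num.min (de / 2) 4^-1 <= 4^-1 by rewrite ge_min lexx orbT.
  have x0 : 0 < x by rewrite divr_gt0//; real_arith.
  have dx : expR k * x + x = Num.min (de / 2) 4^-1.
    by rewrite -[X in _ + X]mul1r -mulrDl mulrC divfK// gt_eqF//; real_arith.
  have ekx : 0 < expR k * x by rewrite mulr_gt0.
  have ux : unit_pt x by split=> //; real_arith.
  have xd : x < de by real_arith.
  have := kP x x0 xd 1 ler01 (lexx _).
  rewrite mulr1 (sd_axis S)// (saddle_f_near0 S)//; last by real_arith.
  move/axis_inj => E; apply/esym/(mulIf (lt0r_neq0 x0)); apply: E.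
    by rewrite ger0_norm ?mulr_ge0//; [real_nonlin|real_arith|exact: ltW].
  by rewrite ger0_norm ?ltW//; real_arith.
exists de => // x x0 xd; rewrite (kP x x0 xd); [|by real_arith|by real_arith].
congr axis; congr (_ * _).
have -> : 1 + tau = expR (k * 2^-1) ^+ 2 by rewrite -kE -expRM_natl; congr expR; field.
by rewrite sqrtr_sqr ger0_norm// expR_ge0.
Qed.

End AutonomousRoot.

(** * Existence of saddles without square roots *)

Lemma cube_exists (R : realType) (n : nat) (M : smoothManifold R n) (x : M) :
  inhabited (cube M).
Proof.
have [c Ac cx] := atlas_cover x.
have : nbhs (cmap c x) (cmap c @` cdom c).
  by apply: open_nbhs_nbhs; split; [exact: cimg_open|exists x].
move=> /nbhs_ballP[e /= e0 eP].
(* The scale [e / 8] sends the cube of radius 4 into radius [e / 2], inside the chart. *)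
have sub (w : 'rV[R]_n) : `|w| <= 4 -> (cmap c @` cdom c) ((e / 8) *: w + cmap c x).
  move=> w4; apply: eP; rewrite -ball_normE /= opprD addrCA subrr addr0 normrN normrZ.
  rewrite ger0_norm; last by rewrite divr_ge0// ltW.
  have : e / 8 * `|w| <= e / 8 * 4 by rewrite ler_wpM2l// divr_ge0// ltW.
  by move: `|w| => y h; lra.
by split; exact: (Cube Ac (divr_gt0 e0 (ltr0n R 8)) sub).
Qed.

Lemma small_multiple_lipschitz (R : realType) (n : nat) (U : 'rV[R]_n -> 'rV[R]_n) r :
  smooth_on setT U -> (forall x : 'rV[R]_n, r <= `|x| -> U x = 0) ->
  exists2 a : R, 0 < a & forall b, 0 <= b -> b <= a ->
    forall v w, `|b *: U v - b *: U w| <= 4^-1 * `|v - w|.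
Proof.
move=> Us U0; have [C C0 lU] := smooth_support_lipschitz Us U0.
have C1 : 0 < 4 * (C + 1) by rewrite mulr_gt0// ltr_wpDl.
exists (4 * (C + 1))^-1 => [|b b0 ba v w]; first by rewrite invr_gt0.
have bC : b * C <= 4^-1.
  have : b * (4 * (C + 1)) <= 1 by rewrite -ler_pdivlMr// mul1r.
  by move: b0; clear -C0; nra.
rewrite -scalerBr normrZ ger0_norm//.
apply: (@le_trans _ _ (b * (C * `|v - w|))); first by rewrite ler_wpM2l.
by rewrite mulrA ler_wpM2r.
Qed.

Section NoRoot.
Context {R : realType} {m : nat} {M : smoothManifold R m.+1} (q : cube M).

(** The common obstruction: a square of a diffeomorphism and an autonomous map would both produce a
    good root. *)
Definition rigid_saddle (phi : M -> M) :=
  exists tau f, saddle q tau f phi /\ forall psi, ~ good_root q tau phi psi.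

Lemma rigid_saddle_square (phi psi : diffc M) : rigid_saddle phi ->
  (phi : M -> M) <> (psi : M -> M) \o (psi : M -> M).
Proof.
move=> [tau [f [S H]]] E; apply: (H psi); apply: (diffeo_good_root S) => x.
by rewrite E.
Qed.

Lemma rigid_saddle_autonomous (phi : diffc M) : rigid_saddle phi -> ~ autonomous M phi.
Proof.
move=> [tau [f [S H]]] [X _]; rewrite /vexp /flow; case: xgetP => [Phi _ PhiX|_] E.
  have S1 : saddle q tau f (Phi 1) by rewrite E.
  by apply: (H (Phi 2^-1)); rewrite -E; exact: (autonomous_good_root PhiX S1).
(* Default value: without a flow [vexp X] is the identity, whereas a saddle moves [axis 2^-1]. *)
have u : unit_pt (2^-1 : R) by split; lra.
have := sd_axis S u; rewrite -E => /axis_inj E2.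
have uf := im_unit (sd_interval S) u.
have := im_gt (sd_interval S) u.
by rewrite -E2 ?ltxx//; exact: unit_norm.
Qed.

Lemma rigid_saddle_exists (A : set (diffc M)) : open A -> A (diffc_id M) ->
  exists phi : diffc M, [/\ A phi, diffc0 M phi & rigid_saddle phi].
Proof.
move=> oA A1.
have fs := @field_smooth R m; have f0 := @field_eq0 R m.
have oT := @openT 'rV[R]_m.+1.
have Z0 : smooth_on setT (fun _ : 'rV[R]_m.+1 => 0 : 'rV[R]_m.+1).
  apply/(smooth_on_coordP _ oT) => k j; under eq_fun do rewrite mxE.
  exact: Ck_cst.
have [a a0 lf] := small_multiple_lipschitz fs f0.
have [|||e e0 eP] := small_isotopy (q := q) (d0 := diffc_id M) Z0 fs _ f0 _ _ oA A1.
- by [].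
- by move=> v w; rewrite subrr normr0 mulr_ge0// invr_ge0.
- by apply/funext => x; rewrite -[LHS](push_id q); congr push; apply/funext => w; rewrite addr0.
(* [e] keeps the map in [A], [2^-1] ensures [tau < 1], and [a] makes the perturbation 1/4-Lipschitz,
   which leaves a quarter for the kick. *)
pose tau := Num.min (Num.min e 2^-1) a.
have tau0 : 0 < tau by rewrite !lt_min e0 a0 invr_gt0 ltr0n.
have taue : tau <= e by rewrite !ge_min lexx.
have tau1 : tau < 1 by rewrite !gt_min; apply/orP; left; apply/orP; right; lra.
have taua : tau <= a by rewrite ge_min lexx orbT.
have ltau := lf tau (ltW tau0) taua.
have [phi0 [phi0E Aphi0 cphi0]] := eP tau (ltW tau0) taue.
have {phi0E} phi0E : (phi0 : M -> M) = push q (fun w => w + tau *: field w).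
  by rewrite phi0E; congr push; apply/funext => w; rewrite add0r.
have kick0 s t (w : 'rV[R]_m.+1) : kicked_field tau 0 s t w = tau *: field w.
  by rewrite /kicked_field scale0r addr0.
have S0 t : t <= 2 * 3^-1 -> saddle q tau (@axis_map R m tau 0 2^-1 t) phi0.
  move=> tl.
  have := @explicit_saddle R m M q tau 0 2^-1 t tau0 tau1 (lexx _) _ tl _.
  rewrite phi0E; under eq_fun do rewrite kick0.
  apply; first by lra.
  move=> v w; rewrite !kick0; apply: le_trans (ltau v w) _.
  by rewrite ler_wpM2r//; lra.
(* Without a good root the first saddle is already rigid; otherwise its root determines where to
   kick. *)
have [[psi0 G0]|noroot] := pselect (exists psi, good_root q tau phi0 psi); last first.
  exists phi0; split => //; exists tau, (@axis_map R m tau 0 2^-1 2^-1); split.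
    by apply: S0; lra.
  by move=> psi G; apply: noroot; exists psi.
have h12 : 2^-1 <= 2 * 3^-1 :> R by lra.
have [t [t0 t1 rig]] := good_root_rigidity (S0 2^-1 h12) G0.
have ks := @kick_smooth R m 2^-1 t; have k0 := @kick_eq0 R m 2^-1 t.
have [c c0 lk] := small_multiple_lipschitz ks k0.
have ts : smooth_on setT (fun w : 'rV[R]_m.+1 => tau *: field w).
  suff <- : kicked_field tau 0 2^-1 t = (fun w : 'rV[R]_m.+1 => tau *: field w).
    exact: kicked_field_smooth.
  by apply/funext => w; exact: kick0.
have tz (w : 'rV[R]_m.+1) : 3 <= `|w| -> tau *: field w = 0 by move=> /f0 ->; rewrite scaler0.
have [e' e'0 e'P] := small_isotopy ts ks tz k0 ltau phi0E oA Aphi0.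
pose sigma := Num.min e' c.
have sigma0 : 0 < sigma by rewrite lt_min e'0 c0.
have sigmae : sigma <= e' by rewrite ge_min lexx.
have sigmac : sigma <= c by rewrite ge_min lexx orbT.
have [phi1 [phi1E Aphi1 cphi1]] := e'P sigma (ltW sigma0) sigmae.
have S1 : saddle q tau (@axis_map R m tau sigma 2^-1 t) phi1.
  rewrite phi1E; apply: explicit_saddle => //; [exact: ltW|by lra|exact: ltW|].
  move=> v w; rewrite /kicked_field opprD addrACA.
  apply: le_trans (ler_normD _ _) _.
  have := ltau v w; have := lk sigma (ltW sigma0) sigmac v w.
  by move: `|_ - tau *: _| `|_ - sigma *: _| `|v - w| => x y z; lra.
exists phi1; split => //.
  exact: connected_component_trans cphi0 cphi1.
exists tau, (@axis_map R m tau sigma 2^-1 t); split => // psi1 G1.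
(* Strictly between 1/2 and [t] the kick is positive, so the interval maps differ there, against
   rigidity. *)
pose x := (2^-1 + t) / 2 : R.
have x1 : 2^-1 < x by rewrite /x; lra.
have x2 : x < t by rewrite /x; lra.
have x3 : `|x| <= 2 by rewrite ger0_norm; lra.
have : @axis_map R m tau 0 2^-1 2^-1 x = @axis_map R m tau sigma 2^-1 t x.
  apply: (rig _ _ _ S1 _ G1); last by split; lra.
  move=> y hy; rewrite /axis_map /kicked_field scale0r.
  rewrite (@kick_eq0_out _ _ 2^-1 t) ?scaler0//.
  by rewrite !mxE !eqxx mulr1.
have : 0 < sigma * (bump (x - 2^-1) * bump (t - x)).
  by rewrite mulr_gt0// mulr_gt0// bump_gt0 subr_gt0.
by rewrite !axis_mapE// mul0r => h1 h2; lra.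
Qed.

End NoRoot.

Theorem theorem2 (R : realType) (n : nat) (n_gt0 : (0 < n)%N)
    (M : smoothManifold R n) (M_neq0 : [set: M] !=set0)
    (W : set (diffc M))
    (W_open : exists2 O : set (diffc M), open O & W = O `&` diffc0 M)
    (W_id : W (diffc_id M)) :
  (exists2 phi : diffc M, W phi &
     forall psi : diffc M, (phi : M -> M) <> (psi : M -> M) \o (psi : M -> M)) /\
  (W `\` autonomous M !=set0).
Proof.
(* Positive dimension provides the coordinate 0 of the axis, and a point of M provides a cube. *)
case: n n_gt0 M M_neq0 W W_open W_id => // m _ M [x _] W [A oA ->] [A1 _].
have [q] := cube_exists x.
have [phi [Aphi cphi rphi]] := rigid_saddle_exists q oA A1.
split; exists phi => //.
  by move=> psi; exact: rigid_saddle_square rphi.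
by split=> //; exact: rigid_saddle_autonomous rphi.
Qed.
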